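(* Consider families of discretizations (with discretization widths $\delta_\xi,\delta_\alpha,\delta_x>0$) as described in the context. Let $\delta_\xi\to0$, $\frac{\delta_x}{\delta_\xi}\to0$ and $\frac{\delta_\alpha}{\delta_\xi}\to0$. Then $\|\mathcal{F}-\mathcal{F}_{\delta_\xi,\delta_\alpha}^{\delta_x}\|\to0$ and $\|\mathcal{F}^*-(\mathcal{F}_{\delta_\xi,\delta_\alpha}^{\delta_x})^*\|\to0$ in the respective operator norms (for operators $L^2(\Omega)\to L^2(\Omega')$ and $L^2(\Omega')\to L^2(\Omega)$). If, additionally, $\delta_\alpha=\mathcal{O}(\delta_\xi^{1+\epsilon})$ and $\delta_x=\mathcal{O}(\delta_\xi^{1+\epsilon})$ for some $\epsilon\in{]{0,\frac12}[}$, then $\|\mathcal{F}-\mathcal{F}_{\delta_\xi,\delta_\alpha}^{\delta_x}\|=\mathcal{O}(\delta_\xi^\epsilon)$ and $\|\mathcal{F}^*-(\mathcal{F}_{\delta_\xi,\delta_\alpha}^{\delta_x})^*\|=\mathcal{O}(\delta_\xi^\epsilon)$, where $\delta_\xi\le\frac43(\sqrt2-1)$ and $\delta_x<\sqrt2(R_E-1)$.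
   Context: Geometry: fixed reals $R_E>1$ (distance from source to origin), $R>R_E+1$ (distance from source to detector), detector width $W=\frac{2R}{\sqrt{R_E^2-1}}$. Let $\Omega=B(0,1)\subset\mathbb{R}^2$ and $\Omega'={]{-\frac W2,\frac W2}[}\times S^1$; functions on $\Omega$ (resp. $\Omega'$) are extended by zero to $\mathbb{R}^2$ (resp. $\mathbb{R}\times S^1$). $S^1$ is identified with $[-\pi,\pi[$ via $\vartheta(\alpha)=(\cos\alpha,\sin\alpha)$ (angles modulo $2\pi$, arc-length measure); $\vartheta(\alpha)^\perp=(-\sin\alpha,\cos\alpha)$. Fanbeam transform: $[\mathcal{F}f](\xi,\alpha)=\sqrt{\xi^2+R^2}\int_{\mathbb{R}}f\bigl(t(\xi\vartheta(\alpha)+R\vartheta(\alpha)^\perp)-R_E\vartheta(\alpha)^\perp\bigr)\,dt$, a linear continuous operator $L^2(\Omega)\to L^2(\Omega')$ (by continuous extension); $(\cdot)^*$ denotes Hilbert space adjoints. Discretization. Offsets: $P\in\mathbb{N}$, $\delta_\xi=\frac WP$, $\xi_p=\delta_\xi\bigl(p-\frac{P+1}{2}\bigr)$, $\Xi_p=[\xi_p-\frac{\delta_\xi}{2},\xi_p+\frac{\delta_\xi}{2}[$, $p=1,\dots,P$. Angles: $\alpha_1<\dots<\alpha_Q$ in $[-\pi,\pi[$, $\alpha_0=\alpha_Q-2\pi$, $\alpha_{Q+1}=\alpha_1+2\pi$, $\Phi_q=[\frac{\alpha_{q-1}+\alpha_q}{2},\frac{\alpha_q+\alpha_{q+1}}{2}[$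 modulo $2\pi$, $\delta_\alpha=\max_{q=1,\dots,Q}(\alpha_{q+1}-\alpha_q)$, $\vartheta_q=\vartheta(\alpha_q)$, $\vartheta_q^\perp=\vartheta(\alpha_q)^\perp$. Image grid: $N,M\in\mathbb{N}$, $\delta_x>0$, $x_{ij}=\delta_x\bigl(i-\frac{N+1}{2},j-\frac{M+1}{2}\bigr)$, $X_{ij}=x_{ij}+[-\frac{\delta_x}{2},\frac{\delta_x}{2}[^2$, $i=1,\dots,N$, $j=1,\dots,M$. Standing assumptions: $\Omega$ is contained in the union of all $X_{ij}$, and $0<\delta_x<\frac{1}{\sqrt2}(R_E-1)$, so that $|x_{ij}|<R_E$ whenever $\Omega\cap X_{ij}\neq\emptyset$. Let $w_{\delta_\xi}(\tau)=\max(0,\delta_\xi-|\tau|)$. Fully discrete fanbeam transform: for $f\in L^2(\Omega)$, $$[\mathcal{F}_{\delta_\xi,\delta_\alpha}^{\delta_x}f](\xi,\alpha)=\frac{1}{\delta_\xi^2}\sum_{p=1}^P\sum_{q=1}^Q\chi_{\Xi_p}(\xi)\chi_{\Phi_q}(\alpha)\sqrt{\xi_p^2+R^2}\sum_{i,j}w_{\delta_\xi}\Bigl(\frac{x_{ij}\cdot\vartheta_q\,R}{x_{ij}\cdot\vartheta_q^\perp+R_E}-\xi_p\Bigr)\frac{\int_{X_{ij}}f(x)\,dx}{x_{ij}\cdot\vartheta_q^\perp+R_E},$$ where the sum is over those $(i,j)$ with $|x_{ij}|<R_E$ (all other pixels do not meet $\Omega$ and do not contribute). It is regarded as an operator $L^2(\Omega)\to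 L^2(\Omega')$. *)

(* Defs.v *)
From HB Require Import structures.
From mathcomp Require Import all_boot all_order all_algebra.
From mathcomp Require Import all_classical all_reals all_analysis.
From mathcomp Require Import measurable_realfun.
From mathcomp Require Import ring lra.

Set Implicit Arguments.
Unset Strict Implicit.
Unset Printing Implicit Defensive.

Import Order.TTheory GRing.Theory Num.Theory.
Import numFieldNormedType.Exports.

Local Open Scope classical_set_scope.
Local Open Scope ring_scope.

(* Real L^2 spaces. [L2 mu] consists of representatives: measurable functions
   with finite L^2 norm; elements of the Hilbert space are represented up to
   equality mu-almost everywhere, so linearity of operators is required almost
   everywhere. *)
Notation L2 mu := (LfunType mu (lee1n 2)).

Section L2_space.
Context d1 (T1 : measurableType d1) (R : realType).
Variable mu : {measure set T1 -> \bar R}.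

Definition L2norm (f : L2 mu) : \bar R := 'N[mu]_2%:E[EFin \o f].

Definition L2inner (f g : L2 mu) : R := \int[mu]_x (f x * g x).

End L2_space.

Section L2_operators.
Context d1 d2 (T1 : measurableType d1) (T2 : measurableType d2) (R : realType).
Variables (mu : {measure set T1 -> \bar R}) (nu : {measure set T2 -> \bar R}).

Definition L2linear (A : L2 mu -> L2 nu) : Prop :=
  forall (a : R) (f g : L2 mu), A (a *: f + g) = a *: A f + A g %[ae nu].

Definition L2bounded (A : L2 mu -> L2 nu) : Prop :=
  exists C : R, forall f : L2 mu, (L2norm (A f) <= C%:E * L2norm f)%E.

Definition opnorm (A : L2 mu -> L2 nu) : \bar R :=
  ereal_sup [set L2norm (A f) | f in [set f : L2 mu | (L2norm f <= 1)%E]].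

Definition opdist (A B : L2 mu -> L2 nu) : \bar R := opnorm (fun f => A f - B f).

Definition is_adjoint (A : L2 mu -> L2 nu) (B : L2 nu -> L2 mu) : Prop :=
  forall (f : L2 mu) (g : L2 nu), L2inner (A f) g = L2inner f (B g).

End L2_operators.

Section geometry.
Context {R : realType}.
Implicit Types (RE RD : R).

Local Notation RR := (measurableTypeR R).

Definition leb2 := ((@lebesgue_measure R) \x (@lebesgue_measure R))%E.

Definition euclid2 (x : R * R) : R := Num.sqrt (x.1 ^+ 2 + x.2 ^+ 2).

Definition Omega : set (RR * RR) := [set x | euclid2 x < 1].

Definition detector_width RE RD : R := 2 * RD / Num.sqrt (RE ^+ 2 - 1).

(* The circle is represented by the angles in [-pi, pi[. *)
Definition Omega' RE RD : set (RR * RR) :=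
  `](- (detector_width RE RD / 2)), (detector_width RE RD / 2)[%classic
  `*` `[(- pi), pi[%classic.

Lemma measurable_Omega : measurable Omega.
Proof.
have m1 : measurable_fun [set: RR * RR] (fun x => euclid2 x).
  have msqrt : measurable_fun [set: R] (@Num.sqrt R).
    exact: (continuous_measurable_fun (@sqrt_continuous R)).
  apply: (measurableT_comp msqrt).
  by apply: measurable_funD; apply: measurable_funX;
    [exact: measurable_fst|exact: measurable_snd].
have mO := measurable_fun_ltr m1 (@measurable_cst _ _ _ _ setT (1 : R)).
by have := mO measurableT [set true] I; rewrite setTI.
Qed.

Lemma measurable_Omega' RE RD : measurable (Omega' RE RD).
Proof. by apply: measurableX; exact: measurable_itv. Qed.

Definition mu_Omega := mrestr leb2 measurable_Omega.
Definition mu_Omega' RE RD := mrestr leb2 (measurable_Omega' RE RD).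

End geometry.

Notation L2Omega R := (L2 (@mu_Omega R)).
Notation L2Omega' RE RD := (L2 (mu_Omega' RE RD)).

Section fanbeam.
Context {R : realType}.
Implicit Types (RE RD : R).

Definition dot_theta (x : R * R) (a : R) : R := x.1 * cos a + x.2 * sin a.
Definition dot_theta_perp (x : R * R) (a : R) : R := - x.1 * sin a + x.2 * cos a.

(* t (xi theta(a) + RD theta(a)^perp) - RE theta(a)^perp in coordinates *)
Definition fan_ray RE RD (xi a t : R) : R * R :=
  (t * (xi * cos a - RD * sin a) + RE * sin a,
   t * (xi * sin a + RD * cos a) - RE * cos a).

(* [f \_ Omega] is the extension by zero. *)
Definition fanbeam_fun RE RD (f : R * R -> R) (y : R * R) : R :=
  Num.sqrt (y.1 ^+ 2 + RD ^+ 2) *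
  \int[lebesgue_measure]_t (f \_ Omega) (fan_ray RE RD y.1 y.2 t).

Definition Cc_Omega (f : R * R -> R) : Prop :=
  continuous f /\ closure [set x | f x != 0] `<=` (Omega : set (R * R)).

(* The fanbeam transform: the continuous extension to L^2(Omega) of the integral
   formula on the dense subspace of continuous functions with compact support in
   Omega; this determines F up to equality almost everywhere. *)
Definition is_fanbeam RE RD (F : L2Omega R -> L2Omega' RE RD) : Prop :=
  [/\ L2linear F, L2bounded F &
      forall f : L2Omega R, Cc_Omega f ->
        F f = fanbeam_fun RE RD f %[ae (mu_Omega' RE RD)]].

End fanbeam.

(* The numbers [nP], [nQ] of offsets and angles, the numbers [nN], [nM] of
   pixels, the pixel width [dx], and the angles [angle q] for 1 <= q <= nQ
   (other values are irrelevant). Indices start at 1. *)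
Record discretization (R : realType) := Discretization {
  nP : nat;
  nQ : nat;
  nN : nat;
  nM : nat;
  angle : nat -> R;
  delta_x : R
}.

Section discretization.
Context {R : realType}.
Implicit Types (RE RD : R) (D : discretization R).

Definition delta_xi RE RD D : R := detector_width RE RD / (nP D)%:R.

Definition xi_ RE RD D (p : nat) : R :=
  delta_xi RE RD D * (p%:R - (nP D).+1%:R / 2).

Definition Xi_ RE RD D (p : nat) : set R :=
  `[(xi_ RE RD D p - delta_xi RE RD D / 2),
    (xi_ RE RD D p + delta_xi RE RD D / 2)[%classic.

(* The periodic extension to the indices 0 and Q + 1. *)
Definition alpha_ D (q : nat) : R :=
  if q == 0%N then angle D (nQ D) - 2 * pi
  else if q == (nQ D).+1 then angle D 1 + 2 * pi
  else angle D q.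

Definition Phi_ D (q : nat) : set R :=
  [set a | exists k : int, a + k%:~R * (2 * pi) \in
    `[((alpha_ D q.-1 + alpha_ D q) / 2), ((alpha_ D q + alpha_ D q.+1) / 2)[].

(* The gaps are positive, hence the neutral element 0 of the maximum. *)
Definition delta_alpha D : R :=
  \big[Num.max/0]_(1 <= q < (nQ D).+1) (alpha_ D q.+1 - alpha_ D q).

Definition pixel_center D (i j : nat) : R * R :=
  (delta_x D * (i%:R - (nN D).+1%:R / 2), delta_x D * (j%:R - (nM D).+1%:R / 2)).

Definition pixel D (i j : nat) : set (measurableTypeR R * measurableTypeR R) :=
  `[((pixel_center D i j).1 - delta_x D / 2),
    ((pixel_center D i j).1 + delta_x D / 2)[%classic `*`
  `[((pixel_center D i j).2 - delta_x D / 2),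
    ((pixel_center D i j).2 + delta_x D / 2)[%classic.

Definition admissible RE D : Prop :=
  [/\ (0 < nP D)%N, (0 < nQ D)%N,
      (forall q, (1 <= q <= nQ D)%N -> - pi <= angle D q < pi) /\
      (forall q, (1 <= q < nQ D)%N -> angle D q < angle D q.+1),
      Omega `<=` \bigcup_(i in [set i | (1 <= i <= nN D)%N])
                 \bigcup_(j in [set j | (1 <= j <= nM D)%N]) pixel D i j &
      0 < delta_x D < (Num.sqrt 2)^-1 * (RE - 1)].

Definition w_ (delta tau : R) : R := Num.max 0 (delta - `|tau|).

Definition fanbeam_discr_fun RE RD D (f : R * R -> R) (y : R * R) : R :=
  (delta_xi RE RD D ^+ 2)^-1 *
  \sum_(1 <= p < (nP D).+1) \sum_(1 <= q < (nQ D).+1)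
    \1_(Xi_ RE RD D p) y.1 * \1_(Phi_ D q) y.2 *
    Num.sqrt (xi_ RE RD D p ^+ 2 + RD ^+ 2) *
    \sum_(1 <= i < (nN D).+1)
      \sum_(1 <= j < (nM D).+1 | euclid2 (pixel_center D i j) < RE)
      let x := pixel_center D i j in
      let s := dot_theta_perp x (alpha_ D q) + RE in
      w_ (delta_xi RE RD D) (dot_theta x (alpha_ D q) * RD / s - xi_ RE RD D p) *
      ((\int[leb2]_(z in pixel D i j) (f \_ Omega) z) / s).

Lemma measurable_Phi_ D q : measurable (Phi_ D q : set (measurableTypeR R)).
Proof.
rewrite /Phi_; set lo := (X in BLeft X); set hi := (X in Interval _ (BLeft X)).
have -> : [set a | exists k : int, a + k%:~R * (2 * pi) \in `[lo, hi[] =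
    \bigcup_(k in [set: int]) `[lo - k%:~R * (2 * pi), hi - k%:~R * (2 * pi)[%classic.
  apply/seteqP; split=> a /=.
    by move=> [k]; rewrite in_itv/= => ak; exists k => //=;
      rewrite in_itv/= lerBlDr ltrBrDr.
  by move=> [k _]; rewrite /= in_itv/= lerBlDr ltrBrDr => ak; exists k; rewrite in_itv.
apply: countable_bigcupT_measurable => [|k]; [exact: countableP|exact: measurable_itv].
Qed.

Lemma indic_Lfun_Omega' RE RD (A B : set (measurableTypeR R)) :
  measurable A -> measurable B ->
  (fun y : measurableTypeR R * measurableTypeR R => \1_A y.1 * \1_B y.2 : R)
    \in Lfun (mu_Omega' RE RD) 2%:E.
Proof.
move=> mA mB; have mAB : measurable (A `*` B) by exact: measurableX.
have -> : (fun y : measurableTypeR R * measurableTypeR R =>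
    \1_A y.1 * \1_B y.2 : R) = \1_(A `*` B).
  by apply/funext => y; rewrite !indicE in_setX; case: (_ \in A); case: (_ \in B);
    rewrite ?mulr1 ?mulr0.
rewrite inE; apply/andP; split; rewrite inE/=.
  exact: measurable_indic.
rewrite /finite_norm unlock poweR_lty//.
have -> : (fun x => `|(EFin \o \1_(A `*` B)) x| `^ 2%:R)%E =
    (fun x => (\1_(A `*` B) x : R)%:E).
  apply/funext => x /=; rewrite indicE; case: (_ \in _) => /=.
    by rewrite normr1 powR1.
  by rewrite normr0 powR0.
rewrite integral_indic// setIT.
rewrite (@le_lt_trans _ _ (leb2 (Omega' RE RD)))//.
  have mO := measurable_Omega' RE RD.
  by apply: (le_measure leb2); rewrite ?inE//; exact: measurableI.
rewrite /leb2 /Omega' product_measure1E//=; try exact: measurable_itv.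
rewrite !lebesgue_measure_itv/=.
by case: ifP => _; case: ifP => _; rewrite ?mul0e ?mule0 // -!EFinB -EFinM ltry.
Qed.

Lemma fanbeam_discr_Lfun RE RD D (f : R * R -> R) :
  fanbeam_discr_fun RE RD D f \in Lfun (mu_Omega' RE RD) 2%:E.
Proof.
pose c p q := (delta_xi RE RD D ^+ 2)^-1 * (Num.sqrt (xi_ RE RD D p ^+ 2 + RD ^+ 2) *
    \sum_(1 <= i < (nN D).+1)
      \sum_(1 <= j < (nM D).+1 | euclid2 (pixel_center D i j) < RE)
      let x := pixel_center D i j in
      let s := dot_theta_perp x (alpha_ D q) + RE in
      w_ (delta_xi RE RD D) (dot_theta x (alpha_ D q) * RD / s - xi_ RE RD D p) *
      ((\int[leb2]_(z in pixel D i j) (f \_ Omega) z) / s)).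
have -> : fanbeam_discr_fun RE RD D f =
    \sum_(1 <= p < (nP D).+1) \sum_(1 <= q < (nQ D).+1)
      c p q *: (fun y : measurableTypeR R * measurableTypeR R =>
        \1_(Xi_ RE RD D p) y.1 * \1_(Phi_ D q) y.2 : R).
  apply/funext => y; rewrite fct_sumE /fanbeam_discr_fun mulr_sumr.
  apply: eq_bigr => p _; rewrite fct_sumE mulr_sumr; apply: eq_bigr => q _.
  by rewrite -[RHS]/(_ * _) /c [RHS]mulrC !mulrA; congr (_ * _); ring.
have [h0 hZ] := Lfun_submod_closed (mu_Omega' RE RD) (lee1n 2).
have hD := (Lfun_addr_closed (mu_Omega' RE RD) (lee1n 2)).2.
apply: (big_ind (fun g => g \in Lfun _ _)) => // p _.
apply: (big_ind (fun g => g \in Lfun _ _)) => // q _.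
rewrite -[X in X \in _]addr0; apply: hZ => //.
apply: indic_Lfun_Omega'; first exact: measurable_itv.
exact: measurable_Phi_.
Qed.

Definition fanbeam_discr RE RD D (f : L2Omega R) : L2Omega' RE RD :=
  Lfun_Sub (lee1n 2) (fanbeam_discr_Lfun RE RD D f).

End discretization.

Arguments fanbeam_discr {R} RE RD D f.

(* Main.v *)
(** Let [d] be the offset width and [r] the sum of the pixel and angular widths
    divided by [d]. The discrete transform arises in two steps: the ray integral
    at offset [xi] is replaced by its average against the triangle [w_ d / d^2]
    centred at the midpoint of the offset cell, and the kernel of this average
    is replaced by one that is constant on pixels and angular cells. The second
    step costs [O(r)], since the triangle is [d^-2]-Lipschitz and the offset of
    the ray through a point moves by [O(r d)] inside a cell.

    The first step rests on the smoothing property of the transform. The mean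
    square of [g xi - g xi'] against a triangle of width [D] in [xi - xi'] is
    expressed, by polarization, through the kernels
    [N_D x y = \int_a tri D (offset x a - offset y a) / (srcdist x a * srcdist y a)].
    Integrating by parts in the angle yields
    [|N_d - N_D| <= C min (1 / |x - y|) (D / |x - y|^2)] for [d <= D], hence, by Schur's
    test and [d -> 0], a bound [O(D^(2 e))] for every [e < 1/2].

    Density of Lipschitz functions extends the estimate to all of [L^2]. For
    adjoints, apply it to [h = F^* g - F_d^* g], for which
    [|h|^2 = <(F - F_d) h, g>]. *)

Require Import Defs.
From HB Require Import structures.
From mathcomp Require Import all_boot all_order all_algebra.
From mathcomp Require Import all_classical all_reals all_analysis.
From mathcomp Require Import measurable_realfun.
From mathcomp Require Import ring lra.

Set Implicit Arguments.
Unset Strict Implicit.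
Unset Printing Implicit Defensive.

Import Order.TTheory GRing.Theory Num.Theory.
Import numFieldNormedType.Exports.

Local Open Scope classical_set_scope.
Local Open Scope ring_scope.

(** * Integrals under affine maps and rotations *)

(** The transform does not commute with translations of the plane, so its smoothing is not read off
    from a Fourier multiplier but from kernels in [x] and [y]. The kernel of a single width is of
    size [1 / |x - y|] and carries no small factor. A difference of two widths gains decay because
    all triangles have mass one, and the term that polarization leaves over, the mean square of the
    ray integrals, is the same for every width and cancels. The smaller width is auxiliary: only
    there does the Lipschitz constant of the function enter, and it tends to zero with the function
    fixed. The restriction [e < 1/2] comes from interpolating the two kernel bounds to
    [D^(2 e) / |x - y|^(1 + 2 e)], which is integrable near the diagonal of the plane exactly then.

    Apart from the oscillatory integrals over one period, the estimates are made for nonnegative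
    functions with extended real integrals, so that Tonelli's theorem asks for no integrability;
    signed functions are split into positive and negative parts only at the end. *)

Section affine.
Context {R : realType}.
Local Notation mu := (@lebesgue_measure R).

Lemma measurable_affine (a b : R) :
  measurable_fun [set: measurableTypeR R] (fun x : measurableTypeR R => a * x + b : measurableTypeR R).
Proof. by apply: measurable_funD => //; exact: mulrl_measurable. Qed.

(** The pushforward of Lebesgue measure under [x -> a * x + b], multiplied by [a], gives half-open
    intervals their length, hence it is Lebesgue measure by uniqueness. *)
Let affine_pos (a b : R) (f : R -> \bar R) : 0 < a ->
  measurable_fun [set: R] f -> (forall x, 0 <= f x)%E ->
  (\int[mu]_x f x = a%:E * \int[mu]_x f (a * x + b)%R)%E.
Proof.
move=> a0 mf f0.
pose phi := fun x : measurableTypeR R => a * x + b : measurableTypeR R.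
have mphi : measurable_fun setT phi := measurable_affine a b.
have -> : (\int[mu]_x f (a * x + b)%R = \int[pushforward mu phi]_x f x)%E.
  rewrite (@ge0_integral_pushforward _ _ _ _ _ _ mphi) ?preimage_setT//.
pose nu : {measure set (measurableTypeR R) -> \bar R} := pushforward mu phi.
rewrite -[X in (a%:E * X)%E]/(\int[nu mphi]_x f x)%E.
rewrite -[a]/((NngNum (ltW a0))%:num) -ge0_integral_mscale//.
apply: eq_measure_integral => A mA _.
apply: lebesgue_measure_unique => //= _ [[u v]] _ <-.
rewrite /mscale/= /pushforward.
have -> : phi @^-1` `]u, v] = `](u - b) / a, (v - b) / a]%classic.
  apply/seteqP; split=> x /=; rewrite !in_itv/= /phi ltr_pdivrMr// ler_pdivlMr//;
   by rewrite ltrBlDr lerBrDr (mulrC x).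
rewrite !lebesgue_measure_itv/= !lte_fin ltr_pM2r ?invr_gt0// ltrD2r.
case: ifP => _; last by rewrite mule0.
by rewrite -!EFinB -EFinM; congr (_%:E); field; rewrite gt_eqF.
Qed.

Let affine_N (f : R -> \bar R) :
  measurable_fun [set: R] f -> (forall x, 0 <= f x)%E ->
  (\int[mu]_x f x = \int[mu]_x f (- x)%R)%E.
Proof.
move=> mf f0.
have mN : measurable_fun [set: measurableTypeR R] (-%R : _ -> measurableTypeR R).
  exact: oppr_measurable.
rewrite -[RHS](@ge0_integral_pushforward _ _ _ _ _ _ mN _ setT f) ?preimage_setT//.
by apply: eq_measure_integral => //= A mA AS; exact/esym/lebesgue_measureN.
Qed.

Lemma ge0_integral_affine (a b : R) (f : R -> \bar R) : a != 0 ->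
  measurable_fun [set: R] f -> (forall x, 0 <= f x)%E ->
  (\int[mu]_x f x = `|a|%R%:E * \int[mu]_x f (a * x + b)%R)%E.
Proof.
move=> a0 mf f0; have [ap|an|/eqP] := ltgtP a 0; last by rewrite (negbTE a0).
- rewrite ltr0_norm//.
  have mfN : measurable_fun [set: R] (fun x => f (- x)).
    by apply: (measurableT_comp mf); exact: oppr_measurable.
  rewrite affine_N// (@affine_pos (- a) (- b)) ?oppr_gt0//; congr (_ * _)%E.
  by apply: eq_integral => x _; congr f; ring.
- by rewrite (affine_pos b an) // gtr0_norm.
Qed.

(** One variable is substituted at a time: with [v] fixed, [x = c * u - s * v]; after an exchange of
    the integrals, with [x] fixed, [y = (s * x + v) / c]. This needs [c != 0]; for [c = 0] the
    rotation exchanges the axes up to signs. *)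
Lemma ge0_integral_rotation (c s : R) (f : measurableTypeR R * measurableTypeR R -> \bar R) :
  c ^+ 2 + s ^+ 2 = 1 ->
  measurable_fun setT f -> (forall x, 0 <= f x)%E ->
  (\int[mu]_v \int[mu]_u f (c * u - s * v, s * u + c * v)%R =
   \int[mu]_x \int[mu]_y f (x, y))%E.
Proof.
move=> cs mf f0.
have [c0|c0] := eqVneq c 0.
  have s0 : s != 0 by apply: contra_eq_neq cs => ->; rewrite c0 expr0n addr0 eq_sym oner_neq0.
  have ns : `|s| = 1.
    by apply/eqP; rewrite -(@eqrXn2 _ 2)// expr1n real_normK ?num_real// -cs c0 expr0n add0r.
  rewrite c0; under eq_integral do under eq_integral do rewrite !mul0r sub0r addr0.
  have mF : measurable_fun [set: R] (fun x => \int[mu]_y f (x, y))%E.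
    exact: (measurable_fun_fubini_tonelli_F f).
  rewrite [RHS](@ge0_integral_affine (- s) 0) ?oppr_eq0//; last first.
    by move=> x; apply: integral_ge0.
  rewrite normrN ns mul1e; apply: eq_integral => v _.
  rewrite [RHS](@ge0_integral_affine s 0)//; last exact: measurableT_comp.
  rewrite ns mul1e; apply: eq_integral => u _; congr (f (_, _)); ring.
have mA (g1 g2 : measurableTypeR R * measurableTypeR R -> measurableTypeR R) :
    measurable_fun setT g1 -> measurable_fun setT g2 ->
    measurable_fun setT (fun x => f (g1 x, g2 x)).
  by move=> m1 m2; apply: (measurableT_comp mf); exact: measurable_fun_pair.
have mfst : measurable_fun setT (@fst (measurableTypeR R) (measurableTypeR R)).
  exact: measurable_fst.
have msnd : measurable_fun setT (@snd (measurableTypeR R) (measurableTypeR R)).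
  exact: measurable_snd.
transitivity (\int[mu]_v (`|c^-1|%R%:E * \int[mu]_x f (x, s / c * x + c^-1 * v)%R))%E.
  apply: eq_integral => v _.
  rewrite (@ge0_integral_affine c^-1 (s / c * v)) ?invr_eq0//; last first.
    apply: (measurableT_comp mf); apply: measurable_fun_pair.
      by apply: measurable_funB => //; exact: mulrl_measurable.
    by apply: measurable_funD => //; exact: mulrl_measurable.
  congr (_ * _)%E; apply: eq_integral => x _; congr (f (_, _)).
    by field.
  transitivity (s / c * x + (c ^+ 2 + s ^+ 2) / c * v); first by field.
  by rewrite cs div1r.
have mG : measurable_fun setT (fun z : measurableTypeR R * measurableTypeR R =>
   f (z.2, s / c * z.2 + c^-1 * z.1)).
  apply: mA => //; apply: measurable_funD; exact: measurable_funM.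
rewrite ge0_integralZl_EFin//; last 2 first.
  by move=> *; apply: integral_ge0.
  exact: (measurable_fun_fubini_tonelli_F _ mG).
rewrite (fubini_tonelli _ mG)//=.
rewrite -ge0_integralZl_EFin//; last 2 first.
  by move=> *; apply: integral_ge0.
  exact: (measurable_fun_fubini_tonelli_G _ mG).
apply: eq_integral => x _.
rewrite [RHS](@ge0_integral_affine c^-1 (s / c * x)) ?invr_eq0//; last exact: measurableT_comp.
congr (_ * _)%E; apply: eq_integral => v _; congr (f (_, _)); ring.
Qed.

End affine.

(** The roots [A], [B] satisfy [(A - B) * (A + B) = (a - b) * (a + b)] and [|a + b| <= A + B]; the
    proof divides by [A + B], so the case where it vanishes is treated first. *)
Lemma sqrt_hypot_lip (R : rcfType) (a b c : R) :
  `|Num.sqrt (a ^+ 2 + c ^+ 2) - Num.sqrt (b ^+ 2 + c ^+ 2)| <= `|a - b|.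
Proof.
have c2 := sqr_ge0 c; have sa := sqr_ge0 a; have sb := sqr_ge0 b.
have a0 := sqrtr_ge0 (a ^+ 2 + c ^+ 2); have b0 := sqrtr_ge0 (b ^+ 2 + c ^+ 2).
have a2 : Num.sqrt (a ^+ 2 + c ^+ 2) ^+ 2 = a ^+ 2 + c ^+ 2 by rewrite sqr_sqrtr// addr_ge0.
have b2 : Num.sqrt (b ^+ 2 + c ^+ 2) ^+ 2 = b ^+ 2 + c ^+ 2 by rewrite sqr_sqrtr// addr_ge0.
have ax : `|a| <= Num.sqrt (a ^+ 2 + c ^+ 2) by rewrite -sqrtr_sqr ler_wsqrtr// lerDl.
have bx : `|b| <= Num.sqrt (b ^+ 2 + c ^+ 2) by rewrite -sqrtr_sqr ler_wsqrtr// lerDl.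
move: a0 b0 a2 b2 ax bx; set A := Num.sqrt _; set B := Num.sqrt _ => a0 b0 a2 b2 ax bx.
have [AB|AB] := leP (A + B) 0.
  have A0 : A = 0 by lra.
  have B0 : B = 0 by lra.
  by rewrite A0 B0 subrr normr0.
rewrite -(ler_pM2r AB) -{1}(gtr0_norm AB) -normrM.
have -> : (A - B) * (A + B) = (a - b) * (a + b) by rewrite -!subr_sqr a2 b2; ring.
by rewrite normrM ler_wpM2l//; apply: le_trans (ler_normD _ _) _; lra.
Qed.

(** * Measurability and Tonelli for the planar measure *)

Section measurability.
Context {R : realType} {d} {T : measurableType d}.
Implicit Types f : T -> R.

Lemma measurable_oppr f : measurable_fun setT f -> measurable_fun setT (fun x => - f x).
Proof. exact: measurable_funN. Qed.

Lemma measurable_norm f : measurable_fun setT f -> measurable_fun setT (fun x => `|f x|).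
Proof. by move=> mf; apply: measurableT_comp. Qed.

(** The inverse with [0^-1 = 0] is not continuous at 0. The product of [f] with a power of [f ^+ 2]
    agrees with it there, whatever value the power takes. *)
Lemma measurable_funV f : measurable_fun setT f -> measurable_fun setT (fun x => (f x)^-1).
Proof.
move=> mf; have -> : (fun x => (f x)^-1) = (fun x => f x * (f x ^+ 2) `^ (- 1)).
  apply/funext => x; have [->|x0] := eqVneq (f x) 0; first by rewrite invr0 mul0r.
  by rewrite powR_inv1 ?sqr_ge0//; field.
apply: measurable_funM => //; exact: (measurableT_comp (@measurable_powR R (- 1)) (measurable_funX 2 mf)).
Qed.

Lemma measurable_cos f : measurable_fun setT f -> measurable_fun setT (fun x => cos (f x)).
Proof.
move=> mf; apply: (measurableT_comp _ mf); apply: continuous_measurable_fun.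
exact: continuous_cos.
Qed.

Lemma measurable_sin f : measurable_fun setT f -> measurable_fun setT (fun x => sin (f x)).
Proof.
move=> mf; apply: (measurableT_comp _ mf); apply: continuous_measurable_fun.
exact: continuous_sin.
Qed.

Lemma measurable_sqrt f : measurable_fun setT f -> measurable_fun setT (fun x => Num.sqrt (f x)).
Proof.
move=> mf; apply: (measurableT_comp _ mf); apply: continuous_measurable_fun.
exact: sqrt_continuous.
Qed.

End measurability.

(** Measurability follows the syntax of the function. For symbols other than arithmetic, roots,
    [cos] and [sin] it is taken from the hypotheses in the context, which is why instances of
    measurability lemmas are introduced before the calls. *)
Ltac mfun := repeat
  match goal with
  | |- measurable_fun _ (fun _ => ?c) => exact: measurable_cst
  | |- measurable_fun _ (fun x => x) => exact: measurable_id
  | |- measurable_fun _ id => exact: measurable_id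
  | |- measurable_fun _ (fun x => id x) => exact: measurable_id
  | |- measurable_fun _ (fun x => fst x) => exact: measurable_fst
  | |- measurable_fun _ (fun x => snd x) => exact: measurable_snd
  | |- measurable_fun _ (fun _ => (_ %:E)%E) => apply/measurable_EFinP; rewrite /comp
  | |- measurable_fun _ (fun _ => (_ + _)%R) => apply: measurable_funD
  | |- measurable_fun _ (fun _ => (_ * _)%R) => apply: measurable_funM
  | |- measurable_fun _ (fun _ => (- _)%R) => apply: measurable_oppr
  | |- measurable_fun _ (fun _ => (_ ^+ _)%R) => apply: measurable_funX
  | |- measurable_fun _ (fun _ => (_ ^-1)%R) => apply: measurable_funV
  | |- measurable_fun _ (fun _ => Num.max _ _) => apply: measurable_maxr
  | |- measurable_fun _ (fun _ => `| _ |%R) => apply: measurable_norm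
  | |- measurable_fun _ (fun _ => cos _) => apply: measurable_cos
  | |- measurable_fun _ (fun _ => sin _) => apply: measurable_sin
  | |- measurable_fun _ (fun _ => Num.sqrt _) => apply: measurable_sqrt
  | |- measurable_fun _ (fun _ => (_, _)) => apply: measurable_fun_pair
  | |- measurable_fun ?D (Algebra.add ?c) =>
      change (measurable_fun D (fun t => Algebra.add c t))
  | |- measurable_fun ?D (GRing.mul ?c) =>
      change (measurable_fun D (fun t => GRing.mul c t))
  | |- measurable_fun _ Num.norm => exact: normr_measurable
  | |- measurable_fun _ Algebra.opp => exact: oppr_measurable
  | H : measurable_fun _ ?f |- measurable_fun _ ?f => exact: H
  | H : measurable_fun _ ?f |- measurable_fun _ (fun x => ?f x) => exact: H
  | |- measurable_fun _ (fun _ => (fst _)) => apply: (measurableT_comp measurable_fst)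
  | |- measurable_fun _ (fun _ => (snd _)) => apply: (measurableT_comp measurable_snd)
  | H : measurable_fun _ (fun x => ?f x ?a) |-
        measurable_fun _ (fun z => ?f (@?u z) ?a) =>
      apply: (measurableT_comp H (g := u))
  | H : measurable_fun _ (fun z => ?f z.1 z.2) |-
        measurable_fun _ (fun z => ?f (@?u z) (@?v z)) =>
      refine (measurableT_comp H (measurable_fun_pair (f := u) (g := v) _ _))
  | H : measurable_fun _ ?f |- measurable_fun _ (fun _ => ?f _) =>
        apply: (measurableT_comp H)
  end.

Section integral_setT.
Local Open Scope ereal_scope.
Context {d} {T : measurableType d} {R : realType} (mu : {measure set T -> \bar R}).
Implicit Types f g : T -> \bar R.

Lemma ge0_int_scale (k : R) f : (0 <= k)%R -> measurable_fun setT f ->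
  (forall x, 0 <= f x) -> \int[mu]_x (k%:E * f x) = k%:E * \int[mu]_x f x.
Proof. by move=> k0 mf f0; rewrite ge0_integralZl_EFin. Qed.

Lemma ge0_int_add f g : measurable_fun setT f -> measurable_fun setT g ->
  (forall x, 0 <= f x) -> (forall x, 0 <= g x) ->
  \int[mu]_x (f x + g x) = \int[mu]_x f x + \int[mu]_x g x.
Proof. by move=> mf mg f0 g0; rewrite ge0_integralD. Qed.

Lemma ge0_int_le f g : measurable_fun setT f -> measurable_fun setT g ->
  (forall x, 0 <= f x) -> (forall x, f x <= g x) ->
  \int[mu]_x f x <= \int[mu]_x g x.
Proof. by move=> mf mg f0 fg; apply: ge0_le_integral => // x _; exact: fg. Qed.

End integral_setT.

(** Tonelli's theorem for pairs of points in the plane needs the planar measure to be sigma-finite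
    itself, not only its two factors. *)
Lemma product_sigma_finite d1 d2 (T1 : measurableType d1) (T2 : measurableType d2)
    (R : realType) (m1 : {sigma_finite_measure set T1 -> \bar R})
    (m2 : {sigma_finite_measure set T2 -> \bar R}) :
  sigma_finite [set: T1 * T2] (m1 \x m2)%E.
Proof.
have /sigma_finiteP[F [TF ndF Foo]] := sigma_finiteT m1.
have /sigma_finiteP[G [TG ndG Goo]] := sigma_finiteT m2.
exists (fun n => F n `*` G n).
  rewrite -setXTT TF TG predeqE => -[x y]; split.
    move=> [/= [n _ Fnx] [k _ Gky]]; exists (maxn n k) => //; split.
    - by move: x Fnx; exact/subsetPset/ndF/leq_maxl.
    - by move: y Gky; exact/subsetPset/ndG/leq_maxr.
  by move=> [n _ []/= ? ?]; split; exists n.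
move=> k; have [? ?] := Foo k; have [? ?] := Goo k.
split; first exact: measurableX.
by rewrite product_measure1E// lte_mul_pinfty// ge0_fin_numE.
Qed.

Section leb2_sigma_finite.
Context {R : realType}.
Local Notation RR := (measurableTypeR R).
Local Notation mu := (@lebesgue_measure R).

HB.instance Definition _ := Measure.on (@leb2 R).
HB.instance Definition _ := Measure_isSigmaFinite.Build _ _ _ (@leb2 R)
  (product_sigma_finite mu mu).

Definition leb4 : set ((RR * RR) * (RR * RR)) -> \bar R := (@leb2 R \x @leb2 R)%E.

HB.instance Definition _ := Measure.on leb4.
HB.instance Definition _ := Measure_isSigmaFinite.Build _ _ _ leb4
  (product_sigma_finite (@leb2 R) (@leb2 R)).

Lemma leb2_tonelli1 (f : RR * RR -> \bar R) : measurable_fun setT f ->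
  (forall x, 0 <= f x)%E ->
  (\int[leb2]_x f x = \int[mu]_x \int[mu]_y f (x, y))%E.
Proof. exact: fubini_tonelli1. Qed.

Lemma leb2_tonelli2 (f : RR * RR -> \bar R) : measurable_fun setT f ->
  (forall x, 0 <= f x)%E ->
  (\int[leb2]_x f x = \int[mu]_y \int[mu]_x f (x, y))%E.
Proof. exact: fubini_tonelli2. Qed.

Lemma leb4_tonelli1 (f : (RR * RR) * (RR * RR) -> \bar R) : measurable_fun setT f ->
  (forall x, 0 <= f x)%E ->
  (\int[leb4]_x f x = \int[leb2]_x \int[leb2]_y f (x, y))%E.
Proof. exact: fubini_tonelli1. Qed.

Lemma leb4_tonelli2 (f : (RR * RR) * (RR * RR) -> \bar R) : measurable_fun setT f ->
  (forall x, 0 <= f x)%E ->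
  (\int[leb4]_x f x = \int[leb2]_y \int[leb2]_x f (x, y))%E.
Proof. exact: fubini_tonelli2. Qed.

End leb2_sigma_finite.

(** * Geometry of the rays *)

Section fan_geometry.
Context {R : realType}.
Variables (RE RD : R).
Hypotheses (hRE : 1 < RE) (hRD : 0 < RD).
Local Notation mu := (@lebesgue_measure R).
Local Notation RR := (measurableTypeR R).

(** The source for the angle [a] is [- RE * theta(a)^perp]. [srcdist] is the component of [x] minus
    the source along the axis through the origin, and [offset] is the detector offset at which the
    ray through [x] arrives. *)
Definition srcdist (x : R * R) (a : R) : R := dot_theta_perp x a + RE.
Definition offset (x : R * R) (a : R) : R := dot_theta x a * RD / srcdist x a.

Lemma measurable_srcdist :
  measurable_fun setT (fun z : (RR * RR) * RR => srcdist z.1 z.2 : R).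
Proof. by rewrite /srcdist /dot_theta_perp; mfun. Qed.

Lemma measurable_offset :
  measurable_fun setT (fun z : (RR * RR) * RR => offset z.1 z.2 : R).
Proof. by have m := measurable_srcdist; rewrite /offset /dot_theta; mfun. Qed.

Lemma measurable_fan_ray :
  measurable_fun setT (fun z : RR * RR * RR => fan_ray RE RD z.1.1 z.1.2 z.2 : RR * RR).
Proof. by rewrite /fan_ray; mfun. Qed.

Lemma OmegaE (x : R * R) : Omega x <-> x.1 ^+ 2 + x.2 ^+ 2 < 1.
Proof.
rewrite /Omega/= /euclid2; split=> h.
  rewrite -(sqr_sqrtr (_ : 0 <= x.1 ^+ 2 + x.2 ^+ 2)) ?addr_ge0 ?sqr_ge0//.
  by rewrite expr_lt1// sqrtr_ge0.
by rewrite -sqrtr1 ltr_sqrt.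
Qed.

Lemma dot_theta_sqr (x : R * R) a :
  dot_theta x a ^+ 2 + dot_theta_perp x a ^+ 2 = x.1 ^+ 2 + x.2 ^+ 2.
Proof.
rewrite /dot_theta /dot_theta_perp.
transitivity ((x.1 ^+ 2 + x.2 ^+ 2) * (cos a ^+ 2 + sin a ^+ 2)); first by ring.
by rewrite cos2Dsin2 mulr1.
Qed.

Lemma dot_theta_rot (u v a : R) :
  dot_theta (cos a * u - sin a * v, sin a * u + cos a * v) a = u.
Proof.
rewrite /dot_theta/=; transitivity (u * (cos a ^+ 2 + sin a ^+ 2)); first by ring.
by rewrite cos2Dsin2 mulr1.
Qed.

Lemma dot_theta_perp_rot (u v a : R) :
  dot_theta_perp (cos a * u - sin a * v, sin a * u + cos a * v) a = v.
Proof.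
rewrite /dot_theta_perp/=; transitivity (v * (cos a ^+ 2 + sin a ^+ 2)); first by ring.
by rewrite cos2Dsin2 mulr1.
Qed.

Lemma norm_dot_theta (x : R * R) a : Omega x -> `|dot_theta x a| <= 1.
Proof.
move/OmegaE; rewrite -(dot_theta_sqr x a) => h.
rewrite -(@ler_pXn2r _ 2) ?nnegrE// real_normK ?num_real// expr1n.
by have := sqr_ge0 (dot_theta_perp x a); lra.
Qed.

Lemma norm_dot_theta_perp (x : R * R) a : Omega x -> `|dot_theta_perp x a| <= 1.
Proof.
move/OmegaE; rewrite -(dot_theta_sqr x a) => h.
rewrite -(@ler_pXn2r _ 2) ?nnegrE// real_normK ?num_real// expr1n.
by have := sqr_ge0 (dot_theta x a); lra.
Qed.

Lemma srcdist_ge (x : R * R) a : Omega x -> RE - 1 <= srcdist x a.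
Proof. by move=> /(norm_dot_theta_perp a); rewrite ler_norml /srcdist; lra. Qed.

Lemma srcdist_le (x : R * R) a : Omega x -> srcdist x a <= RE + 1.
Proof. by move=> /(norm_dot_theta_perp a); rewrite ler_norml /srcdist; lra. Qed.

Lemma srcdist_gt0 (x : R * R) a : Omega x -> 0 < srcdist x a.
Proof. by move=> /(srcdist_ge a) h; apply: lt_le_trans h; rewrite subr_gt0. Qed.

Lemma fan_ray_rot (xi a t : R) : fan_ray RE RD xi a t =
  (cos a * (t * xi) - sin a * (RD * t - RE), sin a * (t * xi) + cos a * (RD * t - RE)).
Proof. by rewrite /fan_ray; congr (_, _); ring. Qed.

(** The point with parameter [t] has source distance [RD * t], which on [Omega] is positive and at
    most [RE + 1], hence below [2 * RE]. *)
Lemma fan_ray_Omega (xi a t : R) : Omega (fan_ray RE RD xi a t) ->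
  0 < t < 2 * RE / RD.
Proof.
move=> /[dup] /(srcdist_gt0 a) + /(srcdist_le a).
rewrite fan_ray_rot /srcdist dot_theta_perp_rot subrK pmulr_rgt0// => -> h/=.
rewrite ltr_pdivlMr// (mulrC t). move: hRE h; lra.
Qed.

(* The Jacobian of [(xi, t) |-> fan_ray xi a t] is [RD * t], which equals
   [srcdist x a] at [x = fan_ray xi a t]. *)
Lemma fan_integral (f : RR * RR -> R) (phi : RR -> R) a :
  measurable_fun setT f -> measurable_fun setT phi ->
  (forall x, 0 <= f x) -> (forall x, 0 <= phi x) -> (forall x, f x != 0 -> Omega x) ->
  (\int[mu]_xi ((phi xi)%:E * \int[mu]_t (f (fan_ray RE RD xi a t))%:E) =
   \int[leb2]_x (phi (offset x a) * (f x / srcdist x a))%:E)%E.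
Proof.
move=> mf mphi f0 phi0 fO.
have fN x : ~ Omega x -> f x = 0.
  by move=> xO; apply/eqP/negPn/negP => /fO.
have h0 x : 0 <= phi (offset x a) * (f x / srcdist x a).
  have [xO|/fN ->] := pselect (Omega x); last by rewrite mul0r mulr0.
  by rewrite mulr_ge0// divr_ge0// ltW// srcdist_gt0.
have ms := measurable_srcdist.
have mo := measurable_offset.
have mr := measurable_fan_ray.
have msa : measurable_fun setT (fun x : RR * RR => srcdist x a : R).
  by apply: (measurableT_comp ms (g := fun x => (x, a))); mfun.
have moa : measurable_fun setT (fun x : RR * RR => offset x a : RR).
  by apply: (measurableT_comp mo (g := fun x => (x, a))); mfun.
have mF : measurable_fun setT (fun x : RR * RR => (phi (offset x a) * (f x / srcdist x a))%:E).
  by mfun.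
rewrite leb2_tonelli1//=.
(* In the rotated coordinates [(u, v)] the ray point has [v = RD * t - RE] and [u = t * xi]. These
   two affine substitutions contribute the factors [RD] and [t] of the Jacobian. *)
rewrite -(ge0_integral_rotation (cos2Dsin2 a) mF); last by move=> x; rewrite lee_fin.
under [RHS]eq_integral do under eq_integral do
  rewrite /offset /srcdist dot_theta_rot dot_theta_perp_rot.
set G := fun v => (\int[mu]_u _)%E.
have mP : measurable_fun setT (fun z : RR * RR => f (cos a * z.2 - sin a * z.1, sin a * z.2 + cos a * z.1)).
  by apply: (measurableT_comp mf); mfun.
rewrite [RHS](@ge0_integral_affine _ RD (- RE)) ?gt_eqF//; last 2 first.
- apply: (measurable_fun_fubini_tonelli_F (fun z : RR * RR => (phi (z.2 * RD / (z.1 + RE)) *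
     (f (cos a * z.2 - sin a * z.1, sin a * z.2 + cos a * z.1) / (z.1 + RE)))%:E)) => [|x].
    by mfun.
  rewrite lee_fin.
  set X := (_ - _, _); have := h0 X; rewrite /offset /srcdist /X.
  by rewrite dot_theta_rot dot_theta_perp_rot.
- move=> v; apply: integral_ge0 => u _; rewrite lee_fin.
  set X := (_ - _, _); have := h0 X; rewrite /offset /srcdist /X.
  by rewrite dot_theta_rot dot_theta_perp_rot.
have mf2 : measurable_fun setT (fun z : RR * RR => f (fan_ray RE RD z.2 a z.1)).
  apply: (measurableT_comp mf).
  by apply: (measurableT_comp mr (g := fun z : RR * RR => ((z.2, a), z.1))); mfun.
have mH : measurable_fun setT (fun z : RR * RR => (phi z.2 * f (fan_ray RE RD z.2 a z.1))%:E).
  by mfun.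
transitivity (\int[mu]_t (RD%:E * G (RD * t - RE)%R))%E; last first.
  rewrite gtr0_norm//; apply: ge0_int_scale; first exact: ltW.
    apply: (measurable_fun_fubini_tonelli_F (fun z : RR * RR =>
      (phi (z.2 * RD / (RD * z.1 - RE + RE)) * (f (cos a * z.2 - sin a * (RD * z.1 - RE),
        sin a * z.2 + cos a * (RD * z.1 - RE)) / (RD * z.1 - RE + RE)))%:E)) => [|x].
      by mfun.
    rewrite lee_fin; set X := (_ - _, _); have := h0 X.
    by rewrite /offset /srcdist /X dot_theta_rot dot_theta_perp_rot.
  move=> t; apply: integral_ge0 => u _; rewrite lee_fin.
  set X := (_ - _, _); have := h0 X.
  by rewrite /offset /srcdist /X dot_theta_rot dot_theta_perp_rot.
transitivity (\int[mu]_t \int[mu]_xi (phi xi * f (fan_ray RE RD xi a t))%:E)%E.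
  rewrite [RHS](fubini_tonelli _ mH)/=; last first.
    by move=> x; rewrite lee_fin mulr_ge0.
  apply: eq_integral => xi _.
  under [RHS]eq_integral do rewrite EFinM.
  symmetry; apply: ge0_int_scale => //; last by move=> t; rewrite lee_fin.
  by apply/measurable_EFinP; apply: (measurableT_comp mf2 (g := fun t => (t, xi))); mfun.
apply: eq_integral => t _; rewrite /G subrK.
(* For [t <= 0] the substitution [u = t * xi] degenerates or turns round, but then the ray point is
   outside [Omega] and both sides vanish. *)
have [t0|t0] := ltP 0 t; last first.
  rewrite integral0_eq; last first.
    move=> xi _; rewrite fN ?mulr0//.
    by move=> /fan_ray_Omega; rewrite ltNge t0.
  rewrite integral0_eq ?mule0// => u _; rewrite fN ?mul0r ?mulr0//.
  move=> /(srcdist_gt0 a); rewrite /srcdist dot_theta_perp_rot subrK.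
  by rewrite pmulr_rgt0// ltNge t0.
rewrite [in RHS](@ge0_integral_affine _ t 0) ?gt_eqF//; last 2 first.
- by mfun.
- move=> u; rewrite lee_fin.
  set X := (_ - _, _); have := h0 X; rewrite /offset /srcdist /X.
  by rewrite dot_theta_rot dot_theta_perp_rot subrK.
rewrite gtr0_norm// muleA -EFinM; apply: etrans; last first.
  apply: ge0_int_scale; first by rewrite mulr_ge0 ?ltW.
    by mfun.
  move=> u; rewrite lee_fin.
  set X := (_ - _, _); have := h0 X; rewrite /offset /srcdist /X.
  by rewrite dot_theta_rot dot_theta_perp_rot subrK.
apply: eq_integral => xi _; rewrite -EFinM; congr (_%:E).
rewrite addr0 fan_ray_rot.
have -> : t * xi * RD / (RD * t) = xi by field; rewrite !gt_eqF.
by field; rewrite !gt_eqF.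
Qed.

End fan_geometry.

(** * Continuity and derivatives of real functions *)

Section continuity.
Context {R : realType}.
Implicit Types f g : R -> R.

Lemma cont_add f g : continuous f -> continuous g -> continuous (fun x => f x + g x).
Proof. by move=> cf cg x; apply: cvgD; [exact: cf|exact: cg]. Qed.

Lemma cont_mul f g : continuous f -> continuous g -> continuous (fun x => f x * g x).
Proof. by move=> cf cg x; apply: cvgM; [exact: cf|exact: cg]. Qed.

Lemma cont_exp f n : continuous f -> continuous (fun x => f x ^+ n).
Proof.
move=> cf; elim: n => [|n ih].
  by rewrite (_ : (fun _ => _) = cst 1); [exact: cst_continuous|apply/funext => x; rewrite expr0].
rewrite (_ : (fun _ => _) = (fun x => f x * f x ^+ n)); first exact: cont_mul.
by apply/funext => x; rewrite exprS.
Qed.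

Lemma cont_opp f : continuous f -> continuous (fun x => - f x).
Proof. by move=> cf x; apply: cvgN; exact: cf. Qed.

Lemma cont_inv f : (forall x, f x != 0) -> continuous f -> continuous (fun x => (f x)^-1).
Proof. by move=> f0 cf x; apply: cvgV => //; exact: cf. Qed.

Lemma cont_comp f g : continuous g -> continuous f -> continuous (fun x => g (f x)).
Proof. by move=> cg cf x; apply: (@continuous_comp _ _ _ f g); [exact: cf|exact: cg]. Qed.

Lemma cont_norm f : continuous f -> continuous (fun x => `|f x|).
Proof. by move=> cf; apply: cont_comp => //; exact: norm_continuous. Qed.

Lemma cont_cos f : continuous f -> continuous (fun x => cos (f x)).
Proof. by move=> cf; apply: cont_comp => //; exact: continuous_cos. Qed.

Lemma cont_sin f : continuous f -> continuous (fun x => sin (f x)).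
Proof. by move=> cf; apply: cont_comp => //; exact: continuous_sin. Qed.

Lemma cont_max f g : continuous f -> continuous g ->
  continuous (fun x => Num.max (f x) (g x)).
Proof. by move=> cf cg x; apply: continuous_max; [exact: cf|exact: cg]. Qed.

Lemma cont_cst (a : R) : continuous (fun _ : R => a).
Proof. exact: cst_continuous. Qed.

Lemma cont_id : continuous (fun x : R => x).
Proof. by move=> x; exact: cvg_id. Qed.

End continuity.

Ltac ctsf := repeat
  match goal with
  | |- continuous (fun _ => ?c) => exact: cont_cst
  | |- continuous (fun x => x) => exact: cont_id
  | |- continuous (fun _ => (_ + _)%R) => apply: cont_add
  | |- continuous (fun _ => (_ * _)%R) => apply: cont_mul
  | |- continuous (fun _ => (- _)%R) => apply: cont_opp
  | |- continuous (fun _ => (_ ^+ _)%R) => apply: cont_exp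
  | |- continuous (fun _ => (_ ^-1)%R) => apply: cont_inv
  | |- continuous (fun _ => Num.max _ _) => apply: cont_max
  | |- continuous (fun _ => `| _ |%R) => apply: cont_norm
  | |- continuous (fun _ => cos _) => apply: cont_cos
  | |- continuous (fun _ => sin _) => apply: cont_sin
  | |- continuous Num.norm => exact: norm_continuous
  | |- continuous cos => exact: continuous_cos
  | |- continuous sin => exact: continuous_sin
  | H : continuous ?f |- continuous ?f => exact: H
  | H : continuous ?f |- continuous (fun x => ?f x) => exact: H
  | H : continuous ?f |- continuous (fun _ => ?f _) => apply: (cont_comp H)
  end.

Section derivatives.
Context {R : realType}.
Implicit Types (f g : R -> R) (x a b : R).

Lemma der_eq f x a b : is_derive x 1 f a -> a = b -> is_derive x 1 f b.
Proof. by move=> d <-. Qed.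

Lemma der_cst x a : is_derive x 1 (fun _ : R => a) 0.
Proof. exact: is_derive_cst. Qed.

Lemma der_id x : is_derive x 1 (fun x : R => x) 1.
Proof. exact: is_derive_id. Qed.

Lemma der_add f g x a b : is_derive x 1 f a -> is_derive x 1 g b ->
  is_derive x 1 (fun x => f x + g x) (a + b).
Proof. by move=> df dg; exact: is_deriveD. Qed.

Lemma der_opp f x a : is_derive x 1 f a -> is_derive x 1 (fun x => - f x) (- a).
Proof. by move=> df; exact: is_deriveN. Qed.

Lemma der_mul f g x a b : is_derive x 1 f a -> is_derive x 1 g b ->
  is_derive x 1 (fun x => f x * g x) (f x * b + g x * a).
Proof. by move=> df dg; exact: is_deriveM. Qed.

Lemma der_comp f g x a b : is_derive (f x) 1 g b -> is_derive x 1 f a ->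
  is_derive x 1 (fun x => g (f x)) (b * a).
Proof. by move=> dg df; exact: is_derive1_comp. Qed.

Lemma der_inv f x a : f x != 0 -> is_derive x 1 f a ->
  is_derive x 1 (fun x => (f x)^-1) (- (f x) ^- 2 * a).
Proof. by move=> f0 df; exact: is_deriveV. Qed.

Lemma der_continuous f g : (forall x, is_derive x 1 f (g x)) -> continuous f.
Proof. by move=> d x; apply/differentiable_continuous/derivable1_diffP. Qed.

End derivatives.

Ltac ders := repeat
  match goal with
  | |- is_derive _ _ (fun _ => ?c) _ => eapply der_cst
  | |- is_derive _ _ (fun x => x) _ => eapply der_id
  | H : is_derive ?x _ ?f _ |- is_derive ?x _ ?f _ => eapply H
  | H : is_derive ?x _ ?f _ |- is_derive ?x _ (fun y => ?f y) _ => eapply H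
  | H : forall x, is_derive x _ ?f (@?g x) |- is_derive _ _ ?f _ => eapply H
  | H : forall x, is_derive x _ ?f (@?g x) |- is_derive _ _ (fun y => ?f y) _ => eapply H
  | |- is_derive _ _ (fun _ => (_ + _)%R) _ => eapply der_add
  | |- is_derive _ _ (fun _ => (_ * _)%R) _ => eapply der_mul
  | |- is_derive _ _ (fun _ => (- _)%R) _ => eapply der_opp
  | |- is_derive _ _ (fun _ => (_ ^-1)%R) _ => eapply der_inv
  | |- is_derive _ _ cos _ => eapply is_derive_cos
  | |- is_derive _ _ sin _ => eapply is_derive_sin
  | |- is_derive _ _ (fun x => cos x) _ => eapply is_derive_cos
  | |- is_derive _ _ (fun x => sin x) _ => eapply is_derive_sin
  | |- is_derive _ _ (fun _ => cos _) _ => eapply (der_comp (is_derive_cos _))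
  | |- is_derive _ _ (fun _ => sin _) _ => eapply (der_comp (is_derive_sin _))
  end.

(** * The triangle kernel *)

Section triangle.
Context {R : realType}.
Implicit Types (D u : R).

Definition tri D u : R := w_ D u / D ^+ 2.

(** This is [max 0 u ^+ 2 / 2], the primitive of [max 0 u]. Written with the product of [u] and its
    absolute value, its derivative needs a case distinction for that product only. *)
Let half_sqr u : R := (u ^+ 2 + u * `|u|) / 4.

(** The triangle is the second difference of [max 0 u], so its primitive is the second difference of
    [half_sqr]. Subtracting one half makes the limits [-1/2] and [1/2], which are independent of [D]
    and reached outside [[-D, D]]. *)
Definition tri_prim D u : R :=
  (half_sqr (u + D) - 2 * half_sqr u + half_sqr (u - D)) / D ^+ 2 - 2^-1.

Let is_derive_mul_norm u : is_derive u 1 (fun x : R => x * `|x|) (2 * `|u|).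
Proof.
have [u0|u0|->] := ltgtP u 0.
- apply: (@near_eq_is_derive _ _ _ (fun x : R => - (x * x))).
    near=> x; rewrite ltr0_norm; first by ring.
    by near: x; exact: lt_nbhsl.
  by eapply der_eq; [ders|rewrite ltr0_norm//; ring].
- apply: (@near_eq_is_derive _ _ _ (fun x : R => x * x)).
    near=> x; rewrite gtr0_norm //.
    by near: x; exact: lt_nbhsr.
  by eapply der_eq; [ders|rewrite gtr0_norm//; ring].
- apply/is_derive1_caratheodory; exists (fun x => `|x|); split.
  + by move=> z; rewrite normr0 mulr0 !subr0 mulrC.
  + exact: norm_continuous.
  + by rewrite normr0 mulr0.
Unshelve. all: by end_near. Qed.

Let is_derive_half_sqr u : is_derive u 1 half_sqr (Num.max 0 u).
Proof.
have d1 := is_derive_mul_norm u.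
have -> : half_sqr = (fun x => 4^-1 * (x * x + x * `|x|)).
  by apply/funext => x; rewrite /half_sqr mulrC expr2.
eapply der_eq; first by ders.
by have [u0|u0] := leP 0 u; [rewrite ger0_norm//|rewrite ltr0_norm//]; field.
Qed.

Let is_derive_half_sqr_shift b u : is_derive u 1 (fun x => half_sqr (x + b)) (Num.max 0 (u + b)).
Proof.
eapply der_eq; first by eapply (der_comp (is_derive_half_sqr _)); ders.
by rewrite addr0 mulr1.
Qed.

Lemma is_derive_tri_prim D u : 0 < D -> is_derive u 1 (tri_prim D) (tri D u).
Proof.
move=> D0.
have d1 := is_derive_half_sqr_shift D u.
have d2 := is_derive_half_sqr_shift (- D) u.
have d3 := is_derive_half_sqr u.
eapply der_eq; first by rewrite /tri_prim; ders.
rewrite !mulr0 !addr0 /tri [RHS]mulrC add0r; congr (_ * _).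
rewrite /w_ !maxEle; case: (ger0P u) => ?;
  by do ![case: ifPn; rewrite -?ltNge => ?]; lra.
Qed.

Lemma tri_ge0 D u : 0 <= tri D u.
Proof. by rewrite /tri /w_ divr_ge0 ?sqr_ge0// le_max lexx. Qed.

Lemma triN D u : tri D (- u) = tri D u.
Proof. by rewrite /tri /w_ normrN. Qed.

Lemma tri_out D u : D <= `|u| -> tri D u = 0.
Proof. by move=> h; rewrite /tri /w_ max_l ?mul0r// subr_le0. Qed.

Lemma tri_le D u : 0 < D -> tri D u <= D^-1.
Proof.
move=> D0; rewrite /tri ler_pdivrMr ?exprn_gt0// expr2 mulKf ?gt_eqF//.
by rewrite /w_ ge_max ltW//= lerBlDr lerDl.
Qed.

Lemma tri_mul_norm D u : 0 < D -> `|u * tri D u| <= 2^-1.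
Proof.
move=> D0; rewrite normrM (ger0_norm (tri_ge0 _ _)).
have [h|h] := leP D `|u|; first by rewrite tri_out// mulr0.
rewrite /tri /w_ max_r ?subr_ge0 ?(ltW h)// mulrA ler_pdivrMr ?exprn_gt0//.
by have := sqr_ge0 (`|u| - 2^-1 * D); nra.
Qed.

Lemma tri_prim_right D u : 0 < D -> D <= u -> tri_prim D u = 2^-1.
Proof.
move=> D0 h; rewrite /tri_prim /half_sqr !ger0_norm; first [lra | by field; rewrite gt_eqF].
Qed.

Lemma tri_prim_left D u : 0 < D -> u <= - D -> tri_prim D u = - 2^-1.
Proof.
move=> D0 h; rewrite /tri_prim /half_sqr !ler0_norm; first [lra | by field; rewrite gt_eqF].
Qed.

Lemma tri_prim_le D u : 0 < D -> `|tri_prim D u| <= 2^-1.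
Proof.
move=> D0; rewrite /tri_prim; set A := (_ + half_sqr (u - D)).
have D20 : 0 < D ^+ 2 by rewrite exprn_gt0.
suff : 0 <= A <= D ^+ 2.
  move=> /andP[A0 A1].
  have : 0 <= A / D ^+ 2 <= 1 by rewrite divr_ge0 ?(ltW D20)// ler_pdivrMr// mul1r.
  by move=> /andP[? ?]; rewrite ler_norml; lra.
rewrite /A /half_sqr.
case: (ger0P u) => hu; case: (ger0P (u + D)) => h1;
  case: (ger0P (u - D)) => h2; apply/andP; split; try lra; nra.
Qed.

Lemma tri_lip D a b : 0 < D -> `|tri D a - tri D b| <= `|a - b| / D ^+ 2.
Proof.
move=> D0; rewrite /tri -mulrBl normrM (@ger0_norm _ (D ^- 2)); last first.
  by rewrite invr_ge0 sqr_ge0.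
rewrite ler_pM2r ?invr_gt0 ?exprn_gt0//.
have h1 := ler_dist_dist a b; have h2 := h1.
rewrite ler_norml in h1; move/andP: h1 => [h1 h1'].
rewrite /w_ !maxEle ler_norml.
by case: ifPn; rewrite -?ltNge => ?; case: ifPn; rewrite -?ltNge => ?; apply/andP; split;
  have := normr_ge0 (a - b); lra.
Qed.

(** Makes [4 * D * tri (2 * D)] a continuous majorant of the indicator of [[-D, D]], again of
    triangle form. *)
Lemma tri_half D u : 0 < D -> `|u| <= D -> 4^-1 <= D * tri (2 * D) u.
Proof.
move=> D0 h; have D2 : 0 < (2 * D) ^+ 2 by rewrite exprn_gt0// mulr_gt0.
have h2 : 0 <= 2 * D - `|u| by lra.
by rewrite /tri /w_ (max_r h2) mulrA ler_pdivlMr//; nra.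
Qed.

Lemma continuous_tri D : 0 < D -> continuous (tri D).
Proof. by move=> D0; change (continuous (fun u => Num.max 0 (D - `|u|) * (D ^- 2))); ctsf. Qed.

End triangle.

Section ftc.
Context {R : realType}.
Local Notation mu := (@lebesgue_measure R).

Lemma FTC_derive (F f : R -> R) (a b : R) : a < b -> continuous f ->
  (forall x : R, is_derive x 1 F (f x)) ->
  (\int[mu]_(x in `[a, b]) (f x)%:E = (F b - F a)%:E)%E.
Proof.
move=> ab cf dF; rewrite EFinB; apply: continuous_FTC2 => //.
- exact: continuous_subspaceT.
- have cF := der_continuous dF; split.
  + by move=> x _; exact: ex_derive.
  + by apply: cvg_at_right_filter; exact: cF.
  + by apply: cvg_at_left_filter; exact: cF.
- by move=> x _; rewrite derive1E derive_val.
Qed.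

Lemma continuous_integrable (f : R -> R) (a b : R) : continuous f ->
  mu.-integrable `[a, b] (EFin \o f).
Proof.
move=> cf; apply: continuous_compact_integrable; first exact: segment_compact.
exact: continuous_subspaceT.
Qed.

End ftc.

Section triangle_mass.
Context {R : realType}.
Local Notation mu := (@lebesgue_measure R).

Lemma measurable_tri (D : R) : measurable_fun [set: measurableTypeR R] (fun u : measurableTypeR R => tri D u : measurableTypeR R).
Proof. by rewrite /tri /w_; mfun. Qed.

Lemma integral_tri (D b : R) : 0 < D -> (\int[mu]_x (tri D (x - b))%:E = 1)%E.
Proof.
move=> D0.
have mt := measurable_tri D.
rewrite (@ge0_integral_affine _ 1 b) ?oner_neq0//; last 2 first.
  by mfun.
  by move=> x; rewrite lee_fin tri_ge0.
rewrite normr1 mul1e; under eq_integral do rewrite mul1r addrK.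
transitivity (\int[mu]_(x in `[(- D)%R, D]) (tri D x)%:E)%E.
  rewrite [RHS]integral_mkcond; apply: eq_integral => x _.
  rewrite patchE; case: ifPn => //; rewrite notin_setE/= in_itv/= => /negP.
  by rewrite -ler_norml -ltNge => h; rewrite tri_out// ltW.
have dT (x : R) : is_derive x 1 (tri_prim D) (tri D x) by exact: is_derive_tri_prim.
have DD : - D < D by lra.
rewrite (FTC_derive DD (continuous_tri D0) dT).
by rewrite tri_prim_right// tri_prim_left// opprK; congr (_%:E); lra.
Qed.

End triangle_mass.

(** * Oscillatory integrals in the angle *)

Section fan_kernel.
Context {R : realType}.
Variables (RE RD : R).
Hypotheses (hRE : 1 < RE) (hRD : 0 < RD).
Local Notation mu := (@lebesgue_measure R).
Implicit Types (x y : R * R).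

Definition fan_jac x y (a : R) : R := (srcdist RE x a * srcdist RE y a)^-1.

Definition offset_diff x y (a : R) : R := offset RE RD x a - offset RE RD y a.

(** The numerator collects the bounds of the coefficients [B1] and [B2] in the proof of
    [ibp_pointwise], both proportional to the distance [r]; the denominator is the lower bound of
    [RD * D0], divided by [r ^+ 2]. *)
Definition fan_kernel_cst : R :=
  ((RE + 1) + 2 / (RE - 1) * RE + RE) / (RD * (RE ^+ 2 - 1)).

Lemma fan_kernel_cst_gt0 : 0 < fan_kernel_cst.
Proof.
have h1 : 0 < RE - 1 by rewrite subr_gt0.
have h2 : 0 < RE by apply: lt_trans hRE.
rewrite /fan_kernel_cst divr_gt0// ?mulr_gt0//.
  have : 0 < 2 / (RE - 1) * RE by rewrite !mulr_gt0 ?invr_gt0.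
  by move: hRE; lra.
by move: hRE; rewrite expr2; nra.
Qed.

Let cross x y := x.1 * y.2 - y.1 * x.2.

(** Rotation invariance of the cross product makes the denominator of the boundary term independent
    of the angle, so that it is not differentiated. *)
Let crossE x y a : cross x y =
  dot_theta x a * dot_theta_perp y a - dot_theta y a * dot_theta_perp x a.
Proof.
rewrite /cross /dot_theta /dot_theta_perp.
transitivity ((x.1 * y.2 - y.1 * x.2) * (cos a ^+ 2 + sin a ^+ 2)); last by ring.
by rewrite cos2Dsin2 mulr1.
Qed.

(* The numerator [n] of [offset x - offset y] is a trigonometric polynomial with
   [n'^2 + n (n - 2 A)] constant; integrating by parts against [n'] therefore
   needs no localisation near the zeros of [n]. *)
Let ibp_pointwise (r X X' Y Y' A P Th h c v v' : R) :
  0 < r -> A = X * Y' - Y * X' -> (X - Y) ^+ 2 + (X' - Y') ^+ 2 = r ^+ 2 ->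
  X ^+ 2 + X' ^+ 2 <= 1 -> Y ^+ 2 + Y' ^+ 2 <= 1 ->
  c = ((X' + RE) * (Y' + RE))^-1 ->
  v = X * RD / (X' + RE) - Y * RD / (Y' + RE) ->
  v' = RD * (X' * (X' + RE) + X ^+ 2) / (X' + RE) ^+ 2
       - RD * (Y' * (Y' + RE) + Y ^+ 2) / (Y' + RE) ^+ 2 ->
  `|P * v| <= h -> `|Th| <= h ->
  `|P * c - (P * v' * (RE * (X' - Y')) - Th * (RE * (X - Y))) / (RD * (RE ^+ 2 * r ^+ 2 - A ^+ 2))|
     <= fan_kernel_cst / r * h.
Proof.
move=> r0 AE rE hX hY cE vE v'E hP hT.
have R1 := hRE; have R0 := hRD.
have RE10 : 0 < RE - 1 by rewrite subr_gt0.
have RE0 : 0 < RE by lra.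
have A2 : A ^+ 2 <= r ^+ 2.
  (* Lagrange's identity: [A] is, up to sign, the cross product of the first point with the
     difference of the points, hence at most [r] in absolute value. *)
  have E : (X ^+ 2 + X' ^+ 2) * r ^+ 2 - A ^+ 2 = (X * (X - Y) + X' * (X' - Y')) ^+ 2.
    by rewrite -rE AE; ring.
  have := sqr_ge0 (X * (X - Y) + X' * (X' - Y')); rewrite -E => h1.
  apply: le_trans (_ : (X ^+ 2 + X' ^+ 2) * r ^+ 2 <= _); first by lra.
  by rewrite -[leRHS]mul1r ler_wpM2r ?sqr_ge0.
have X1 : `|X| <= 1.
  by rewrite -(@ler_pXn2r _ 2) ?nnegrE// real_normK ?num_real// expr1n; have := sqr_ge0 X'; lra.
have Y1 : `|Y| <= 1.
  by rewrite -(@ler_pXn2r _ 2) ?nnegrE// real_normK ?num_real// expr1n; have := sqr_ge0 Y'; lra.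
have X'1 : `|X'| <= 1.
  by rewrite -(@ler_pXn2r _ 2) ?nnegrE// real_normK ?num_real// expr1n; have := sqr_ge0 X; lra.
have Y'1 : `|Y'| <= 1.
  by rewrite -(@ler_pXn2r _ 2) ?nnegrE// real_normK ?num_real// expr1n; have := sqr_ge0 Y; lra.
have dX : `|X - Y| <= r.
  by rewrite -(@ler_pXn2r _ 2) ?nnegrE ?(ltW r0)// real_normK ?num_real// -rE lerDl sqr_ge0.
have dX' : `|X' - Y'| <= r.
  by rewrite -(@ler_pXn2r _ 2) ?nnegrE ?(ltW r0)// real_normK ?num_real// -rE lerDr sqr_ge0.
have Ar : `|A| <= r.
  by rewrite -(@ler_pXn2r _ 2) ?nnegrE ?(ltW r0)// real_normK ?num_real.
have sx : RE - 1 <= X' + RE by move: X'1; rewrite ler_norml; lra.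
have sy : RE - 1 <= Y' + RE by move: Y'1; rewrite ler_norml; lra.
have sx0 : 0 < X' + RE by lra.
have sy0 : 0 < Y' + RE by lra.
set D0 := RE ^+ 2 * r ^+ 2 - A ^+ 2.
have r2 : 0 < r ^+ 2 by rewrite exprn_gt0.
have RE2 : 0 < RE ^+ 2 - 1 by rewrite expr2; nra.
have hD0 : (RE ^+ 2 - 1) * r ^+ 2 <= D0 by rewrite /D0 mulrBl mul1r; lra.
have D00 : 0 < D0 by apply: lt_le_trans hD0; rewrite mulr_gt0.
(* Here [n = X * (Y' + RE) - Y * (X' + RE)] and [n' = RE * (X' - Y')], since the angular derivatives
   of [X] and [X'] are [X'] and [- X]. The constant [D0] is positive because [|A| <= r] and
   [RE > 1]. *)
have D0E : D0 = (RE * (X' - Y')) ^+ 2 + (X * (Y' + RE) - Y * (X' + RE)) * (X * (Y' + RE) - Y * (X' + RE) - 2 * A).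
  by rewrite /D0 -rE AE; ring.
(* From [v = RD * c * n] follows [RD * c * n' = v' - v * (X / (X' + RE) + Y / (Y' + RE))]. In
   [P * c * (n'^2 + n * (n - 2 * A))] the part containing [v'] is therefore cancelled by the total
   derivative, and each remaining term has a factor [P * v] or [Th], both bounded by [h]. *)
pose B1 := (X * (Y' + RE) - Y * (X' + RE) - 2 * A)
  - (X / (X' + RE) + Y / (Y' + RE)) * (RE * (X' - Y')).
pose B2 := RE * (X - Y).
have -> : P * c - (P * v' * (RE * (X' - Y')) - Th * (RE * (X - Y))) / (RD * D0) =
   (P * v * B1 + Th * B2) / (RD * D0).
  apply: (@mulIf _ (RD * D0)); first by rewrite mulf_neq0 ?gt_eqF.
  rewrite mulrBl !divfK ?mulf_neq0 ?gt_eqF//.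
  have -> : P * c * (RD * D0) = P * (c * RD) * D0 by ring.
  rewrite D0E /B1 /B2 cE vE v'E AE; field.
  by rewrite !gt_eqF.
have hh : 0 <= h by apply: le_trans hT.
have hB1 : `|B1| <= ((RE + 1) + 2 / (RE - 1) * RE) * r.
  rewrite mulrDl; apply: le_trans (ler_normB _ _) _; apply: lerD.
    have -> : X * (Y' + RE) - Y * (X' + RE) - 2 * A = RE * (X - Y) - A by rewrite AE; ring.
    apply: le_trans (ler_normB _ _) _; rewrite mulrDl mul1r; apply: lerD => //.
    by rewrite normrM gtr0_norm// ler_pM2l.
  rewrite normrM -[leRHS](mulrA _ RE); apply: ler_pM => //.
    have q (Z s : R) : `|Z| <= 1 -> RE - 1 <= s -> `|Z / s| <= (RE - 1)^-1.
      move=> hZ hs; have s0 : 0 < s by lra.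
      rewrite normrM normfV (gtr0_norm s0) -[leRHS]mul1r; apply: ler_pM => //.
        by rewrite invr_ge0 ltW.
      by rewrite lef_pV2.
    have -> : 2 / (RE - 1) = (RE - 1)^-1 + (RE - 1)^-1 by ring.
    by apply: le_trans (ler_normD _ _) _; apply: lerD; apply: q.
  by rewrite normrM gtr0_norm// ler_pM2l.
have hB2 : `|B2| <= RE * r by rewrite /B2 normrM gtr0_norm// ler_pM2l.
rewrite normrM normfV (gtr0_norm (mulr_gt0 hRD D00)) ler_pdivrMr ?mulr_gt0//.
apply: le_trans (_ : h * ((RE + 1) + 2 / (RE - 1) * RE + RE) * r <= _).
  apply: le_trans (ler_normD _ _) _.
  rewrite -[leRHS]mulrA [in leRHS]mulrDl [in leRHS]mulrDr (normrM (P * v)) (normrM Th).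
  by apply: lerD; apply: ler_pM.
rewrite /fan_kernel_cst; set K := _ + _ + RE.
have K0 : 0 <= K.
  have : 0 <= 2 / (RE - 1) * RE by rewrite !mulr_ge0 ?invr_ge0// ltW.
  by rewrite /K; lra.
apply: le_trans (_ : K / (RD * (RE ^+ 2 - 1)) / r * h * (RD * ((RE ^+ 2 - 1) * r ^+ 2)) <= _).
  rewrite le_eqVlt; apply/orP; left; apply/eqP; field.
  by rewrite !gt_eqF// subr_gt0.
apply: ler_wpM2l; last by rewrite ler_pM2l.
by rewrite !mulr_ge0// !invr_ge0 ?mulr_ge0// ltW.
Qed.

Lemma der_dot_theta x (a : R) : is_derive a 1 (dot_theta x) (dot_theta_perp x a).
Proof.
by rewrite /dot_theta; eapply der_eq; [ders|rewrite /dot_theta_perp; ring].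
Qed.

Lemma der_dot_theta_perp x (a : R) : is_derive a 1 (dot_theta_perp x) (- dot_theta x a).
Proof.
by rewrite /dot_theta_perp; eapply der_eq; [ders|rewrite /dot_theta; ring].
Qed.

Lemma der_offset x (a : R) : Omega x -> is_derive a 1 (offset RE RD x)
  (RD * (dot_theta_perp x a * srcdist RE x a + dot_theta x a ^+ 2) / srcdist RE x a ^+ 2).
Proof.
move=> Ox; have s0 := srcdist_gt0 hRE a Ox.
have d1 := der_dot_theta x; have d2 := der_dot_theta_perp x.
eapply der_eq.
  rewrite /offset; ders; first by rewrite gt_eqF.
  by rewrite /srcdist; ders.
by rewrite /srcdist; field; rewrite gt_eqF.
Qed.

Lemma continuous_offset_diff x y : Omega x -> Omega y -> continuous (offset_diff x y).
Proof.
move=> Ox Oy; rewrite /offset_diff.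
have c1 := der_continuous (fun a => der_offset a Ox).
have c2 := der_continuous (fun a => der_offset a Oy).
by ctsf.
Qed.

Lemma continuous_srcdist x : continuous (srcdist RE x).
Proof.
have c := der_continuous (der_dot_theta_perp x).
by rewrite /srcdist; ctsf.
Qed.

Lemma continuous_fan_jac x y : Omega x -> Omega y -> continuous (fan_jac x y).
Proof.
move=> Ox Oy; rewrite /fan_jac.
have c1 := @continuous_srcdist x; have c2 := @continuous_srcdist y.
by ctsf => a; rewrite mulf_neq0// gt_eqF// srcdist_gt0.
Qed.

(** The subtracted [t] is the derivative of the [2 pi]-periodic function [T], so its integral over a
    period is zero, and the pointwise bound applies. Only [u * P u] and a primitive of [P] enter,
    which is what makes the estimate uniform for kernels [P] that concentrate at zero. *)
Lemma oscillatory_bound (P Th h : R -> R) x y r : Omega x -> Omega y -> 0 < r ->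
  (x.1 - y.1) ^+ 2 + (x.2 - y.2) ^+ 2 = r ^+ 2 ->
  continuous P -> continuous h -> (forall u : R, is_derive u 1 Th (P u)) ->
  (forall u, `|P u * u| <= h u) -> (forall u, `|Th u| <= h u) ->
  `|\int[mu]_(a in `[- pi, pi]) (P (offset_diff x y a) * fan_jac x y a)| <=
  fan_kernel_cst / r * \int[mu]_(a in `[- pi, pi]) h (offset_diff x y a).
Proof.
move=> Ox Oy r0 rE cP ch dTh hP hT.
have cv := continuous_offset_diff Ox Oy.
have cc := continuous_fan_jac Ox Oy.
have cTh := der_continuous dTh.
pose v' a := RD * (dot_theta_perp x a * srcdist RE x a + dot_theta x a ^+ 2) / srcdist RE x a ^+ 2
  - RD * (dot_theta_perp y a * srcdist RE y a + dot_theta y a ^+ 2) / srcdist RE y a ^+ 2.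
have dv (a : R) : is_derive a 1 (offset_diff x y) (v' a).
  have d1 := der_offset a Ox; have d2 := der_offset a Oy.
  by rewrite /offset_diff /v'; ders.
have d1 := der_dot_theta; have d2 := der_dot_theta_perp.
have c1 z := der_continuous (der_dot_theta z).
have c2 z := der_continuous (der_dot_theta_perp z).
have cx := @continuous_srcdist x; have cy := @continuous_srcdist y.
pose D0 := RE ^+ 2 * r ^+ 2 - cross x y ^+ 2.
pose T a := Th (offset_diff x y a) * (RE * (dot_theta_perp x a - dot_theta_perp y a)) / (RD * D0).
pose t a := (P (offset_diff x y a) * v' a * (RE * (dot_theta_perp x a - dot_theta_perp y a))
   - Th (offset_diff x y a) * (RE * (dot_theta x a - dot_theta y a))) / (RD * D0).
have dT (a : R) : is_derive a 1 T (t a).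
  have d3 := d1 x; have d4 := d1 y; have d5 := d2 x; have d6 := d2 y.
  have d7 : is_derive a 1 (fun a => Th (offset_diff x y a)) (P (offset_diff x y a) * v' a).
    exact: (der_comp (dTh _) (dv a)).
  rewrite /T; eapply der_eq; first by ders.
  by rewrite /t; ring.
have ct : continuous t.
  have c3 := c1 x; have c4 := c1 y; have c5 := c2 x; have c6 := c2 y.
  by rewrite /t /v'; ctsf => a; rewrite expf_neq0// gt_eqF// srcdist_gt0.
have pi0 : - pi < pi :> R by rewrite gtrN// pi_gt0.
have it : \int[mu]_(a in `[- pi, pi]) t a = 0.
  rewrite /Rintegral (FTC_derive pi0 ct dT) /=.
  rewrite /T /offset_diff /offset /srcdist /dot_theta /dot_theta_perp.
  by rewrite cosN sinN sinpi oppr0 subrr.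
set G := fun a => P (offset_diff x y a) * fan_jac x y a.
have cG : continuous G by rewrite /G; ctsf.
have -> : \int[mu]_(a in `[- pi, pi]) G a = \int[mu]_(a in `[- pi, pi]) (G a - t a).
  by rewrite RintegralB//= ?it ?subr0//; exact: continuous_integrable.
apply: le_trans (le_normr_Rintegral _ _) _ => //.
  by apply: continuous_integrable; ctsf.
rewrite -RintegralZl//=; last by apply: continuous_integrable; ctsf.
apply: le_Rintegral => //=.
- by apply: (@continuous_integrable _ (fun a => `|G a - t a|)); ctsf.
- by apply: (@continuous_integrable _ (fun a => fan_kernel_cst / r * h (offset_diff x y a))); ctsf.
move=> a _; rewrite /G /t /D0.
apply: (@ibp_pointwise r (dot_theta x a) (dot_theta_perp x a) (dot_theta y a) (dot_theta_perp y a)) => //.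
- rewrite -rE; have := dot_theta_sqr (x.1 - y.1, x.2 - y.2) a => /= <-.
  by rewrite /dot_theta /dot_theta_perp/=; ring.
- by rewrite dot_theta_sqr; apply/ltW/OmegaE.
- by rewrite dot_theta_sqr; apply/ltW/OmegaE.
Qed.

End fan_kernel.

(** * Correlation kernels of triangles and their differences *)

Section averaged_kernel.
Context {R : realType}.
Variables (RE RD : R).
Hypotheses (hRE : 1 < RE) (hRD : 0 < RD).
Local Notation mu := (@lebesgue_measure R).
Implicit Types (x y : R * R) (d D r : R).

Definition fan_kernel D x y : R :=
  \int[mu]_(a in `[- pi, pi]) (tri D (offset_diff RE RD x y a) * fan_jac RE x y a).

Let cts_tri D x y : 0 < D -> Omega x -> Omega y ->
  continuous (fun a => tri D (offset_diff RE RD x y a)).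
Proof.
move=> D0 Ox Oy; have c1 := continuous_tri D0.
by have c2 := continuous_offset_diff hRE (RD := RD) Ox Oy; ctsf.
Qed.

Let cts_integrand D x y : 0 < D -> Omega x -> Omega y ->
  continuous (fun a => tri D (offset_diff RE RD x y a) * fan_jac RE x y a).
Proof.
move=> D0 Ox Oy; have c1 := cts_tri D0 Ox Oy.
by have c2 := continuous_fan_jac hRE Ox Oy; ctsf.
Qed.

Lemma fan_jac_ge0 x y a : Omega x -> Omega y -> 0 <= fan_jac RE x y a.
Proof.
by move=> Ox Oy; rewrite /fan_jac invr_ge0 mulr_ge0// ltW// srcdist_gt0.
Qed.

Let jac_le x y a : Omega x -> Omega y -> fan_jac RE x y a <= (RE - 1) ^- 2.
Proof.
move=> Ox Oy; have h : 0 < RE - 1 by rewrite subr_gt0.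
have s1 := srcdist_gt0 hRE a Ox; have s2 := srcdist_gt0 hRE a Oy.
rewrite /fan_jac lef_pV2 ?posrE ?mulr_gt0 ?exprn_gt0// expr2.
by apply: ler_pM; rewrite ?(ltW h)// srcdist_ge.
Qed.

Let jac_ge x y a : Omega x -> Omega y -> (RE + 1) ^- 2 <= fan_jac RE x y a.
Proof.
move=> Ox Oy; have h : 0 < RE + 1 by have := hRE; lra.
have s1 := srcdist_gt0 hRE a Ox; have s2 := srcdist_gt0 hRE a Oy.
rewrite /fan_jac lef_pV2 ?posrE ?mulr_gt0 ?exprn_gt0// expr2.
by apply: ler_pM; rewrite ?(ltW s1) ?(ltW s2)// srcdist_le.
Qed.

Let pi_gt : - pi < pi :> R. Proof. by rewrite gtrN// pi_gt0. Qed.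

Let int_cst (k : R) : \int[mu]_(a in `[(- pi : R), pi]) k = k * (2 * pi).
Proof.
rewrite Rintegral_cst//= lebesgue_measure_itv/= lte_fin pi_gt -EFinB/=; ring.
Qed.

Lemma fan_kernel_ge0 D x y : Omega x -> Omega y -> 0 <= fan_kernel D x y.
Proof.
by move=> Ox Oy; apply: Rintegral_ge0 => a _; rewrite mulr_ge0 ?tri_ge0 ?fan_jac_ge0.
Qed.

Lemma fan_kernel_le D x y : 0 < D -> Omega x -> Omega y ->
  fan_kernel D x y <= (RE - 1) ^- 2 * (2 * pi) / D.
Proof.
move=> D0 Ox Oy; rewrite mulrAC -int_cst; apply: le_Rintegral => //=.
- by apply: continuous_integrable; exact: cts_integrand.
- by apply: (@continuous_integrable _ (fun=> (RE - 1) ^- 2 / D)); ctsf.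
- move=> a _; rewrite mulrC; apply: ler_pM => //; first exact: fan_jac_ge0.
  + exact: tri_ge0.
  + exact: jac_le.
  + exact: tri_le.
Qed.

Let dist2 x y r := (x.1 - y.1) ^+ 2 + (x.2 - y.2) ^+ 2 = r ^+ 2.

(** The case [P = tri D], [h = 1/2] of [oscillatory_bound], with the weight removed by its lower
    bound. Used for width [2 * D], it says that the offsets of [x] and [y] are within [D] of each
    other only for a set of angles of measure [O(D / r)]. *)
Let level_bound D x y r : 0 < D -> Omega x -> Omega y -> 0 < r -> dist2 x y r ->
  \int[mu]_(a in `[- pi, pi]) tri D (offset_diff RE RD x y a)
    <= (RE + 1) ^+ 2 * (fan_kernel_cst RE RD / r * pi).
Proof.
move=> D0 Ox Oy r0 rE; have h : 0 < RE + 1 by have := hRE; lra.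
rewrite -ler_pdivrMl ?exprn_gt0//.
have dT (u : R) : is_derive u 1 (tri_prim D) (tri D u) by exact: is_derive_tri_prim.
have := @oscillatory_bound _ _ _ hRE hRD (tri D) (tri_prim D) (fun=> 2^-1) x y r Ox Oy r0 rE
  (continuous_tri D0) (@cont_cst _ _) dT.
rewrite int_cst mulKf// => H; apply: le_trans (H _ _); last 2 first.
- by move=> u; rewrite mulrC tri_mul_norm.
- by move=> u; exact: tri_prim_le.
apply: le_trans (ler_norm _).
rewrite -RintegralZl//; last by apply: continuous_integrable; exact: cts_tri.
apply: le_Rintegral => //=.
- apply: (@continuous_integrable _ (fun a => (RE + 1) ^- 2 * tri D (offset_diff RE RD x y a))).
  by have c := cts_tri D0 Ox Oy; ctsf.
- by apply: continuous_integrable; exact: cts_integrand.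
- by move=> a _; rewrite mulrC ler_wpM2l ?tri_ge0// jac_ge.
Qed.

(** As the two triangles have the same mass, [tri_prim d - tri_prim D] vanishes outside [[-D, D]].
    Hence [h] has to dominate 1 on that interval only, and may be chosen small elsewhere. *)
Let diff_bound (h : R -> R) d D x y r : 0 < d -> d <= D -> Omega x -> Omega y ->
  0 < r -> dist2 x y r -> continuous h -> (forall u, 0 <= h u) ->
  (forall u, `|u| <= D -> 1 <= h u) ->
  `|fan_kernel d x y - fan_kernel D x y| <=
    fan_kernel_cst RE RD / r * \int[mu]_(a in `[- pi, pi]) h (offset_diff RE RD x y a).
Proof.
move=> d0 dD Ox Oy r0 rE ch h0 h1.
have D0 : 0 < D := lt_le_trans d0 dD.
rewrite /fan_kernel -RintegralB//=; last 2 first.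
- by apply: continuous_integrable; exact: cts_integrand.
- by apply: continuous_integrable; exact: cts_integrand.
under eq_Rintegral do rewrite -mulrBl.
have c1 := continuous_tri d0; have c2 := continuous_tri D0.
have d1 (u : R) : is_derive u 1 (tri_prim d) (tri d u) by exact: is_derive_tri_prim.
have d2 (u : R) : is_derive u 1 (tri_prim D) (tri D u) by exact: is_derive_tri_prim.
have out (u : R) : D < `|u| -> d <= `|u| by move=> hu; apply: le_trans dD (ltW hu).
apply: (@oscillatory_bound _ _ _ hRE hRD (fun u => tri d u - tri D u)
   (fun u => tri_prim d u - tri_prim D u)) => //.
- by ctsf.
- move=> u; have [hu|hu] := leP `|u| D; last first.
    by rewrite !tri_out ?subrr ?mul0r ?normr0 ?out// ltW.
  rewrite mulrBl; apply: le_trans (ler_normB _ _) _; apply: le_trans (h1 u hu).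
  have := tri_mul_norm u d0; have := tri_mul_norm u D0.
  by rewrite !(mulrC u); lra.
- move=> u; have [hu|hu] := leP `|u| D; last first.
    rewrite (_ : _ - _ = 0) ?normr0//.
    move: (hu); rewrite lter_normr => /orP[hu'|hu'].
      by rewrite !tri_prim_right ?subrr ?(ltW hu')// (le_trans dD (ltW hu')).
    have hu2 : u < - D by rewrite -(opprK u) ltrN2.
    rewrite !tri_prim_left ?subrr ?(ltW hu2)//.
    by apply: le_trans (ltW hu2) _; rewrite lerN2.
  apply: le_trans (ler_normB _ _) _; apply: le_trans (h1 u hu).
  by have := tri_prim_le u d0; have := tri_prim_le u D0; lra.
Qed.

(** The entries belong to three bounds: [diff_bound] with [h = 1]; [diff_bound] with
    [h = 4 * D * tri (2 * D)], whose integral is estimated by [level_bound]; and the trivial bound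
    of a kernel by its supremum, for points closer than [d]. *)
Definition fan_diff_cst : R := Num.max (fan_kernel_cst RE RD * (2 * pi))
  (Num.max (4 * (RE + 1) ^+ 2 * pi * fan_kernel_cst RE RD ^+ 2) ((RE - 1) ^- 2 * (2 * pi))).

Lemma fan_diff_cst_ge0 : 0 <= fan_diff_cst.
Proof.
rewrite /fan_diff_cst le_max mulr_ge0 ?(ltW (fan_kernel_cst_gt0 hRE hRD))//.
by rewrite mulr_ge0// pi_ge0.
Qed.

Let diff_bound2 d D x y r : 0 < d -> d <= D -> Omega x -> Omega y ->
  0 < r -> dist2 x y r ->
  `|fan_kernel d x y - fan_kernel D x y| <= fan_diff_cst / r * Num.min 1 (D / r).
Proof.
move=> d0 dD Ox Oy r0 rE; have D0 : 0 < D := lt_le_trans d0 dD.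
have K0 := fan_kernel_cst_gt0 hRE hRD.
rewrite minEle; case: ifPn => _.
  have := @diff_bound (fun=> 1) d D x y r d0 dD Ox Oy r0 rE (@cont_cst _ _) _ _.
  rewrite int_cst mul1r mulr1 => H; apply: le_trans (H _ _) _ => //.
  by rewrite mulrAC ler_pM2r ?invr_gt0// /fan_diff_cst le_max lexx.
have D20 : 0 < 2 * D by rewrite mulr_gt0.
have c2 := continuous_tri D20.
have := @diff_bound (fun u => (4 * D) * tri (2 * D) u) d D x y r d0 dD Ox Oy r0 rE _ _ _.
move=> H; apply: le_trans (H _ _ _) _ => //.
- by ctsf.
- by move=> u; rewrite mulr_ge0 ?tri_ge0// mulr_ge0// ltW.
- by move=> u hu; have := tri_half D0 hu; lra.
rewrite RintegralZl//=; last by apply: continuous_integrable; exact: cts_tri.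
have L := level_bound D20 Ox Oy r0 rE.
apply: le_trans (_ : fan_kernel_cst RE RD / r * ((4 * D) * ((RE + 1) ^+ 2 * (fan_kernel_cst RE RD / r * pi))) <= _).
  apply: ler_wpM2l; first by rewrite divr_ge0// ltW.
  by apply: ler_wpM2l => //; rewrite mulr_ge0// ltW.
apply: le_trans (_ : (4 * (RE + 1) ^+ 2 * pi * fan_kernel_cst RE RD ^+ 2) / r * (D / r) <= _).
  by rewrite le_eqVlt; apply/orP; left; apply/eqP; field; rewrite gt_eqF.
rewrite ler_pM2r ?divr_gt0// ler_pM2r ?invr_gt0//.
by rewrite /fan_diff_cst !le_max lexx !orbT.
Qed.

Let powR_min (t e : R) : 0 <= t -> 0 <= e <= 1 -> Num.min 1 t <= t `^ e.
Proof.
move=> t0 /andP[e0 e1]; have [t1|t1] := leP 1 t.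
  by rewrite -[leLHS](powRr0 t) ler_powR.
have [->|tn] := eqVneq t 0; first exact: powR_ge0.
have tp : 0 < t by rewrite lt_neqAle eq_sym tn.
by rewrite -[leLHS](powRr1 t0) ger_powR// ?tp ltW.
Qed.

(** Since [min 1 s <= s^(2 e)], the two bounds interpolate to [D^(2 e) * r^(-(1 + 2 e))]. Half of
    the power goes to each coordinate, so that Schur's test reduces to integrals in one variable;
    the exponent [1/2 + e] is below 1 there. *)
Lemma fan_kernel_diff d D (e : R) x y : 0 < d -> d <= D -> 0 < e < 2^-1 -> Omega x -> Omega y ->
  `|fan_kernel d x y - fan_kernel D x y| <= 4 * fan_diff_cst * D `^ (2 * e) *
    ((d + `|x.1 - y.1|) `^ (- (2^-1 + e)) * (d + `|x.2 - y.2|) `^ (- (2^-1 + e))).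
Proof.
move=> d0 dD /andP[e0 e1] Ox Oy; have D0 : 0 < D := lt_le_trans d0 dD.
pose r := Num.sqrt ((x.1 - y.1) ^+ 2 + (x.2 - y.2) ^+ 2).
have rE : dist2 x y r by rewrite /dist2 sqr_sqrtr// addr_ge0 ?sqr_ge0.
have r0 : 0 <= r by exact: sqrtr_ge0.
(* Below distance [d] both kernels are at most a multiple of [1 / d], so the distance may be cut off
   at [d]; this removes the singularity on the diagonal. *)
pose r' := Num.max d r.
have r'0 : 0 < r' by rewrite lt_max d0.
have C0 := fan_diff_cst_ge0.
have H1 : `|fan_kernel d x y - fan_kernel D x y| <= fan_diff_cst / r' * Num.min 1 (D / r').
  rewrite /r'; have [dr|rd] := leP d r.
    by apply: diff_bound2 => //; exact: lt_le_trans dr.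
  rewrite (_ : Num.min _ _ = 1) ?mulr1; last first.
    by rewrite min_l// ler_pdivlMr// mul1r.
  have := fan_kernel_ge0 d Ox Oy; have := fan_kernel_ge0 D Ox Oy.
  have := fan_kernel_le d0 Ox Oy; have hD := fan_kernel_le D0 Ox Oy.
  have h3 : (RE - 1) ^- 2 * (2 * pi) / d <= fan_diff_cst / d.
    by rewrite ler_pM2r ?invr_gt0// /fan_diff_cst !le_max lexx !orbT.
  have h4 : (RE - 1) ^- 2 * (2 * pi) / D <= (RE - 1) ^- 2 * (2 * pi) / d.
    rewrite ler_wpM2l// ?lef_pV2// mulr_ge0 ?invr_ge0 ?sqr_ge0// mulr_ge0//.
    exact: pi_ge0.
  by move=> *; rewrite ler_norml; lra.
apply: le_trans H1 _.
have e2 : 0 <= 2 * e <= 1 by lra.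
have Dr0 : 0 <= D / r' by rewrite divr_ge0 ?ltW.
apply: le_trans (_ : fan_diff_cst / r' * (D / r') `^ (2 * e) <= _).
  by rewrite ler_wpM2l ?powR_min// divr_ge0// ltW.
pose b := 2^-1 + e.
have E : r'^-1 * (D / r') `^ (2 * e) = D `^ (2 * e) * (r' `^ (- b) * r' `^ (- b)).
  rewrite powRM ?invr_ge0 ?(ltW D0) ?(ltW r'0)// mulrCA; congr (_ * _).
  rewrite -powRD; last by apply/implyP => _; rewrite gt_eqF.
  rewrite -(powR_inv1 (ltW r'0)) -powRrM -powRD; last by apply/implyP => _; rewrite gt_eqF.
  by congr (_ `^ _); rewrite /b; lra.
have half : (2^-1 : R) `^ (- b) <= 2.
  rewrite powRN -(powR_inv1 (ler0n _ 2)) -powRrM -powRN mulN1r opprK.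
  rewrite -[leRHS](powRr1 (ler0n _ 2)) ler_powR ?ler1n// /b; lra.
(* [d + |z| <= 2 * r'] costs a factor [2^b <= 2] for each coordinate, whence the factor 4 of the
   statement. *)
have B (z : R) : `|z| <= r -> r' `^ (- b) <= 2 * (d + `|z|) `^ (- b).
  move=> zr; have dz : 0 < d + `|z| by rewrite ltr_wpDr.
  apply: le_trans (_ : (2^-1 * (d + `|z|)) `^ (- b) <= _); last first.
    by rewrite powRM ?invr_ge0// ?(ltW dz)// ler_wpM2r ?powR_ge0.
  rewrite !powRN lef_pV2 ?posrE ?powR_gt0 ?mulr_gt0//.
  apply: ge0_ler_powR; rewrite ?nnegrE ?(ltW r'0) ?mulr_ge0 ?(ltW dz)//.
    by rewrite /b; lra.
  have h1 : d <= r' by rewrite le_max lexx.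
  have h2 : r <= r' by rewrite le_max lexx orbT.
  lra.
have Z1 : `|x.1 - y.1| <= r.
  by rewrite -(@ler_pXn2r _ 2) ?nnegrE// real_normK ?num_real// -rE lerDl sqr_ge0.
have Z2 : `|x.2 - y.2| <= r.
  by rewrite -(@ler_pXn2r _ 2) ?nnegrE// real_normK ?num_real// -rE lerDr sqr_ge0.
rewrite -mulrA E mulrA -/b.
have -> (p q : R) : 4 * fan_diff_cst * D `^ (2 * e) * (p * q) =
    fan_diff_cst * D `^ (2 * e) * ((2 * p) * (2 * q)) by ring.
apply: ler_wpM2l; first by rewrite mulr_ge0 ?powR_ge0.
by apply: ler_pM; rewrite ?powR_ge0 ?B.
Qed.

End averaged_kernel.

(** * Weakly singular power weights on an interval *)

Section power_integral.
Context {R : realType}.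
Local Notation mu := (@lebesgue_measure R).
Implicit Types (b d : R).

Lemma indic_itvcc (u v t : R) : \1_(`[u, v]%classic : set R) t = (u <= t <= v)%R%:R :> R.
Proof. by rewrite indicE; congr ((nat_of_bool _)%:R); apply/idP/idP; rewrite inE/= in_itv. Qed.

Let pw d b (t : R) : R := (d + `|t|) `^ (- b) * \1_(`[(-2), 2]%classic : set R) t.

Let pw1 d b (t : R) : R := (d + t) `^ (- b) * \1_(`[0, 2]%classic : set R) t.

Let mpow d b : measurable_fun setT (fun t : measurableTypeR R => (d + t) `^ (- b) : measurableTypeR R).
Proof.
have m := @measurable_powR R (- b).
by apply: (measurableT_comp m); mfun.
Qed.

Let mpw1 d b : measurable_fun setT (pw1 d b : measurableTypeR R -> measurableTypeR R).
Proof.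
by have m := mpow d b; rewrite /pw1; apply: measurable_funM.
Qed.

Lemma measurable_trunc_powR d b : measurable_fun setT (pw d b : measurableTypeR R -> measurableTypeR R).
Proof.
have m := mpow d b; rewrite /pw; apply: measurable_funM => //.
by apply: (measurableT_comp m); mfun.
Qed.

(** The bound is uniform in the cut-off [d]: on [[0, 2]] the primitive [(d + t)^(1 - b) / (1 - b)]
    is at most [3 / (1 - b)], and the other half is its mirror image. The interval [[-2, 2]]
    contains all differences of coordinates of points of [Omega]. *)
Lemma integral_trunc_powR d b : 0 < d <= 1 -> 0 < b < 1 ->
  (\int[mu]_t ((d + `|t|) `^ (- b) * \1_(`[(-2), 2]%classic : set R) t)%:E <= (6 / (1 - b))%:E)%E.
Proof.
move=> /andP[d0 d1] /andP[b0 b1].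
have b'0 : 0 < 1 - b by rewrite subr_gt0.
have p1ge t : 0 <= pw1 d b t by rewrite mulr_ge0 ?powR_ge0.
have m1 := mpw1 d b.
have I1 : (\int[mu]_t (pw1 d b t)%:E <= (3 / (1 - b))%:E)%E.
  have -> : (\int[mu]_t (pw1 d b t)%:E = \int[mu]_(t in `[0%R, 2%R]) ((d + t) `^ (- b))%:E)%E.
    rewrite [RHS]integral_mkcond; apply: eq_integral => t _.
    by rewrite patchE /pw1 indicE; case: ifPn => _; rewrite ?mulr1 ?mulr0.
  pose F t := (1 - b)^-1 * (d + t) `^ (1 - b).
  have dF (t : R) : 0 <= t -> is_derive t 1 F ((d + t) `^ (- b)).
    move=> t0; have dt : 0 < d + t by rewrite ltr_wpDr.
    have d2 := is_derive1_powR (1 - b) dt.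
    have d3 : is_derive t 1 (fun t => (d + t) `^ (1 - b)) ((1 - b) * (d + t) `^ (1 - b - 1) * (0 + 1)).
      by apply: (der_comp d2); ders.
    rewrite /F; eapply der_eq; first by ders.
    rewrite mulr0 addr0 add0r mulr1 mulrA mulVf ?gt_eqF// mul1r; congr (_ `^ _); lra.
  have cf (t : R) : 0 <= t -> {for t, continuous (fun t => (d + t) `^ (- b))}.
    move=> t0; have dt : 0 < d + t by rewrite ltr_wpDr.
    have d2 := is_derive1_powR (- b) dt.
    have d3 : is_derive t 1 (fun t => (d + t) `^ (- b)) ((- b) * (d + t) `^ (- b - 1) * (0 + 1)).
      by apply: (der_comp d2); ders.
    exact/differentiable_continuous/derivable1_diffP.
  have cF (t : R) : 0 <= t -> {for t, continuous F}.
    by move=> t0; have d2 := dF t t0; exact/differentiable_continuous/derivable1_diffP.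
  rewrite (@continuous_FTC2 _ _ F) ?ltr0n//.
  - rewrite -EFinB lee_fin.
    apply: le_trans (_ : F 2 <= _).
      by rewrite gerBl mulr_ge0 ?powR_ge0// invr_ge0 ltW.
    rewrite /F mulrC ler_pM2r ?invr_gt0//.
    apply: le_trans (_ : 3 `^ (1 - b) <= _).
      by apply: ge0_ler_powR; rewrite ?nnegrE//; lra.
    by rewrite -[leRHS](powRr1 (ler0n _ 3)) ler_powR ?ler1n//; lra.
  - apply/continuous_in_subspaceT => t; rewrite inE/= in_itv/= => /andP[t0 _].
    exact: cf.
  - split.
    + by move=> t; rewrite in_itv/= => /andP[t0 _]; have d2 := dF t (ltW t0); exact: ex_derive.
    + by apply: cvg_at_right_filter; exact: cF.
    + by apply: cvg_at_left_filter; exact: cF.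
  - move=> t; rewrite in_itv/= => /andP[t0 _]; rewrite derive1E.
    by have d2 := dF t (ltW t0); rewrite derive_val.
have I2 : (\int[mu]_t (pw1 d b (- t)%R)%:E = \int[mu]_t (pw1 d b t)%:E)%E.
  have n1 : (-1 : R) != 0 by rewrite oppr_eq0 oner_eq0.
  rewrite [RHS](@ge0_integral_affine _ (-1) 0)//; last by mfun.
  rewrite normrN normr1 mul1e; apply: eq_integral => t _.
  by rewrite mulN1r addr0.
have m2 : measurable_fun setT (fun t : measurableTypeR R => pw1 d b (- t)).
  by apply: (measurableT_comp m1); mfun.
have m3 := measurable_trunc_powR d b.
apply: le_trans (_ : \int[mu]_t ((pw1 d b t)%:E + (pw1 d b (- t)%R)%:E) <= _)%E.
  apply: ge0_int_le => //.
  - exact/measurable_EFinP.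
  - by apply: emeasurable_funD; mfun.
  - by move=> t; rewrite lee_fin mulr_ge0 ?powR_ge0.
  move=> t; rewrite -EFinD lee_fin /pw1 !indic_itvcc.
  have [t0|t0] := leP 0 t.
    rewrite ger0_norm// (_ : (-2 <= t <= 2) = (t <= 2)); last by rewrite (le_trans _ t0)// oppr_le0.
    by rewrite lerDl mulr_ge0 ?powR_ge0.
  rewrite ltr0_norm// (_ : (-2 <= t <= 2) = (0 <= - t <= 2)).
    by rewrite lerDr mulr_ge0 ?powR_ge0.
  by apply/idP/idP => /andP[? ?]; apply/andP; split; lra.
rewrite ge0_int_add//; [|by mfun|by mfun|by move=> t; rewrite lee_fin].
rewrite I2 (_ : (6 / (1 - b))%:E = (3 / (1 - b))%:E + (3 / (1 - b))%:E)%E ?leeD//.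
by rewrite -EFinD; congr (_%:E); lra.
Qed.

End power_integral.

(** * Ray integrals of Lipschitz functions *)

Section polarization.
Context {R : realType}.
Local Notation mu := (@lebesgue_measure R).
Local Notation RR := (measurableTypeR R).
Implicit Types (g : RR -> R) (D : R).

(* Polarization trades differences for correlations, which have explicit kernels. *)
Lemma tri_polarize g D : 0 < D -> measurable_fun setT (g : RR -> RR) -> (forall u, 0 <= g u) ->
  (\int[mu]_u \int[mu]_v (tri D (u - v) * (g u - g v) ^+ 2)%:E +
   2%:E * \int[mu]_u \int[mu]_v (tri D (u - v) * (g u * g v))%:E =
   2%:E * \int[mu]_u ((g u) ^+ 2)%:E)%E.
Proof.
move=> D0 mg g0.
have mt := @measurable_tri R D.
have t0 u : 0 <= tri D u := tri_ge0 D u.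
have tC u v : tri D (u - v) = tri D (v - u) by rewrite -triN opprB.
have m1 : measurable_fun setT (fun z : RR * RR => (tri D (z.1 - z.2) * (g z.1 - g z.2) ^+ 2)%:E).
  by mfun.
have m2 : measurable_fun setT (fun z : RR * RR => (2 * (tri D (z.1 - z.2) * (g z.1 * g z.2)))%:E).
  by mfun.
have m2' : measurable_fun setT (fun z : RR * RR => (tri D (z.1 - z.2) * (g z.1 * g z.2))%:E).
  by mfun.
have m3 : measurable_fun setT (fun z : RR * RR => (g z.1 ^+ 2 * tri D (z.1 - z.2))%:E).
  by mfun.
have m4 : measurable_fun setT (fun z : RR * RR => (g z.2 ^+ 2 * tri D (z.1 - z.2))%:E).
  by mfun.
rewrite -(fubini_tonelli1 _ m1)/=; last by move=> z; rewrite lee_fin mulr_ge0 ?sqr_ge0.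
rewrite -(fubini_tonelli1 _ m2')/=; last by move=> z; rewrite lee_fin mulr_ge0// mulr_ge0.
rewrite -ge0_int_scale//; last by move=> z; rewrite lee_fin mulr_ge0// mulr_ge0.
rewrite -ge0_int_add//; last 2 first.
- by move=> z; rewrite lee_fin mulr_ge0 ?sqr_ge0.
- by move=> z; rewrite -EFinM lee_fin mulr_ge0// mulr_ge0// mulr_ge0.
transitivity (\int[(mu \x mu)%E]_z ((g z.1 ^+ 2 * tri D (z.1 - z.2))%:E +
                       (g z.2 ^+ 2 * tri D (z.1 - z.2))%:E))%E.
  by apply: eq_integral => z _; rewrite -EFinM -!EFinD; congr (_%:E); ring.
rewrite ge0_int_add; [|exact: m3|exact: m4|by move=> z; rewrite lee_fin mulr_ge0 ?sqr_ge0|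
  by move=> z; rewrite lee_fin mulr_ge0 ?sqr_ge0].
rewrite (fubini_tonelli1 _ m3); last by move=> z; rewrite lee_fin mulr_ge0 ?sqr_ge0.
rewrite (fubini_tonelli2 _ m4); last by move=> z; rewrite lee_fin mulr_ge0 ?sqr_ge0.
have E u (h : RR -> R) : (forall v, h v = tri D (v - u)) ->
    (\int[mu]_v (g u ^+ 2 * h v)%:E = (g u ^+ 2)%:E)%E.
  move=> hE; under eq_integral do rewrite hE EFinM.
  rewrite ge0_int_scale; [|exact: sqr_ge0|by mfun|by move=> v; rewrite lee_fin].
  by rewrite integral_tri// mule1.
rewrite (_ : 2%:E = 1 + 1)%E; last by rewrite -EFinD.
rewrite ge0_muleDl ?lee_fin// !mul1e; congr (_ + _)%E; apply: eq_integral => u _.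
  by apply: (E u (fun v => tri D (u - v))) => v; exact: tC.
exact: (E u (fun v => tri D (v - u))).
Qed.

End polarization.

Section test_functions.
Context {R : realType}.
Variables (RE RD : R).
Hypotheses (hRE : 1 < RE) (hRD : 0 < RD).
Local Notation mu := (@lebesgue_measure R).
Local Notation RR := (measurableTypeR R).
Implicit Types (f : RR * RR -> R).

(** Nonnegativity gives access to Tonelli's theorem without integrability. The Lipschitz constant is
    only used qualitatively: for boundedness and for the convergence of the energy at vanishing
    width. *)
Record test_fun f : Prop := TestFun {
  test_ge0 : forall x, 0 <= f x ;
  test_meas : measurable_fun setT (f : RR * RR -> RR) ;
  test_lip : exists2 L : R, 0 <= L &
    forall x y, `|f x - f y| <= L * (`|x.1 - y.1| + `|x.2 - y.2|) ;
  test_supp : forall x, f x != 0 -> Omega x }.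

Lemma test_out f x : test_fun f -> ~ Omega x -> f x = 0.
Proof. by move=> tf; have := test_supp tf (x := x); case: eqVneq => // _ /(_ isT). Qed.

(** Compares with the boundary point [(1, 0)], where [f] vanishes; its [l^1] distance to points of
    [Omega] is at most 3. *)
Lemma test_bounded f : test_fun f -> exists2 M : R, 0 <= M & forall x, f x <= M.
Proof.
move=> tf; have [L L0 hL] := test_lip tf; exists (L * 3); first by rewrite mulr_ge0.
move=> x; have [Ox|nOx] := pselect (Omega x); last by rewrite (test_out tf)// mulr_ge0.
have f1 : f (1, 0) = 0.
  by apply: test_out => // /OmegaE/=; rewrite expr0n addr0 expr1n ltxx.
apply: le_trans (ler_norm _) _; have := hL x (1, 0); rewrite f1 subr0 /= => h.
apply: le_trans h _; apply: ler_wpM2l => //; rewrite subr0.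
move/OmegaE : Ox => Ox.
have h1 : `|x.1| <= 1.
  by rewrite -(@ler_pXn2r _ 2) ?nnegrE// real_normK ?num_real// expr1n; have := sqr_ge0 x.2; lra.
have h2 : `|x.2| <= 1.
  by rewrite -(@ler_pXn2r _ 2) ?nnegrE// real_normK ?num_real// expr1n; have := sqr_ge0 x.1; lra.
by apply: le_trans (lerD (ler_normB _ _) h2) _; rewrite normr1; lra.
Qed.

(** The transform without its factor [sqrt (xi^2 + RD^2)]. That factor is Lipschitz in [xi] and is
    dealt with separately. *)
Definition ray_int f (xi a : R) : R := fine (\int[mu]_t (f (fan_ray RE RD xi a t))%:E)%E.

Let Tm := 2 * RE / RD.

Let Tm0 : 0 < Tm.
Proof. by rewrite /Tm divr_gt0// mulr_gt0//; apply: lt_trans hRE. Qed.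

Let iT (t : R) : R := \1_(`[0, Tm]%classic : set R) t.

Let int_iT (k : R) : 0 <= k -> (\int[mu]_t (k * iT t)%:E = (k * Tm)%:E)%E.
Proof.
move=> k0; under eq_integral do rewrite EFinM.
rewrite ge0_int_scale//; last 2 first.
  by apply/measurable_EFinP; apply: measurable_indic; exact: measurable_itv.
  by move=> t; rewrite lee_fin.
rewrite integral_indic//= setIT lebesgue_measure_itv/= lte_fin Tm0 -EFinB subr0.
by rewrite -EFinM.
Qed.

Let m_iT : measurable_fun setT (iT : RR -> RR).
Proof. by apply: measurable_indic; exact: measurable_itv. Qed.

Let iT_in t : 0 < t < Tm -> iT t = 1.
Proof. by move=> /andP[t0 t1]; rewrite /iT indic_itvcc !ltW. Qed.

Lemma measurable_on_ray f : measurable_fun setT (f : RR * RR -> RR) ->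
  measurable_fun setT (fun z : RR * RR * RR => f (fan_ray RE RD z.1.1 z.1.2 z.2) : RR).
Proof. by move=> mf; apply: (measurableT_comp mf); exact: measurable_fan_ray. Qed.

Let m_ray1 f xi a : test_fun f ->
  measurable_fun setT (fun t : RR => f (fan_ray RE RD xi a t) : RR).
Proof.
move=> tf; apply: (measurableT_comp (measurable_on_ray (test_meas tf)) (g := fun t => ((xi, a), t))).
by mfun.
Qed.

Let ray_int_fin f xi a : test_fun f ->
  (\int[mu]_t (f (fan_ray RE RD xi a t))%:E)%E \is a fin_num.
Proof.
move=> tf; have [M M0 hM] := test_bounded tf.
have m1 := m_ray1 xi a tf.
rewrite ge0_fin_numE; last by apply: integral_ge0 => t _; rewrite lee_fin test_ge0.
apply: le_lt_trans (_ : \int[mu]_t (M * iT t)%:E < +oo)%E; last by rewrite int_iT// ltry.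
apply: ge0_int_le; [by mfun|by mfun|by move=> t; rewrite lee_fin test_ge0|].
move=> t; rewrite lee_fin.
have [Or|nO] := pselect (Omega (fan_ray RE RD xi a t)); last first.
  by rewrite (test_out tf)// mulr_ge0.
by rewrite iT_in ?mulr1//; exact: fan_ray_Omega Or.
Qed.

Lemma ray_intE f xi a : test_fun f ->
  (\int[mu]_t (f (fan_ray RE RD xi a t))%:E = (ray_int f xi a)%:E)%E.
Proof. by move=> tf; rewrite /ray_int fineK// ray_int_fin. Qed.

Lemma ray_int_ge0 f xi a : test_fun f -> 0 <= ray_int f xi a.
Proof.
by move=> tf; rewrite /ray_int fine_ge0// integral_ge0// => t _; rewrite lee_fin test_ge0.
Qed.

Lemma measurable_ray_int f : test_fun f ->
  measurable_fun setT (fun z : RR * RR => ray_int f z.1 z.2 : RR).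
Proof.
move=> tf; have m := measurable_on_ray (test_meas tf).
have m2 : measurable_fun setT (fun z : RR * RR * RR => (f (fan_ray RE RD z.1.1 z.1.2 z.2))%:E).
  by apply/measurable_EFinP.
have m3 := measurable_fun_fubini_tonelli_F (m2 := mu) _ m2
  (fun z => test_ge0 tf (fan_ray RE RD z.1.1 z.1.2 z.2)).
have := measurableT_comp (fine_measurable measurableT) m3.
apply: eq_measurable_fun => z _ /=.
by rewrite /ray_int; case: z.
Qed.

Lemma offset_le x a : Omega x -> `|offset RE RD x a| <= RD / (RE - 1).
Proof.
move=> Ox; have s0 := srcdist_gt0 hRE a Ox; have R1 : 0 < RE - 1 by rewrite subr_gt0.
rewrite /offset 2!normrM normfV (gtr0_norm s0) (gtr0_norm hRD).
apply: ler_pM; rewrite ?mulr_ge0 ?invr_ge0 ?(ltW s0) ?(ltW hRD)//.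
  by rewrite -[leRHS]mul1r ler_pM2r// norm_dot_theta.
by rewrite lef_pV2 ?posrE// srcdist_ge.
Qed.

Lemma offset_fan_ray (xi a t : R) : 0 < t -> offset RE RD (fan_ray RE RD xi a t) a = xi.
Proof.
move=> t0; rewrite /offset /srcdist fan_ray_rot dot_theta_rot dot_theta_perp_rot subrK.
by field; rewrite !gt_eqF.
Qed.

Lemma ray_int_out f xi a : test_fun f -> RD / (RE - 1) < `|xi| -> ray_int f xi a = 0.
Proof.
move=> tf h; rewrite /ray_int integral0_eq// => t _.
rewrite (test_out tf)// => Or.
have /andP[t0 _] := fan_ray_Omega hRE hRD Or.
by have := offset_le a Or; rewrite offset_fan_ray// leNgt h.
Qed.

Lemma ray_int_bounded f : test_fun f -> exists2 M : R, 0 <= M & forall xi a, ray_int f xi a <= M.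
Proof.
move=> tf; have [M M0 hM] := test_bounded tf.
exists (M * Tm) => [|xi a]; first by rewrite mulr_ge0// ltW.
rewrite -lee_fin -ray_intE// -int_iT//.
have m1 := m_ray1 xi a tf.
apply: ge0_int_le; [by mfun|by mfun|by move=> t; rewrite lee_fin test_ge0|].
move=> t; rewrite lee_fin.
have [Or|nO] := pselect (Omega (fan_ray RE RD xi a t)); last first.
  by rewrite (test_out tf)// mulr_ge0.
by rewrite iT_in ?mulr1//; exact: fan_ray_Omega Or.
Qed.

(** Changing the offset from [u] to [v] moves the ray point of parameter [t] by
    [t * (u - v) * theta(a)], whose [l^1] norm is at most [2 * Tm * |u - v|]; a further factor [Tm]
    is the length of the parameter interval. *)
Lemma ray_int_lip f : test_fun f -> exists2 L : R, 0 <= L &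
  forall a u v, `|ray_int f u a - ray_int f v a| <= L * `|u - v|.
Proof.
move=> tf; have [L L0 hL] := test_lip tf.
have T0 := ltW Tm0; exists (L * 2 * Tm * Tm) => [|a u v]; first by rewrite mulr_ge0// mulr_ge0// mulr_ge0.
wlog suff H : u v / ray_int f u a <= ray_int f v a + L * 2 * Tm * Tm * `|u - v|.
  by rewrite ler_distlC; have := H u v; have := H v u; rewrite (distrC v); lra.
have m1 := m_ray1 u a tf; have m2 := m_ray1 v a tf.
have k0 : 0 <= L * 2 * Tm * `|u - v| by rewrite mulr_ge0// mulr_ge0// mulr_ge0.
rewrite -lee_fin EFinD -!ray_intE// [X in X%:E](_ : _ = L * 2 * Tm * `|u - v| * Tm); last by ring.
rewrite -int_iT// -ge0_int_add; [|by mfun|by mfun|by move=> t; rewrite lee_fin test_ge0|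
  by move=> t; rewrite lee_fin mulr_ge0].
apply: ge0_int_le; [by mfun|by apply: emeasurable_funD; mfun|by move=> t; rewrite lee_fin test_ge0|].
move=> t; rewrite -EFinD lee_fin.
have [Ou|nOu] := pselect (Omega (fan_ray RE RD u a t)); last first.
  by rewrite (test_out tf nOu) addr_ge0 ?test_ge0// mulr_ge0.
have /andP[t0 t1] := fan_ray_Omega hRE hRD Ou.
rewrite iT_in ?t0// mulr1 -lerBlDl; apply: le_trans (ler_norm _) _.
apply: le_trans (hL _ _) _; rewrite [leRHS](_ : _ = L * (Tm * (`|u - v| * 2))); last by ring.
apply: ler_wpM2l => //; rewrite /fan_ray/=.
have -> : t * (u * cos a - RD * sin a) + RE * sin a - (t * (v * cos a - RD * sin a) + RE * sin a) =
  t * ((u - v) * cos a) by ring.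
have -> : t * (u * sin a + RD * cos a) - RE * cos a - (t * (v * sin a + RD * cos a) - RE * cos a) =
  t * ((u - v) * sin a) by ring.
rewrite !normrM (gtr0_norm t0) -mulrDr -mulrDr.
have hc : `|cos a| <= 1 by rewrite ler_norml cos_geN1 cos_le1.
have hs : `|sin a| <= 1 by rewrite ler_norml sin_geN1 sin_le1.
apply: le_trans (_ : t * (`|u - v| * 2) <= _).
  by apply: ler_wpM2l; [exact: ltW|apply: ler_wpM2l => //; lra].
by apply: ler_wpM2r; [rewrite mulr_ge0|exact: ltW].
Qed.

(** [fan_integral] is applied twice: to the inner integral with weight [tri D (u - .)], and, after
    an exchange of the integrals, to the outer one with weight [tri D (. - offset y a)]. *)
Lemma fan_correlation f D a : 0 < D -> test_fun f ->
  (\int[mu]_u \int[mu]_v (tri D (u - v) * (ray_int f u a * ray_int f v a))%:E =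
   \int[leb2]_x \int[leb2]_y
     (f x * f y * (tri D (offset_diff RE RD x y a) * fan_jac RE x y a))%:E)%E.
Proof.
move=> D0 tf.
have mt := @measurable_tri R D.
have mf := test_meas tf.
have mg0 := measurable_ray_int tf.
have mg : measurable_fun setT (fun u : RR => ray_int f u a : RR).
  by apply: (measurableT_comp mg0 (g := fun u => (u, a))); mfun.
have ms0 := @measurable_srcdist R RE.
have ms : measurable_fun setT (fun x : RR * RR => srcdist RE x a : RR).
  by apply: (measurableT_comp ms0 (g := fun u => (u, a))); mfun.
have mo0 := @measurable_offset R RE RD.
have mo : measurable_fun setT (fun x : RR * RR => offset RE RD x a : RR).
  by apply: (measurableT_comp mo0 (g := fun u => (u, a))); mfun.
have fs0 x : 0 <= f x / srcdist RE x a.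
  have [Ox|/(test_out tf) ->] := pselect (Omega x); last by rewrite mul0r.
  by rewrite divr_ge0 ?test_ge0// ltW// srcdist_gt0.
have S (phi : RR -> RR) : measurable_fun setT phi -> (forall u, 0 <= phi u) ->
    (\int[mu]_u (phi u * ray_int f u a)%:E =
     \int[leb2]_x (phi (offset RE RD x a) * (f x / srcdist RE x a))%:E)%E.
  move=> mp p0; rewrite -(fan_integral hRE hRD a mf mp (test_ge0 tf) p0 (test_supp tf)).
  by apply: eq_integral => u _; rewrite ray_intE.
transitivity (\int[mu]_u \int[leb2]_y (ray_int f u a *
     (tri D (u - offset RE RD y a) * (f y / srcdist RE y a)))%:E)%E.
  apply: eq_integral => u _.
  under eq_integral do rewrite mulrCA EFinM.
  under [RHS]eq_integral do rewrite EFinM.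
  rewrite ge0_int_scale; last 3 first.
  - exact: ray_int_ge0.
  - by mfun.
  - by move=> v; rewrite lee_fin mulr_ge0 ?tri_ge0 ?ray_int_ge0.
  rewrite ge0_int_scale; last 3 first.
  - exact: ray_int_ge0.
  - by mfun.
  - by move=> v; rewrite lee_fin mulr_ge0 ?tri_ge0.
  congr (_ * _)%E; apply: (S (fun v => tri D (u - v))) => [|v]; last exact: tri_ge0.
  by mfun.
have m1 : measurable_fun setT (fun z : RR * (RR * RR) => (ray_int f z.1 a *
     (tri D (z.1 - offset RE RD z.2 a) * (f z.2 / srcdist RE z.2 a)))%:E).
  by mfun.
rewrite (fubini_tonelli _ m1)/=; last first.
  by move=> z; rewrite lee_fin mulr_ge0 ?ray_int_ge0// mulr_ge0 ?tri_ge0.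
have m2 : measurable_fun setT (fun z : (RR * RR) * (RR * RR) =>
   (f z.1 * f z.2 * (tri D (offset_diff RE RD z.1 z.2 a) * fan_jac RE z.1 z.2 a))%:E).
  by rewrite /offset_diff /fan_jac; mfun.
have p2 z : 0 <= f z.1 * f z.2 * (tri D (offset_diff RE RD z.1 z.2 a) * fan_jac RE z.1 z.2 a).
  rewrite mulrCA mulr_ge0 ?tri_ge0// /fan_jac invfM.
  by have := mulr_ge0 (fs0 z.1) (fs0 z.2); rewrite mulrACA.
rewrite [RHS](fubini_tonelli _ m2)/=; last by move=> z; rewrite lee_fin.
apply: eq_integral => y _.
transitivity (\int[mu]_u ((f y / srcdist RE y a)%:E *
    (tri D (u - offset RE RD y a) * ray_int f u a)%:E))%E.
  by apply: eq_integral => u _; rewrite -EFinM; congr (_%:E); ring.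
rewrite ge0_int_scale//; last 2 first.
- by mfun.
- by move=> u; rewrite lee_fin mulr_ge0 ?tri_ge0 ?ray_int_ge0.
rewrite (S (fun u => tri D (u - offset RE RD y a))); [|by mfun|by move=> u; exact: tri_ge0].
rewrite -ge0_int_scale//; last 2 first.
- by mfun.
- by move=> u; rewrite lee_fin mulr_ge0 ?tri_ge0.
apply: eq_integral => x _; rewrite -EFinM; congr (_%:E).
by rewrite /offset_diff /fan_jac invfM; ring.
Qed.

End test_functions.

(** * Smoothing in the offset *)

Section smoothing.
Context {R : realType}.
Variables (RE RD : R).
Hypotheses (hRE : 1 < RE) (hRD : 0 < RD).
Local Notation mu := (@lebesgue_measure R).
Local Notation RR := (measurableTypeR R).
Implicit Types (f : RR * RR -> R) (d D e : R).

(** The restriction to one period is carried as a weight, so that all angular integrals run over the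
    whole line and fit the product measures. *)
Definition ind_pi (a : R) : R := \1_(`[(- pi), pi[%classic : set R) a.

Lemma ind_pi_ge0 a : 0 <= ind_pi a. Proof. by []. Qed.

Lemma measurable_ind_pi : measurable_fun setT (ind_pi : RR -> RR).
Proof. by apply: measurable_indic; exact: measurable_itv. Qed.

Lemma integral_ind_pi (k : R) : 0 <= k -> (\int[mu]_a (ind_pi a * k)%:E = (2 * pi * k)%:E)%E.
Proof.
move=> k0; under eq_integral do rewrite mulrC EFinM.
have mI := measurable_ind_pi.
rewrite ge0_int_scale; [|exact: k0|by mfun|by move=> a; rewrite lee_fin].
rewrite integral_indic//= setIT lebesgue_measure_itv/= lte_fin gtrN ?pi_gt0// -EFinB -EFinM.
by congr (_%:E); ring.
Qed.

Lemma integral_ind_pi_cont (h : R -> R) : continuous h ->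
  (\int[mu]_a (ind_pi a * h a)%:E = (\int[mu]_(a in `[(- pi : R), pi]) h a)%:E)%E.
Proof.
move=> ch.
transitivity (\int[mu]_(a in `[(- pi)%R, pi[) (h a)%:E)%E.
  rewrite [RHS]integral_mkcond; apply: eq_integral => a _.
  by rewrite patchE /ind_pi indicE; case: ifPn => _; rewrite ?mul1r ?mul0r.
rewrite integral_itv_bndo_bndc; last first.
  apply/measurable_EFinP; apply: measurable_funTS.
  exact: continuous_measurable_fun.
rewrite /Rintegral fineK//; apply: integrable_fin_num => //.
exact: continuous_integrable.
Qed.

Definition sqr_int f : \bar R := (\int[leb2]_x (f x ^+ 2)%:E)%E.

Definition fan_energy D f : \bar R := (\int[mu]_a ((ind_pi a)%:E *
  \int[mu]_u \int[mu]_v (tri D (u - v) * (ray_int RE RD f u a - ray_int RE RD f v a) ^+ 2)%:E))%E.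

Let fan_corr D f : \bar R := (\int[mu]_a ((ind_pi a)%:E *
  \int[mu]_u \int[mu]_v (tri D (u - v) * (ray_int RE RD f u a * ray_int RE RD f v a))%:E))%E.

Let fan_mass f : \bar R := (\int[mu]_a ((ind_pi a)%:E *
  \int[mu]_u ((ray_int RE RD f u a) ^+ 2)%:E))%E.

Lemma measurable_int2 (F : R -> R -> R -> R) : (forall a u v, 0 <= F a u v) ->
  measurable_fun setT (fun z : RR * RR * RR => F z.1.1 z.1.2 z.2 : RR) ->
  measurable_fun setT (fun a : RR => \int[mu]_u \int[mu]_v (F a u v)%:E)%E.
Proof.
move=> F0 mF.
have mF' : measurable_fun setT (fun z : RR * RR * RR => (F z.1.1 z.1.2 z.2)%:E).
  exact/measurable_EFinP.
have m1 := measurable_fun_fubini_tonelli_F (m2 := mu) _ mF' (fun z => F0 _ _ _).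
apply: (measurable_fun_fubini_tonelli_F (m2 := mu)
  (fun z : RR * RR => \int[mu]_v (F z.1 z.2 v)%:E)%E) => [|z].
  exact: m1.
by apply: integral_ge0 => v _; rewrite lee_fin.
Qed.

(** Polarization integrated over the angle. The right-hand side does not depend on [D], so comparing
    two widths eliminates it; the identity is kept in additive form because differences of extended
    reals may be undefined. *)
Let energy_corr D f : 0 < D -> test_fun f ->
  (fan_energy D f + 2%:E * fan_corr D f = 2%:E * fan_mass f)%E.
Proof.
move=> D0 tf.
have mt := @measurable_tri R D.
have mI := measurable_ind_pi.
have mg := measurable_ray_int RE RD tf.
have g0 u a := ray_int_ge0 RE RD u a tf.
have t0 u := tri_ge0 D u.
have mgu a : measurable_fun setT (fun u : RR => ray_int RE RD f u a : RR).
  by mfun.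
have m1 : measurable_fun setT (fun a : RR => \int[mu]_u \int[mu]_v
     (tri D (u - v) * (ray_int RE RD f u a - ray_int RE RD f v a) ^+ 2)%:E)%E.
  by apply: measurable_int2 => [? ? ?|]; [rewrite mulr_ge0 ?sqr_ge0|mfun].
have m2 : measurable_fun setT (fun a : RR => \int[mu]_u \int[mu]_v
     (tri D (u - v) * (ray_int RE RD f u a * ray_int RE RD f v a))%:E)%E.
  by apply: measurable_int2 => [? ? ?|]; [rewrite mulr_ge0// mulr_ge0|mfun].
have m3 : measurable_fun setT (fun a : RR => \int[mu]_u ((ray_int RE RD f u a) ^+ 2)%:E)%E.
  apply: (measurable_fun_fubini_tonelli_F (m2 := mu)
    (fun z : RR * RR => (ray_int RE RD f z.2 z.1 ^+ 2)%:E)) => [|z]; first by mfun.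
  by rewrite lee_fin sqr_ge0.
have p1 a : (0 <= \int[mu]_u \int[mu]_v
     (tri D (u - v) * (ray_int RE RD f u a - ray_int RE RD f v a) ^+ 2)%:E)%E.
  by apply: integral_ge0 => u _; apply: integral_ge0 => v _; rewrite lee_fin mulr_ge0 ?sqr_ge0.
have p2 a : (0 <= \int[mu]_u \int[mu]_v
     (tri D (u - v) * (ray_int RE RD f u a * ray_int RE RD f v a))%:E)%E.
  by apply: integral_ge0 => u _; apply: integral_ge0 => v _; rewrite lee_fin mulr_ge0// mulr_ge0.
have p3 a : (0 <= \int[mu]_u ((ray_int RE RD f u a) ^+ 2)%:E)%E.
  by apply: integral_ge0 => u _; rewrite lee_fin sqr_ge0.
have mIE : measurable_fun setT (fun a : RR => (ind_pi a)%:E) by mfun.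
have i0 a : (0 <= (ind_pi a)%:E)%E by rewrite lee_fin.
rewrite /fan_energy /fan_corr /fan_mass.
rewrite -ge0_int_scale//; last 2 first.
- exact: emeasurable_funM.
- by move=> a; rewrite mule_ge0.
rewrite -ge0_int_scale//; last 2 first.
- exact: emeasurable_funM.
- by move=> a; rewrite mule_ge0.
rewrite -ge0_int_add//; last 4 first.
- by apply: emeasurable_funM; [exact: mIE|exact: m1].
- by apply: emeasurable_funM => //; exact: emeasurable_funM.
- by move=> a; rewrite mule_ge0.
- by move=> a; rewrite mule_ge0// mule_ge0.
apply: eq_integral => a _.
have := tri_polarize D0 (mgu a) (fun u => g0 u a); move: (p1 a) (p2 a).
set A := (\int[mu]_u \int[mu]_v (_ * (_ - _) ^+ 2)%:E)%E.
set B := (\int[mu]_u \int[mu]_v (_ * (_ * _))%:E)%E.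
set M := (\int[mu]_u (_ ^+ 2)%:E)%E.
move: (ind_pi a)%:E (i0 a); clearbody A B M => w w0 A0 B0 E.
by rewrite (muleCA _ w M) -E ge0_muleDr ?mule_ge0// (muleCA w).
Qed.

(** With the angular integral innermost, the correlation becomes a quadratic form in [f] whose
    kernel is [fan_kernel], as [corr_val] then shows. *)
Let fan_corrE D f : 0 < D -> test_fun f ->
  (fan_corr D f = \int[leb4]_z
    \int[mu]_a (f z.1 * f z.2 * (ind_pi a * (tri D (offset_diff RE RD z.1 z.2 a) * fan_jac RE z.1 z.2 a)))%:E)%E.
Proof.
move=> D0 tf.
have mt := @measurable_tri R D.
have mI := measurable_ind_pi.
have mf := test_meas tf.
have ms0 := @measurable_srcdist R RE.
have mo0 := @measurable_offset R RE RD.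
have p2 z a : 0 <= f z.1 * f z.2 * (tri D (offset_diff RE RD z.1 z.2 a) * fan_jac RE z.1 z.2 a).
  have [Oz1|/(test_out tf) ->] := pselect (Omega z.1); last by rewrite !mul0r.
  have [Oz2|/(test_out tf) ->] := pselect (Omega z.2); last by rewrite mulr0 !mul0r.
  apply: mulr_ge0; first by rewrite mulr_ge0 ?test_ge0.
  by rewrite mulr_ge0 ?tri_ge0 ?fan_jac_ge0.
have m1 a : measurable_fun setT (fun z : (RR * RR) * (RR * RR) =>
   (f z.1 * f z.2 * (tri D (offset_diff RE RD z.1 z.2 a) * fan_jac RE z.1 z.2 a))%:E).
  by rewrite /offset_diff /fan_jac; mfun.
have m2 : measurable_fun setT (fun z : RR * ((RR * RR) * (RR * RR)) =>
   (f z.2.1 * f z.2.2 * (ind_pi z.1 * (tri D (offset_diff RE RD z.2.1 z.2.2 z.1) * fan_jac RE z.2.1 z.2.2 z.1)))%:E).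
  by rewrite /offset_diff /fan_jac; mfun.
rewrite -(fubini_tonelli (m1 := mu) _ m2)/=; last first.
  by move=> z; rewrite lee_fin mulrCA mulr_ge0 ?ind_pi_ge0.
apply: eq_integral => a _.
rewrite fan_correlation// -(leb4_tonelli1 (m1 a)); last by move=> z; rewrite lee_fin.
rewrite -ge0_int_scale//; last by move=> z; rewrite lee_fin.
by apply: eq_integral => z _; rewrite -EFinM mulrCA.
Qed.

Let corr_pointwise D f (z : (RR * RR) * (RR * RR)) : 0 < D -> Omega z.1 -> Omega z.2 ->
  (\int[mu]_a (f z.1 * f z.2 * (ind_pi a * (tri D (offset_diff RE RD z.1 z.2 a) * fan_jac RE z.1 z.2 a)))%:E
  = \int[mu]_a (ind_pi a * (f z.1 * f z.2 * (tri D (offset_diff RE RD z.1 z.2 a) * fan_jac RE z.1 z.2 a)))%:E)%E.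
Proof. by move=> D0 Oz1 Oz2; apply: eq_integral => a _; rewrite mulrCA. Qed.

Let corr_val D f (z : (RR * RR) * (RR * RR)) : 0 < D -> Omega z.1 -> Omega z.2 ->
  (\int[mu]_a (f z.1 * f z.2 * (ind_pi a * (tri D (offset_diff RE RD z.1 z.2 a) * fan_jac RE z.1 z.2 a)))%:E
  = (f z.1 * f z.2 * fan_kernel RE RD D z.1 z.2)%:E)%E.
Proof.
move=> D0 Oz1 Oz2; rewrite corr_pointwise//.
have c1 := continuous_tri D0.
have c2 := continuous_offset_diff hRE (RD := RD) Oz1 Oz2.
have c3 := continuous_fan_jac hRE Oz1 Oz2.
rewrite (integral_ind_pi_cont (h := fun a => f z.1 * f z.2 *
   (tri D (offset_diff RE RD z.1 z.2 a) * fan_jac RE z.1 z.2 a))); last by ctsf.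
congr (_%:E); rewrite /fan_kernel RintegralZl//.
by apply: (@continuous_integrable _ (fun a => tri D (offset_diff RE RD z.1 z.2 a) * fan_jac RE z.1 z.2 a)); ctsf.
Qed.

Let pw d e (t : R) : R := (d + `|t|) `^ (- (2^-1 + e)) * \1_(`[(-2), 2]%classic : set R) t.

Let m_pw d e : measurable_fun setT (pw d e : RR -> RR).
Proof. exact: (measurable_trunc_powR d (2^-1 + e)). Qed.

Let pw_ge0 d e t : 0 <= pw d e t.
Proof. by rewrite mulr_ge0 ?powR_ge0. Qed.

Let int_pw d e s : 0 < d <= 1 -> 0 < e < 2^-1 ->
  (\int[mu]_t (pw d e (s - t))%:E <= (6 / (2^-1 - e))%:E)%E.
Proof.
move=> hd he.
have n1 : (-1 : R) != 0 by rewrite oppr_eq0 oner_eq0.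
have m := m_pw d e.
have : (\int[mu]_t (pw d e t)%:E <= (6 / (1 - (2^-1 + e)))%:E)%E.
  by apply: integral_trunc_powR => //; move: he; lra.
rewrite (_ : 1 - (2^-1 + e) = 2^-1 - e); last by lra.
apply: le_trans; rewrite [leRHS](@ge0_integral_affine _ (-1) s)//; last 2 first.
- by mfun.
- by move=> t; rewrite lee_fin.
rewrite normrN normr1 mul1e le_eqVlt; apply/orP; left; apply/eqP.
by apply: eq_integral => t _; congr (_%:E); congr pw; ring.
Qed.

Definition fan_smoothing_cst e : R := 4 * fan_diff_cst RE RD * (6 / (2^-1 - e)) ^+ 2.

(** Schur's test for a symmetric kernel: [f x * f y] is at most the mean of [f x ^+ 2] and
    [f y ^+ 2], and in each of the two halves the free point is integrated out. Each coordinate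
    contributes a factor [6 / (1/2 - e)]. *)
Let schur d e f : 0 < d <= 1 -> 0 < e < 2^-1 -> test_fun f ->
  (\int[leb4]_z (f z.1 * f z.2 *
      (pw d e (z.1.1 - z.2.1) * pw d e (z.1.2 - z.2.2)))%:E <=
   ((6 / (2^-1 - e)) ^+ 2)%:E * sqr_int f)%E.
Proof.
move=> hd he tf; have mf := test_meas tf; have m := m_pw d e.
set k := fun z : (RR * RR) * (RR * RR) => pw d e (z.1.1 - z.2.1) * pw d e (z.1.2 - z.2.2).
have k0 z : 0 <= k z by rewrite mulr_ge0.
have mk : measurable_fun setT (k : _ -> RR) by rewrite /k; mfun.
set c := 6 / (2^-1 - e).
have kx x : (\int[leb2]_y (k (x, y))%:E <= (c ^+ 2)%:E)%E.
  have mk1 : measurable_fun setT (fun y : RR * RR => (k (x, y))%:E).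
    by rewrite /k/=; mfun.
  rewrite (leb2_tonelli1 mk1)/=; last by move=> y; rewrite lee_fin.
  rewrite /k/=; under eq_integral.
    move=> u _; under eq_integral do rewrite EFinM.
    rewrite ge0_int_scale//; last 2 first.
    - by mfun.
    - by move=> t; rewrite lee_fin.
    over.
  apply: le_trans (_ : \int[mu]_u (c * pw d e (x.1 - u))%:E <= _)%E.
    apply: ge0_int_le => //.
    - by apply: emeasurable_funM; [mfun|exact: measurable_cst].
    - by mfun.
    - by move=> u; rewrite mule_ge0 ?lee_fin//; apply: integral_ge0 => t _; rewrite lee_fin.
    - by move=> u; rewrite (mulrC c) [leRHS]EFinM; apply: lee_wpmul2l; rewrite ?lee_fin// int_pw.
  have c0 : 0 <= c by rewrite /c divr_ge0//; move: he; lra.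
  under eq_integral do rewrite EFinM.
  rewrite ge0_int_scale//; last 2 first.
  - by mfun.
  - by move=> t; rewrite lee_fin.
  by rewrite expr2 [leRHS]EFinM; apply: lee_wpmul2l; rewrite ?lee_fin// int_pw.
have kC x y : k (x, y) = k (y, x).
  have E t : pw d e t = pw d e (- t).
    rewrite /pw normrN !indic_itvcc; congr (_ * (nat_of_bool _)%:R).
    by apply/idP/idP => /andP[? ?]; apply/andP; split; lra.
  by rewrite /k/= E (E (x.2 - y.2)) !opprB.
have m1 : measurable_fun setT (fun z : (RR * RR) * (RR * RR) => (2^-1 * (f z.1 ^+ 2 * k z))%:E) by mfun.
have m2 : measurable_fun setT (fun z : (RR * RR) * (RR * RR) => (2^-1 * (f z.2 ^+ 2 * k z))%:E) by mfun.
have h0 : 0 <= 2^-1 :> R by [].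
have p1 z : 0 <= 2^-1 * (f z.1 ^+ 2 * k z) by rewrite mulr_ge0// mulr_ge0 ?sqr_ge0.
have p2 z : 0 <= 2^-1 * (f z.2 ^+ 2 * k z) by rewrite mulr_ge0// mulr_ge0 ?sqr_ge0.
apply: le_trans (_ : \int[leb4]_z ((2^-1 * (f z.1 ^+ 2 * k z))%:E +
    (2^-1 * (f z.2 ^+ 2 * k z))%:E) <= _)%E.
  apply: ge0_int_le.
  - by rewrite -/k; mfun.
  - by apply: emeasurable_funD.
  - by move=> z; rewrite lee_fin mulr_ge0// mulr_ge0 ?test_ge0.
  - move=> z; rewrite -EFinD lee_fin -/(k z) -mulrDr -mulrDl mulrA ler_wpM2r//.
    by have := sqr_ge0 (f z.1 - f z.2); lra.
rewrite ge0_int_add//.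
have half (x : RR * RR) : (\int[leb2]_y (2^-1 * (f x ^+ 2 * k (x, y)))%:E <=
    (2^-1 * (c ^+ 2))%:E * (f x ^+ 2)%:E)%E.
  under eq_integral do rewrite mulrA EFinM.
  rewrite ge0_int_scale; last 3 first.
  - by rewrite mulr_ge0 ?sqr_ge0.
  - by rewrite /k/=; mfun.
  - by move=> y; rewrite lee_fin.
  apply: le_trans (_ : (2^-1 * f x ^+ 2)%:E * (c ^+ 2)%:E <= _)%E.
    by apply: lee_wpmul2l => //; rewrite lee_fin mulr_ge0 ?sqr_ge0.
  by rewrite -!EFinM lee_fin le_eqVlt; apply/orP; left; apply/eqP; ring.
have hsum : ((2^-1 * c ^+ 2)%:E * sqr_int f + (2^-1 * c ^+ 2)%:E * sqr_int f = (c ^+ 2)%:E * sqr_int f)%E.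
  have c20 : (0 <= (2^-1 * c ^+ 2)%:E)%E by rewrite lee_fin mulr_ge0 ?sqr_ge0.
  by rewrite -(ge0_muleDl _ c20 c20) -EFinD; congr (_%:E * _)%E; lra.
rewrite -hsum; have mf2 : measurable_fun setT (fun x : RR * RR => (f x ^+ 2)%:E) by mfun.
apply: leeD.
  rewrite (leb4_tonelli1 m1); last by move=> z; rewrite lee_fin.
  rewrite -ge0_int_scale; [|by rewrite mulr_ge0 ?sqr_ge0|exact: mf2|by move=> z; rewrite lee_fin sqr_ge0].
  apply: ge0_int_le.
  - exact: (measurable_fun_fubini_tonelli_F _ m1).
  - by apply: emeasurable_funM => //; exact: measurable_cst.
  - by move=> x; apply: integral_ge0 => y _; rewrite lee_fin.
  - by move=> x; exact: half.
rewrite (leb4_tonelli2 m2); last by move=> z; rewrite lee_fin.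
rewrite -ge0_int_scale; [|by rewrite mulr_ge0 ?sqr_ge0|exact: mf2|by move=> z; rewrite lee_fin sqr_ge0].
apply: ge0_int_le.
- exact: (measurable_fun_fubini_tonelli_G _ m2).
- by apply: emeasurable_funM => //; exact: measurable_cst.
- by move=> x; apply: integral_ge0 => y _; rewrite lee_fin.
- move=> y; rewrite /fubini_G; under eq_integral do rewrite kC; exact: half.
Qed.

(** This direction alone is needed: by [energy_corr] at both widths, the energy at [D] exceeds the
    one at [d] by twice the correlation at [d] minus that at [D]. *)
Let corr_le d D e f : 0 < d <= 1 -> d <= D -> 0 < e < 2^-1 -> test_fun f ->
  (fan_corr d f <= fan_corr D f + (fan_smoothing_cst e * D `^ (2 * e))%:E * sqr_int f)%E.
Proof.
move=> /[dup] hd /andP[d0 _] dD he tf; have D0 := lt_le_trans d0 dD.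
have mf := test_meas tf; have m := m_pw d e.
have mI := measurable_ind_pi.
have ms0 := @measurable_srcdist R RE.
have mo0 := @measurable_offset R RE RD.
have p2 h z a : 0 < h -> 0 <= f z.1 * f z.2 * (ind_pi a * (tri h (offset_diff RE RD z.1 z.2 a) * fan_jac RE z.1 z.2 a)).
  move=> h0.
  have [Oz1|/(test_out tf) ->] := pselect (Omega z.1); last by rewrite !mul0r.
  have [Oz2|/(test_out tf) ->] := pselect (Omega z.2); last by rewrite mulr0 !mul0r.
  apply: mulr_ge0; first by rewrite mulr_ge0 ?test_ge0.
  by apply: mulr_ge0 => //; rewrite mulr_ge0 ?tri_ge0 ?fan_jac_ge0.
have m2 h : measurable_fun setT (fun z : ((RR * RR) * (RR * RR)) * RR =>
   (f z.1.1 * f z.1.2 * (ind_pi z.2 * (tri h (offset_diff RE RD z.1.1 z.1.2 z.2) * fan_jac RE z.1.1 z.1.2 z.2)))%:E).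
  have mt := @measurable_tri R h.
  by rewrite /offset_diff /fan_jac; mfun.
have mG h (h0 : 0 < h) := measurable_fun_fubini_tonelli_F (m2 := mu) _ (m2 h) (fun z => p2 h z.1 z.2 h0).
set K := 4 * fan_diff_cst RE RD * D `^ (2 * e).
have K0 : 0 <= K by rewrite /K mulr_ge0 ?powR_ge0// mulr_ge0// fan_diff_cst_ge0.
have mk : measurable_fun setT (fun z : (RR * RR) * (RR * RR) =>
   (f z.1 * f z.2 * (pw d e (z.1.1 - z.2.1) * pw d e (z.1.2 - z.2.2)))%:E) by mfun.
have k0 (z : (RR * RR) * (RR * RR)) : 0 <= f z.1 * f z.2 * (pw d e (z.1.1 - z.2.1) * pw d e (z.1.2 - z.2.2)).
  by rewrite mulr_ge0// mulr_ge0// test_ge0.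
rewrite !fan_corrE//.
have -> : fan_smoothing_cst e * D `^ (2 * e) = K * (6 / (2^-1 - e)) ^+ 2.
  by rewrite /fan_smoothing_cst /K; ring.
apply: le_trans (_ : _ + K%:E * \int[leb4]_z (f z.1 * f z.2 *
      (pw d e (z.1.1 - z.2.1) * pw d e (z.1.2 - z.2.2)))%:E <= _)%E; last first.
  by rewrite (EFinM K) -muleA; apply: leeD2l; apply: lee_wpmul2l; [rewrite lee_fin|exact: schur].
rewrite -ge0_int_scale//.
rewrite -ge0_int_add; [|exact: (mG D D0)|by apply: emeasurable_funM => //; exact: measurable_cst
  |by move=> z; apply: integral_ge0 => a _; rewrite lee_fin p2|by move=> z; rewrite mule_ge0 ?lee_fin].
apply: ge0_int_le.
- exact: (mG d d0).
- apply: emeasurable_funD; first exact: (mG D D0).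
  by apply: emeasurable_funM => //; exact: measurable_cst.
- by move=> z; apply: integral_ge0 => a _; rewrite lee_fin p2.
move=> z.
have zero h : f z.1 * f z.2 = 0 -> (\int[mu]_a (f z.1 * f z.2 * (ind_pi a * (tri h (offset_diff RE RD z.1 z.2 a) * fan_jac RE z.1 z.2 a)))%:E = 0)%E.
  by move=> f0; apply: integral0_eq => a _; rewrite f0 mul0r.
have [Oz1|/(test_out tf) f0] := pselect (Omega z.1); last first.
  by rewrite !zero ?f0 ?mul0r// mule0 adde0.
have [Oz2|/(test_out tf) f0] := pselect (Omega z.2); last first.
  by rewrite !zero ?f0 ?mulr0 ?mul0r// mule0 adde0.
rewrite !corr_val// -EFinM -EFinD lee_fin mulrCA -mulrDr ler_wpM2l ?mulr_ge0 ?test_ge0//.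
rewrite -lerBlDl; apply: le_trans (ler_norm _) _.
apply: le_trans (fan_kernel_diff hRE hRD d0 dD he Oz1 Oz2) _.
have b1 (x : RR * RR) : Omega x -> `|x.1| <= 1.
  move=> /OmegaE h.
  by rewrite -(@ler_pXn2r _ 2) ?nnegrE// real_normK ?num_real// expr1n; have := sqr_ge0 x.2; lra.
have b2 (x : RR * RR) : Omega x -> `|x.2| <= 1.
  move=> /OmegaE h.
  by rewrite -(@ler_pXn2r _ 2) ?nnegrE// real_normK ?num_real// expr1n; have := sqr_ge0 x.1; lra.
have in2 (s t : R) : `|s| <= 1 -> `|t| <= 1 -> -2 <= s - t <= 2.
  by rewrite !ler_norml => /andP[? ?] /andP[? ?]; apply/andP; split; lra.
by rewrite /pw !indic_itvcc !in2 ?b1 ?b2// !mulr1.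
Qed.

(** Finiteness allows the correlation at [D] to be cancelled from both sides of an inequality
    between extended reals. *)
Let corr_fin D f : 0 < D -> test_fun f -> fan_corr D f \is a fin_num.
Proof.
move=> D0 tf.
have [M M0 hM] := ray_int_bounded hRE hRD tf.
have mt := @measurable_tri R D.
have mI := measurable_ind_pi.
have mg := measurable_ray_int RE RD tf.
have g0 u a := ray_int_ge0 RE RD u a tf.
have t0 u := tri_ge0 D u.
have mgu a : measurable_fun setT (fun u : RR => ray_int RE RD f u a : RR).
  by mfun.
pose B := RD / (RE - 1).
have B0 : 0 <= B by rewrite /B divr_ge0 ?(ltW hRD)// subr_ge0 ltW.
pose ib (u : R) : R := \1_(`[(- B), B]%classic : set R) u.
have mib : measurable_fun setT (ib : RR -> RR) by apply: measurable_indic; exact: measurable_itv.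
have gb u a : ray_int RE RD f u a <= M * ib u.
  rewrite /ib indic_itvcc; have [h|h] := leP `|u| B.
    by rewrite -ler_norml h mulr1.
  by rewrite (ray_int_out hRE hRD)// mulr_ge0.
have Ib : (\int[mu]_u (ib u)%:E = (2 * B)%:E)%E.
  rewrite integral_indic//= setIT lebesgue_measure_itv/= lte_fin.
  case: ltP => h; first by rewrite -EFinB; congr (_%:E); ring.
  by rewrite (_ : B = 0) ?mulr0//; lra.
have q a : (\int[mu]_u \int[mu]_v (tri D (u - v) * (ray_int RE RD f u a * ray_int RE RD f v a))%:E
    <= (M * M * 2 * B)%:E)%E.
  apply: le_trans (_ : \int[mu]_u (M * M * ib u)%:E <= _)%E.
    apply: ge0_int_le.
    - apply: (measurable_fun_fubini_tonelli_F (m2 := mu) (fun z : RR * RR =>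
       (tri D (z.1 - z.2) * (ray_int RE RD f z.1 a * ray_int RE RD f z.2 a))%:E)) => [|z].
        by mfun.
      by rewrite lee_fin mulr_ge0// mulr_ge0.
    - by mfun.
    - by move=> u; apply: integral_ge0 => v _; rewrite lee_fin mulr_ge0// mulr_ge0.
    move=> u.
    apply: le_trans (_ : \int[mu]_v ((M * M * ib u)%:E * (tri D (v - u))%:E) <= _)%E.
      apply: ge0_int_le => //.
      - by mfun.
      - by apply: emeasurable_funM; mfun.
      - by move=> v; rewrite lee_fin mulr_ge0// mulr_ge0.
      move=> v; rewrite -EFinM lee_fin mulrC (_ : tri D (v - u) = tri D (u - v)); last first.
        by rewrite -triN opprB.
      by apply: ler_wpM2r => //; rewrite mulrAC; apply: ler_pM; rewrite ?gb ?hM.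
    rewrite ge0_int_scale; [|by rewrite mulr_ge0// mulr_ge0|by mfun|by move=> v; rewrite lee_fin].
    by rewrite integral_tri// mule1.
  under eq_integral do rewrite EFinM.
  rewrite ge0_int_scale; [|by rewrite mulr_ge0|by mfun|by move=> v; rewrite lee_fin].
  by rewrite Ib -EFinM lee_fin !mulrA.
rewrite ge0_fin_numE; last first.
  apply: integral_ge0 => a _; rewrite mule_ge0// ?lee_fin//.
  by apply: integral_ge0 => u _; apply: integral_ge0 => v _; rewrite lee_fin mulr_ge0// mulr_ge0.
apply: le_lt_trans (_ : \int[mu]_a (ind_pi a * (M * M * 2 * B))%:E < +oo)%E; last first.
  by rewrite integral_ind_pi ?ltry// mulr_ge0// mulr_ge0// mulr_ge0.
apply: ge0_int_le.
- apply: emeasurable_funM; first by mfun.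
  by apply: measurable_int2 => [? ? ?|]; [rewrite mulr_ge0// mulr_ge0|mfun].
- by mfun.
- move=> a; rewrite mule_ge0// ?lee_fin//.
  by apply: integral_ge0 => u _; apply: integral_ge0 => v _; rewrite lee_fin mulr_ge0// mulr_ge0.
- by move=> a; rewrite [leRHS]EFinM; apply: lee_wpmul2l; rewrite ?lee_fin// q.
Qed.

(** The constant depends on the Lipschitz constant of [f]. This is harmless, since [d] tends to zero
    with [f] fixed and the final bound contains only the [L^2] norm. *)
Let energy_small f : test_fun f -> exists2 C : R, 0 <= C &
  forall d, 0 < d <= 1 -> (fan_energy d f <= (C * d)%:E)%E.
Proof.
move=> tf.
have [L L0 hL] := ray_int_lip hRE hRD tf.
have mI := measurable_ind_pi.
have mg := measurable_ray_int RE RD tf.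
have mgu a : measurable_fun setT (fun u : RR => ray_int RE RD f u a : RR).
  by mfun.
(* The range of offsets meeting [Omega] is enlarged by 1, which is at least [d]: if [u] is outside
   it, both ray integrals vanish wherever the triangle does not. *)
pose B := RD / (RE - 1) + 1.
have B0 : 0 <= B by rewrite /B addr_ge0// divr_ge0 ?(ltW hRD)// subr_ge0 ltW.
pose ib (u : R) : R := \1_(`[(- B), B]%classic : set R) u.
have mib : measurable_fun setT (ib : RR -> RR) by apply: measurable_indic; exact: measurable_itv.
have Ib : (\int[mu]_u (ib u)%:E = (2 * B)%:E)%E.
  rewrite integral_indic//= setIT lebesgue_measure_itv/= lte_fin.
  case: ltP => h; first by rewrite -EFinB; congr (_%:E); ring.
  by rewrite (_ : B = 0) ?mulr0//; lra.
have LB : 0 <= L ^+ 2 * (2 * B) by rewrite mulr_ge0 ?sqr_ge0// mulr_ge0.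
exists (2 * pi * (L ^+ 2 * (2 * B))) => [|d /andP[d0 d1]].
  by rewrite mulr_ge0// mulr_ge0// pi_ge0.
have mt := @measurable_tri R d.
have t0 u := tri_ge0 d u.
have q a : (\int[mu]_u \int[mu]_v (tri d (u - v) * (ray_int RE RD f u a - ray_int RE RD f v a) ^+ 2)%:E
    <= (L ^+ 2 * (2 * B) * d)%:E)%E.
  apply: le_trans (_ : \int[mu]_u (L ^+ 2 * d * ib u)%:E <= _)%E.
    apply: ge0_int_le.
    - apply: (measurable_fun_fubini_tonelli_F (m2 := mu) (fun z : RR * RR =>
       (tri d (z.1 - z.2) * (ray_int RE RD f z.1 a - ray_int RE RD f z.2 a) ^+ 2)%:E)) => [|z].
        by mfun.
      by rewrite lee_fin mulr_ge0 ?sqr_ge0.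
    - by mfun.
    - by move=> u; apply: integral_ge0 => v _; rewrite lee_fin mulr_ge0 ?sqr_ge0.
    move=> u; have Ld : 0 <= L ^+ 2 * d * ib u by rewrite mulr_ge0// mulr_ge0 ?sqr_ge0 ?ltW.
    apply: le_trans (_ : \int[mu]_v ((L ^+ 2 * d * ib u)%:E * (tri d (v - u))%:E) <= _)%E.
      apply: ge0_int_le => //.
      - by mfun.
      - by apply: emeasurable_funM; mfun.
      - by move=> v; rewrite lee_fin mulr_ge0 ?sqr_ge0.
      move=> v; rewrite -EFinM lee_fin mulrC (_ : tri d (v - u) = tri d (u - v)); last first.
        by rewrite -triN opprB.
      have [uv|uv] := leP d `|u - v|; first by rewrite tri_out// !mulr0.
      apply: ler_wpM2r => //; rewrite /ib indic_itvcc.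
      have [h|h] := leP `|u| B; last first.
        rewrite !(ray_int_out hRE hRD)// ?subrr ?expr0n ?mulr_ge0 ?sqr_ge0 ?(ltW d0)//.
          have := ler_distD v u 0; rewrite !subr0 => hh.
          by move: h uv hh d1; rewrite /B; lra.
        by move: h; rewrite /B; lra.
      rewrite -ler_norml h mulr1.
      apply: le_trans (_ : (L * `|u - v|) ^+ 2 <= _).
        by rewrite -(real_normK (num_real (_ - _))) ler_pXn2r ?nnegrE// mulr_ge0.
      rewrite exprMn ler_wpM2l ?sqr_ge0// expr2.
      apply: le_trans (_ : d * 1 <= _); last by rewrite mulr1.
      by apply: ler_pM => //; apply: ltW => //; exact: lt_le_trans uv d1.
    rewrite ge0_int_scale; [|exact: Ld|by mfun|by move=> v; rewrite lee_fin].
    by rewrite integral_tri// mule1.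
  under eq_integral do rewrite EFinM.
  rewrite ge0_int_scale; [|by rewrite mulr_ge0 ?sqr_ge0 ?ltW|by mfun|by move=> v; rewrite lee_fin].
  by rewrite Ib -EFinM lee_fin le_eqVlt; apply/orP; left; apply/eqP; ring.
have k0 : 0 <= L ^+ 2 * (2 * B) * d by rewrite mulr_ge0// ltW.
rewrite -mulrA -(integral_ind_pi k0).
apply: ge0_int_le.
- apply: emeasurable_funM; first by mfun.
  by apply: measurable_int2 => [? ? ?|]; [rewrite mulr_ge0 ?sqr_ge0|mfun].
- by mfun.
- move=> a; rewrite mule_ge0// ?lee_fin//.
  by apply: integral_ge0 => u _; apply: integral_ge0 => v _; rewrite lee_fin mulr_ge0 ?sqr_ge0.
- by move=> a; rewrite [leRHS]EFinM; apply: lee_wpmul2l; rewrite ?lee_fin// q.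
Qed.

Lemma fan_energy_le D e f : 0 < D -> 0 < e < 2^-1 -> test_fun f -> (sqr_int f < +oo)%E ->
  (fan_energy D f <= (2 * fan_smoothing_cst e * D `^ (2 * e))%:E * sqr_int f)%E.
Proof.
move=> D0 he tf ffin.
have [C C0 hC] := energy_small tf.
have f0 : (0 <= sqr_int f)%E by apply: integral_ge0 => x _; rewrite lee_fin sqr_ge0.
apply/lee_addgt0Pr => eps eps0.
have C1 : 0 < C + 1 by apply: ltr_wpDl.
(* The bound 1 serves the power integral, [D] the comparison of widths, and the last one makes the
   energy at [d] at most [eps]; [C + 1] is used because [C] may be zero. *)
pose d := Num.min (Num.min 1 D) (eps / (C + 1)).
have d0 : 0 < d by rewrite !lt_min ltr01 D0 divr_gt0.
have d1 : d <= 1 by rewrite !ge_min lexx.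
have dD : d <= D by rewrite !ge_min lexx orbT.
have de : C * d <= eps.
  apply: le_trans (_ : (C + 1) * d <= _); first by rewrite ler_wpM2r ?(ltW d0)// lerDl.
  by rewrite mulrC -ler_pdivlMr// ge_min lexx orbT.
have hd : 0 < d <= 1 by rewrite d0.
have E1 := energy_corr D0 tf; have E2 := energy_corr d0 tf.
have Qf := corr_fin D0 tf.
have H := corr_le hd dD he tf.
have E3 : (fan_energy D f + 2%:E * fan_corr D f <=
  (eps%:E + (2 * fan_smoothing_cst e * D `^ (2 * e))%:E * sqr_int f) + 2%:E * fan_corr D f)%E.
  rewrite E1 -E2 -[leRHS]addeA; apply: leeD.
    by apply: le_trans (hC d hd) _; rewrite lee_fin.
  apply: le_trans (_ : 2%:E * (fan_corr D f + (fan_smoothing_cst e * D `^ (2 * e))%:E * sqr_int f) <= _)%E.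
    by apply: lee_wpmul2l.
  rewrite muleDr//; last by rewrite fin_num_adde_defr.
  by rewrite muleA -EFinM mulrA addeC.
move: E3; rewrite leeD2rE; last by rewrite fin_numM.
by rewrite addeC.
Qed.

End smoothing.

(** * Cells of the discretization *)

Section trigonometry.
Context {R : realType}.
Implicit Types a b : R.

Let cos_lip_le a b : a <= b -> `|cos a - cos b| <= b - a.
Proof.
move=> ab.
have [|c _ h] := @MVT_segment R cos (fun x => - sin x) a b ab.
  by apply: continuous_subspaceT; exact: continuous_cos.
rewrite distrC h normrM (ger0_norm (_ : 0 <= b - a)) ?subr_ge0// ler_piMl ?subr_ge0//.
by rewrite normrN ler_norml sin_geN1 sin_le1.
Qed.

Let sin_lip_le a b : a <= b -> `|sin a - sin b| <= b - a.
Proof.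
move=> ab.
have [|c _ h] := @MVT_segment R sin (fun x => cos x) a b ab.
  by apply: continuous_subspaceT; exact: continuous_sin.
rewrite distrC h normrM (ger0_norm (_ : 0 <= b - a)) ?subr_ge0// ler_piMl ?subr_ge0//.
by rewrite ler_norml cos_geN1 cos_le1.
Qed.

Lemma cos_lip a b : `|cos a - cos b| <= `|a - b|.
Proof.
have [ab|/ltW ba] := leP a b.
  by rewrite (distrC a) (ger0_norm (_ : 0 <= b - a)) ?subr_ge0// cos_lip_le.
by rewrite distrC (ger0_norm (_ : 0 <= a - b)) ?subr_ge0// cos_lip_le.
Qed.

Lemma sin_lip a b : `|sin a - sin b| <= `|a - b|.
Proof.
have [ab|/ltW ba] := leP a b.
  by rewrite (distrC a) (ger0_norm (_ : 0 <= b - a)) ?subr_ge0// sin_lip_le.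
by rewrite distrC (ger0_norm (_ : 0 <= a - b)) ?subr_ge0// sin_lip_le.
Qed.

Lemma cosDz a (k : int) : cos (a + k%:~R * (2 * pi)) = cos a.
Proof.
have E n : cos (a + n%:R * (2 * pi)) = cos a.
  by rewrite -[RHS](periodicn (@cosD2pi R) n); congr (cos (a + _)); rewrite mulr_natl (mulr_natl pi).
case: k => n; first exact: E.
rewrite NegzE mulrNz mulNr -[LHS](periodicn (@cosD2pi R) n.+1).
by congr cos; rewrite -(mulr_natl (pi *+ 2)) -(mulr_natl pi 2) subrK.
Qed.

Lemma sinDz a (k : int) : sin (a + k%:~R * (2 * pi)) = sin a.
Proof.
have E n : sin (a + n%:R * (2 * pi)) = sin a.
  by rewrite -[RHS](periodicn (@sinD2pi R) n); congr (sin (a + _)); rewrite mulr_natl (mulr_natl pi).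
case: k => n; first exact: E.
rewrite NegzE mulrNz mulNr -[LHS](periodicn (@sinD2pi R) n.+1).
by congr sin; rewrite -(mulr_natl (pi *+ 2)) -(mulr_natl pi 2) subrK.
Qed.

End trigonometry.

Lemma sum_only1 (V : nmodType) (P0 : nat) (n : nat) (F : nat -> V) :
  (1 <= P0 <= n)%N -> (forall p, (1 <= p <= n)%N -> p != P0 -> F p = 0) ->
  \sum_(1 <= p < n.+1) F p = F P0.
Proof.
move=> hP h; rewrite (bigD1_seq P0) ?mem_index_iota ?iota_uniq//=.
by rewrite big_nat_cond big1 ?addr0// => p /andP[hp pP]; apply: h.
Qed.

Section cells.
Context {R : realType}.
Variables (RE RD : R).
Hypotheses (hRE : 1 < RE) (hRD : 0 < RD).
Variable (D : discretization R).
Hypothesis (hD : admissible RE D).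

Let d := delta_xi RE RD D.
Let W := detector_width RE RD.

Lemma detector_width_gt0 : 0 < W.
Proof.
have R1 := hRE.
by rewrite /W /detector_width divr_gt0 ?mulr_gt0// sqrtr_gt0 subr_gt0 expr2; nra.
Qed.

Lemma nP_gt0 : (0 < nP D)%N. Proof. by have [] := hD. Qed.

Lemma delta_xi_gt0 : 0 < d.
Proof. by rewrite /d /delta_xi divr_gt0 ?detector_width_gt0// ltr0n nP_gt0. Qed.

Lemma delta_xi_le : d <= W.
Proof.
rewrite /d /delta_xi ler_pdivrMr ?ltr0n ?nP_gt0//.
by rewrite ler_peMr ?ler1n ?nP_gt0// ltW// detector_width_gt0.
Qed.

Let dP : d * (nP D)%:R = W.
Proof. by rewrite /d /delta_xi divfK// pnatr_eq0 -lt0n nP_gt0. Qed.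

Let Xi_E (p : nat) (u : R) : Xi_ RE RD D p u <-> d * p%:R - d <= u + W / 2 < d * p%:R.
Proof.
rewrite /Xi_/= in_itv/= /xi_ -/d -dP -natr1.
by split => /andP[h1 h2]; apply/andP; split; lra.
Qed.

Lemma offset_cell (u : R) : - (W / 2) < u < W / 2 ->
  exists2 p, (1 <= p <= nP D)%N & Xi_ RE RD D p u.
Proof.
move=> /andP[u0 u1]; have d0 := delta_xi_gt0.
have h0 : 0 <= (u + W / 2) / d by rewrite divr_ge0 ?(ltW d0)//; lra.
have /andP[t0 t1] := Num.Theory.truncn_itv h0.
move: t0 t1; set n := Num.truncn _ => t0 t1.
rewrite ler_pdivlMr// in t0; rewrite ltr_pdivrMr// in t1.
have nS : n.+1%:R = n%:R + 1 :> R by rewrite -natr1.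
(* Cells are counted from 1, so the index is one more than the truncated quotient. *)
rewrite nS in t1; exists n.+1; last by apply/Xi_E; rewrite nS; apply/andP; split; lra.
rewrite /= -(ltr_nat R) -(ltr_pM2l d0) dP; lra.
Qed.

Lemma offset_cell_uniq (u : R) p p' :
  Xi_ RE RD D p u -> Xi_ RE RD D p' u -> p = p'.
Proof.
have d0 := delta_xi_gt0.
have le q q' : Xi_ RE RD D q u -> Xi_ RE RD D q' u -> (q <= q')%N.
  move=> /Xi_E/andP[h1 _] /Xi_E/andP[_ h2].
  rewrite -ltnS -(ltr_nat R) -(ltr_pM2l d0) -[q'.+1%:R]natr1; lra.
by move=> h h'; apply/eqP; rewrite eqn_leq !le.
Qed.

Lemma offset_cell_dist (u : R) p : Xi_ RE RD D p u -> `|u - xi_ RE RD D p| <= d / 2.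
Proof. by rewrite /Xi_/= in_itv/= -/d ler_norml => /andP[? ?]; apply/andP; split; lra. Qed.

Lemma xi_le p : (1 <= p <= nP D)%N -> `|xi_ RE RD D p| <= W / 2.
Proof.
move=> /andP[p1 pP]; have d0 := delta_xi_gt0.
have h1 : d * 1 <= d * p%:R by rewrite ler_pM2l// ler1n.
have h2 : d * p%:R <= d * (nP D)%:R by rewrite ler_pM2l// ler_nat.
by rewrite /xi_ -/d ler_norml -[(nP D).+1%:R]natr1 -dP; apply/andP; split; lra.
Qed.

Let al := alpha_ D.

Let Q0 : (0 < nQ D)%N. Proof. by have [] := hD. Qed.

Let alE q : (1 <= q <= nQ D)%N -> al q = angle D q.
Proof.
move=> /andP[q1 qQ]; rewrite /al /alpha_ ifN -?lt0n// ifN//.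
by apply: contraTneq qQ => ->; rewrite ltnn.
Qed.

Let al0 : al 0 = al (nQ D) - 2 * pi.
Proof. by rewrite [in RHS]alE ?leqnn ?Q0. Qed.

Let alS : al (nQ D).+1 = al 1 + 2 * pi.
Proof. by rewrite [in RHS]alE ?leqnn ?Q0// /al /alpha_/= eqxx. Qed.

Let al_bound q : (1 <= q <= nQ D)%N -> - pi <= al q < pi.
Proof. by move=> hq; rewrite alE//; have [_ _ [h _] _ _] := hD; exact: h. Qed.

(** At the two artificial indices the gap is [al 1 - al (nQ D) + 2 pi], which is nonnegative because
    all angles lie in one interval of length [2 pi]. This includes the case of a single angle. *)
Let al_mono q : (q <= nQ D)%N -> al q <= al q.+1.
Proof.
have b1 : - pi <= al 1 < pi by apply: al_bound; rewrite leqnn Q0.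
have bQ : - pi <= al (nQ D) < pi by apply: al_bound; rewrite leqnn Q0.
case: q => [_|q qQ].
  by rewrite al0; move/andP: b1 => []; move/andP: bQ => []; lra.
have [qE|qn] := eqVneq q.+1 (nQ D).
  by rewrite qE alS; move/andP: b1 => []; move/andP: bQ => []; lra.
have qQ' : (q.+1 < nQ D)%N by rewrite ltn_neqAle qn.
rewrite !alE ?qQ//; apply/ltW.
by have [_ _ [_ h] _ _] := hD; apply: h; rewrite qQ'.
Qed.

Let da := delta_alpha D.

Let gap_le q : (q <= nQ D)%N -> al q.+1 - al q <= da.
Proof.
have H i : (1 <= i <= nQ D)%N -> al i.+1 - al i <= da.
  move=> /andP[i1 iQ]; rewrite /da /delta_alpha.
  apply: (@le_bigmax_seq _ _ _ _ _ i _ (fun q => alpha_ D q.+1 - alpha_ D q)) => //.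
  by rewrite mem_index_iota i1 ltnS.
(* The gap at index 0 is not among those of the maximum, but it equals the gap at index [nQ D], one
   period later. *)
case: q => [_|q qQ]; last exact: H.
by apply: le_trans (H (nQ D) _); [rewrite al0 alS; lra|rewrite leqnn Q0].
Qed.

Lemma delta_alpha_ge0 : 0 <= da.
Proof. by have := gap_le (leq0n _); have := al_mono (leq0n _); lra. Qed.

Let cut q := (al q.-1 + al q) / 2.

Let cut_mono q q' : (1 <= q)%N -> (q <= q')%N -> (q' <= (nQ D).+1)%N -> cut q <= cut q'.
Proof.
move=> q1; elim: q' => [|q' ih].
  by rewrite leqn0 => /eqP q0; rewrite q0 in q1.
rewrite leq_eqVlt => /orP[/eqP <-//|]; rewrite ltnS => qq' q'Q.
apply: le_trans (ih qq' (ltnW q'Q)) _.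
have q'1 : (1 <= q')%N by exact: leq_trans qq'.
have h1 := al_mono (q := q'.-1) _; have h2 := al_mono (q := q') _.
rewrite /cut /= ler_pM2r ?invr_gt0//; apply: lerD.
  by rewrite -{2}(prednK q'1) h1// (leq_trans (leq_pred _))// ltnW.
exact: h2.
Qed.

Let cut_period : cut (nQ D).+1 = cut 1 + 2 * pi.
Proof. by rewrite /cut/= al0 alS; lra. Qed.

Let Phi_E q (a : R) : Phi_ D q a <-> exists k : int, cut q <= a + k%:~R * (2 * pi) < cut q.+1.
Proof. by split => -[k hk]; exists k; move: hk; rewrite in_itv. Qed.

Let cut_search (u : R) n : cut 1 <= u -> u < cut n.+1 -> exists2 q, (1 <= q <= n)%N & cut q <= u < cut q.+1.
Proof.
move=> u1; elim: n => [|n ih] h; first by move: u1; rewrite leNgt h.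
have [/ih[q /andP[q1 qn] hq]|hn] := ltP u (cut n.+1).
  by exists q => //; rewrite q1 ltnW.
by exists n.+1; rewrite ?leqnn// hn.
Qed.

Let pi2 : 0 < 2 * pi :> R. Proof. by rewrite mulr_gt0// pi_gt0. Qed.

Lemma angle_cell (a : R) : exists2 q, (1 <= q <= nQ D)%N & Phi_ D q a.
Proof.
(* The cuts from index 1 to [nQ D + 1] span exactly one period, so [a] is first shifted into it and
   then located between consecutive cuts. *)
pose m := Num.floor ((a - cut 1) / (2 * pi)).
have /andP[m0 m1] := floor_itv ((a - cut 1) / (2 * pi)).
rewrite -/m ler_pdivlMr// in m0; rewrite -/m ltr_pdivrMr// intrD in m1.
have [||q hq hc] := @cut_search (a + (- m)%:~R * (2 * pi)) (nQ D).
- by rewrite mulrNz mulNr; lra.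
- by rewrite cut_period mulrNz mulNr; lra.
by exists q => //; apply/Phi_E; exists (- m).
Qed.

(** Both cells lie in the period that starts at [cut 1]. Two translates of [a] in that period
    coincide, so the integers agree, and monotonicity of the cuts separates different cells. *)
Lemma angle_cell_uniq (a : R) q q' : (1 <= q <= nQ D)%N -> (1 <= q' <= nQ D)%N ->
  Phi_ D q a -> Phi_ D q' a -> q = q'.
Proof.
move=> /andP[q1 qQ] /andP[q'1 q'Q] /Phi_E[k /andP[k0 k1]] /Phi_E[k' /andP[k'0 k'1]].
have lk (l l' : int) : cut 1 <= a + l%:~R * (2 * pi) -> a + l'%:~R * (2 * pi) < cut 1 + 2 * pi -> l' <= l.
  move=> h h'; rewrite -ltzD1 -(ltr_int R) -(ltr_pM2r pi2) intrD; lra.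
have c1 i : (1 <= i <= nQ D)%N -> cut 1 <= cut i.
  by move=> /andP[i1 iQ]; apply: cut_mono => //; exact: leqW.
have c2 i : (1 <= i <= nQ D)%N -> cut i.+1 <= cut 1 + 2 * pi.
  by move=> /andP[i1 iQ]; rewrite -cut_period; apply: cut_mono.
have kk : k = k'.
  apply/eqP; rewrite eq_le !lk//.
  - by apply: le_trans k0; apply: c1; rewrite q1.
  - by apply: lt_le_trans k'1 _; apply: c2; rewrite q'1.
  - by apply: le_trans k'0; apply: c1; rewrite q'1.
  - by apply: lt_le_trans k1 _; apply: c2; rewrite q1.
rewrite -kk in k'0 k'1.
apply/eqP; rewrite eqn_leq; apply/andP; split; rewrite leqNgt; apply/negP => lt.
  have := cut_mono (isT : (0 < q'.+1)%N) lt (leqW qQ).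
  by rewrite leNgt (le_lt_trans k0 k'1).
have := cut_mono (isT : (0 < q.+1)%N) lt (leqW q'Q).
by rewrite leNgt (le_lt_trans k'0 k1).
Qed.

Lemma angle_cell_dist (a : R) q : (1 <= q <= nQ D)%N -> Phi_ D q a ->
  exists k : int, `|a + k%:~R * (2 * pi) - alpha_ D q| <= da.
Proof.
move=> /andP[q1 qQ] /Phi_E[k hk]; exists k; move: hk; rewrite /cut /= -/al.
have := gap_le qQ; have := gap_le (leq_trans (leq_pred q) qQ); rewrite prednK//.
have := al_mono qQ; have := al_mono (leq_trans (leq_pred q) qQ); rewrite prednK//.
by move=> ? ? ? ? /andP[? ?]; rewrite ler_norml; apply/andP; split; lra.
Qed.

Let dx := delta_x D.

Lemma delta_x_gt0 : 0 < dx.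
Proof. by have [_ _ _ _ /andP[]] := hD. Qed.

Lemma delta_x_lt : dx < (Num.sqrt 2)^-1 * (RE - 1).
Proof. by have [_ _ _ _ /andP[]] := hD. Qed.

Lemma pixel_cover x : Omega x -> exists i j,
  [/\ (1 <= i <= nN D)%N, (1 <= j <= nM D)%N & pixel D i j x].
Proof.
by have [_ _ _ h _] := hD => /h[i /= hi [j /= hj hx]]; exists i, j.
Qed.

Let grid_uniq (u c : R) (p p' : nat) :
  dx * (p%:R - c) - dx / 2 <= u < dx * (p%:R - c) + dx / 2 ->
  dx * (p'%:R - c) - dx / 2 <= u < dx * (p'%:R - c) + dx / 2 -> p = p'.
Proof.
have d0 := delta_x_gt0.
have le (q q' : nat) : dx * (q%:R - c) - dx / 2 <= u < dx * (q%:R - c) + dx / 2 ->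
    dx * (q'%:R - c) - dx / 2 <= u < dx * (q'%:R - c) + dx / 2 -> (q <= q')%N.
  move=> /andP[h1 _] /andP[_ h2].
  rewrite -ltnS -(ltr_nat R) -(ltr_pM2l d0) -[q'.+1%:R]natr1; lra.
by move=> h h'; apply/eqP; rewrite eqn_leq !le.
Qed.

Lemma pixel_uniq i j i' j' x : pixel D i j x -> pixel D i' j' x -> i = i' /\ j = j'.
Proof.
rewrite /pixel /pixel_center /= => -[]/=; rewrite !in_itv/= => h1 h2 [h3 h4].
by rewrite (grid_uniq h1 h3) (grid_uniq h2 h4).
Qed.

Lemma pixel_dist i j x : pixel D i j x ->
  `|x.1 - (pixel_center D i j).1| <= dx / 2 /\ `|x.2 - (pixel_center D i j).2| <= dx / 2.
Proof.
rewrite /pixel /= => -[]/=; rewrite !in_itv/= -/dx => /andP[? ?] /andP[? ?].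
by split; rewrite ler_norml; apply/andP; split; lra.
Qed.

Lemma measurable_pixel i j : measurable (pixel D i j).
Proof. by apply: measurableX; exact: measurable_itv. Qed.

End cells.

(** The Cauchy-Schwarz inequality for a weight of mass [c], from [w * (h - r)^2 >= 0] integrated at
    the mean value [r = m / c]. An infinite right-hand side is allowed. *)
Lemma weighted_sqr d (T : measurableType d) (R : realType) (mu : {measure set T -> \bar R})
    (w h : T -> R) (c m : R) :
  measurable_fun setT w -> measurable_fun setT h ->
  (forall x, 0 <= w x) -> (forall x, 0 <= h x) -> 0 < c -> 0 <= m ->
  (\int[mu]_x (w x)%:E = c%:E -> \int[mu]_x (w x * h x)%:E = m%:E ->
  (m ^+ 2)%:E <= c%:E * \int[mu]_x (w x * h x ^+ 2)%:E)%E.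
Proof.
move=> mw mh w0 h0 c0 m0 wc whm.
have V0 : (0 <= \int[mu]_x (w x * h x ^+ 2)%:E)%E.
  by apply: integral_ge0 => x _; rewrite lee_fin mulr_ge0 ?sqr_ge0.
have [Vy|] := eqVneq (\int[mu]_x (w x * h x ^+ 2)%:E)%E +oo%E.
  by rewrite Vy gt0_muley ?leey// lte_fin.
case VE : (\int[mu]_x (w x * h x ^+ 2)%:E)%E V0 => [V| |]// V0 _.
pose r := m / c; have r0 : 0 <= r by rewrite divr_ge0 ?(ltW c0).
have H : 2 * r * m <= V + r ^+ 2 * c.
  rewrite -lee_fin EFinD (EFinM (2 * r)) (EFinM (r ^+ 2)) -VE -wc -whm.
  rewrite -ge0_int_scale; [|by rewrite mulr_ge0|by mfun|by move=> x; rewrite lee_fin mulr_ge0].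
  rewrite -ge0_int_scale; [|by rewrite sqr_ge0|by mfun|by move=> x; rewrite lee_fin].
  rewrite -ge0_int_add; [|by mfun|by apply: emeasurable_funM; mfun
    |by move=> x; rewrite lee_fin mulr_ge0 ?sqr_ge0
    |by move=> x; rewrite -EFinM lee_fin mulr_ge0 ?sqr_ge0].
  apply: ge0_int_le.
  - by apply: emeasurable_funM; mfun.
  - by apply: emeasurable_funD; [mfun|apply: emeasurable_funM; mfun].
  - by move=> x; rewrite -EFinM lee_fin mulr_ge0// mulr_ge0.
  move=> x; rewrite -!EFinM -EFinD lee_fin.
  have -> : 2 * r * (w x * h x) = w x * (2 * r * h x) by ring.
  rewrite (mulrC _ (w x)) -mulrDr ler_wpM2l//.
  by have := sqr_ge0 (h x - r); rewrite sqrrB; lra.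
rewrite -EFinM lee_fin.
have E : 2 * r * m = (r ^+ 2 * c) *+ 2 by rewrite /r; field; rewrite gt_eqF.
have E2 : m ^+ 2 = c * (r ^+ 2 * c) by rewrite /r; field; rewrite gt_eqF.
by rewrite E2 ler_wpM2l ?(ltW c0)//; move: H; rewrite E mulr2n; lra.
Qed.

(** * Boundedness of the ray integrals in mean square *)

Section ray_norm.
Context {R : realType}.
Variables (RE RD : R).
Hypotheses (hRE : 1 < RE) (hRD : 0 < RD).
Local Notation mu := (@lebesgue_measure R).
Local Notation RR := (measurableTypeR R).
Implicit Types (f : RR * RR -> R).

(** [2 pi] is the length of the angular period, [2 * RE / RD] the length of the parameter interval
    in the Cauchy-Schwarz inequality along a ray, and [1 / (RE - 1)] bounds the inverse Jacobian in
    [fan_integral] applied to [f ^+ 2]. *)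
Definition ray_norm_cst : R := 2 * pi * (2 * RE / RD / (RE - 1)).

Lemma ray_norm_cst_ge0 : 0 <= ray_norm_cst.
Proof.
have R1 := hRE; rewrite /ray_norm_cst mulr_ge0//; first by rewrite mulr_ge0 ?pi_ge0.
rewrite divr_ge0// ?subr_ge0 ?(ltW hRE)// divr_ge0 ?(ltW hRD)// mulr_ge0//; lra.
Qed.

Lemma ray_norm f : test_fun f ->
  (\int[mu]_a ((ind_pi a)%:E * \int[mu]_u ((ray_int RE RD f u a) ^+ 2)%:E)
    <= ray_norm_cst%:E * sqr_int f)%E.
Proof.
move=> tf; have mf := test_meas tf.
have mI := @measurable_ind_pi R.
have mg := measurable_ray_int RE RD tf.
have R1 : 0 < RE - 1 by rewrite subr_gt0.
pose Tm := 2 * RE / RD.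
have T0 : 0 < Tm by rewrite /Tm divr_gt0// mulr_gt0//; apply: lt_trans hRE.
pose w (t : R) : R := \1_(`[0, Tm]%classic : set R) t.
have mw : measurable_fun setT (w : RR -> RR) by apply: measurable_indic; exact: measurable_itv.
have wc : (\int[mu]_t (w t)%:E = Tm%:E)%E.
  by rewrite integral_indic//= setIT lebesgue_measure_itv/= lte_fin T0 -EFinB subr0.
have S0 : (0 <= sqr_int f)%E by apply: integral_ge0 => x _; rewrite lee_fin sqr_ge0.
have mr : measurable_fun setT (fun z : RR * RR * RR => f (fan_ray RE RD z.1.1 z.1.2 z.2) : RR).
  exact: measurable_on_ray.
have q a : (\int[mu]_u ((ray_int RE RD f u a) ^+ 2)%:E <= (Tm / (RE - 1))%:E * sqr_int f)%E.
  have mr2 : measurable_fun setT (fun z : RR * RR => f (fan_ray RE RD z.1 a z.2) : RR).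
    by apply: (measurableT_comp mr (g := fun z : RR * RR => ((z.1, a), z.2))); mfun.
  have mrt u : measurable_fun setT (fun t : RR => f (fan_ray RE RD u a t) : RR).
    by apply: (measurableT_comp mr2 (g := fun t : RR => (u, t))); mfun.
  have mi : measurable_fun setT (fun u : RR => \int[mu]_t ((f (fan_ray RE RD u a t)) ^+ 2)%:E)%E.
    apply: (measurable_fun_fubini_tonelli_F (m2 := mu)
      (fun z : RR * RR => ((f (fan_ray RE RD z.1 a z.2)) ^+ 2)%:E)) => [|z]; first by mfun.
    by rewrite lee_fin sqr_ge0.
  have i0 u : (0 <= \int[mu]_t ((f (fan_ray RE RD u a t)) ^+ 2)%:E)%E.
    by apply: integral_ge0 => t _; rewrite lee_fin sqr_ge0.
  apply: le_trans (_ : \int[mu]_u (Tm%:E * \int[mu]_t ((f (fan_ray RE RD u a t)) ^+ 2)%:E) <= _)%E.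
    apply: ge0_int_le.
    - by mfun.
    - by apply: emeasurable_funM => //; exact: measurable_cst.
    - by move=> u; rewrite lee_fin sqr_ge0.
    move=> u.
    have out t : w t * f (fan_ray RE RD u a t) = f (fan_ray RE RD u a t).
      have [Or|/(test_out tf) ->] := pselect (Omega (fan_ray RE RD u a t)); last by rewrite mulr0.
      have /andP[t0 t1] := fan_ray_Omega hRE hRD Or.
      by rewrite /w indic_itvcc (ltW t0) (ltW t1) mul1r.
    have whm : (\int[mu]_t (w t * f (fan_ray RE RD u a t))%:E = (ray_int RE RD f u a)%:E)%E.
      by rewrite -ray_intE//; apply: eq_integral => t _; rewrite out.
    have w0 t : 0 <= w t by [].
    have f0 t : 0 <= f (fan_ray RE RD u a t) by exact: test_ge0.
    apply: le_trans (weighted_sqr mw (mrt u) w0 f0 T0 (ray_int_ge0 _ _ _ _ tf) wc whm) _.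
    apply: lee_wpmul2l; first by rewrite lee_fin ltW.
    have mrtu := mrt u.
    apply: ge0_int_le; [by mfun|by mfun|by move=> t; rewrite lee_fin mulr_ge0 ?sqr_ge0|].
    by move=> t; rewrite lee_fin expr2 mulrA out.
  rewrite ge0_int_scale//; last by rewrite ltW.
  rewrite (EFinM Tm (RE - 1)^-1) -muleA; apply: lee_wpmul2l; first by rewrite lee_fin ltW.
  have mf2 : measurable_fun setT (fun x : RR * RR => f x ^+ 2 : RR) by mfun.
  have m1 : measurable_fun setT (fun _ : RR => 1 : R) by exact: measurable_cst.
  have f2 x : f x ^+ 2 != 0 -> Omega x by rewrite sqrf_eq0; exact: test_supp.
  have H := fan_integral hRE hRD a mf2 m1 (fun x => sqr_ge0 (f x)) (fun _ => ler01) f2.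
  have -> : (\int[mu]_u \int[mu]_t (f (fan_ray RE RD u a t) ^+ 2)%:E =
      \int[leb2]_x (1 * (f x ^+ 2 / srcdist RE x a))%:E)%E.
    by rewrite -H; apply: eq_integral => u _; rewrite mul1e.
  have ms0 := @measurable_srcdist R RE.
  have ms : measurable_fun setT (fun x : RR * RR => srcdist RE x a : RR) by mfun.
  rewrite -ge0_int_scale; [|by rewrite invr_ge0 ltW|by mfun|by move=> x; rewrite lee_fin sqr_ge0].
  have le x : 0 <= f x ^+ 2 / srcdist RE x a <= (RE - 1)^-1 * f x ^+ 2.
    have [Ox|/(test_out tf) ->] := pselect (Omega x); last by rewrite expr0n !mul0r mulr0 lexx.
    have s0 := srcdist_gt0 hRE a Ox.
    rewrite divr_ge0 ?sqr_ge0 ?(ltW s0)// mulrC ler_wpM2r ?sqr_ge0// lef_pV2 ?posrE//.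
    exact: srcdist_ge.
  apply: ge0_int_le.
  - by mfun.
  - by apply: emeasurable_funM; mfun.
  - by move=> x; rewrite lee_fin mul1r; have /andP[] := le x.
  - by move=> x; rewrite -EFinM lee_fin mul1r; have /andP[] := le x.
(* If the norm is infinite, the bound is trivial only because the constant is strictly positive:
   zero times infinity is zero. *)
have [Sy|] := eqVneq (sqr_int f) +oo%E.
  rewrite Sy; have [c0|c0] := eqVneq ray_norm_cst 0.
    have : 0 < ray_norm_cst.
      rewrite /ray_norm_cst mulr_gt0//; first by rewrite mulr_gt0 ?pi_gt0.
      by rewrite divr_gt0.
    by rewrite c0 ltxx.
  by rewrite gt0_muley ?leey// lte_fin lt_neqAle eq_sym c0 ray_norm_cst_ge0.
case SE : (sqr_int f) S0 => [S| |]// S0 _.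
rewrite lee_fin in S0.
have k0 : 0 <= Tm / (RE - 1) * S by rewrite mulr_ge0// divr_ge0 ?(ltW T0) ?(ltW R1).
apply: le_trans (_ : \int[mu]_a (ind_pi a * (Tm / (RE - 1) * S))%:E <= _)%E.
  apply: ge0_int_le.
  - apply: emeasurable_funM; first by mfun.
    apply: (measurable_fun_fubini_tonelli_F (m2 := mu)
      (fun z : RR * RR => (ray_int RE RD f z.2 z.1 ^+ 2)%:E)) => [|z]; first by mfun.
    by rewrite lee_fin sqr_ge0.
  - by mfun.
  - by move=> a; rewrite mule_ge0 ?lee_fin//; apply: integral_ge0 => u _; rewrite lee_fin sqr_ge0.
  - move=> a; rewrite [leRHS]EFinM; apply: lee_wpmul2l; first by rewrite lee_fin.
    by apply: le_trans (q a) _; rewrite SE -EFinM.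
rewrite integral_ind_pi// -EFinM lee_fin /ray_norm_cst -/Tm le_eqVlt.
by apply/orP; left; apply/eqP; ring.
Qed.

End ray_norm.

(** * Freezing the kernel on pixels and angular cells *)

Section discretization_kernel.
Context {R : realType}.
Variables (RE RD : R).
Hypotheses (hRE : 1 < RE) (hRD : 0 < RD).
Variable (D : discretization R).
Hypothesis (hD : admissible RE D).
Local Notation mu := (@lebesgue_measure R).
Local Notation RR := (measurableTypeR R).
Implicit Types (f : RR * RR -> R) (x : RR * RR).

Let d := delta_xi RE RD D.
Let W := detector_width RE RD.
Let dx := delta_x D.
Let da := delta_alpha D.
Let lam := dx + da.
(** Half of the gap between [Omega] and the circle of sources. The bound on [delta_x] makes half the
    diagonal of a pixel at most [eta], so at the centre of a pixel meeting [Omega] the source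
    distance is still at least [eta]. *)
Let eta := (RE - 1) / 2.

Let d0 : 0 < d. Proof. exact: (delta_xi_gt0 hRE hRD hD). Qed.
Let W0 : 0 < W. Proof. exact: (detector_width_gt0 hRE hRD). Qed.
Let dW : d <= W. Proof. exact: (delta_xi_le hRE hRD hD). Qed.
Let dx0 : 0 < dx. Proof. exact: (delta_x_gt0 hD). Qed.
Let da0 : 0 <= da. Proof. exact: (delta_alpha_ge0 hD). Qed.
Let lam0 : 0 < lam. Proof. by rewrite /lam; have := dx0; have := da0; lra. Qed.
Let eta0 : 0 < eta. Proof. by rewrite /eta divr_gt0// subr_gt0. Qed.

Let dx_sqr : dx ^+ 2 <= 2 * eta ^+ 2.
Proof.
have h := delta_x_lt hD; rewrite -/dx in h.
have s0 : 0 < Num.sqrt 2 :> R by rewrite sqrtr_gt0.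
have h2 : Num.sqrt 2 * dx <= RE - 1.
  by rewrite -ler_pdivlMl//; exact: ltW.
have h3 : (Num.sqrt 2 * dx) ^+ 2 <= (RE - 1) ^+ 2.
  by rewrite ler_pXn2r ?nnegrE// ?mulr_ge0 ?(ltW s0) ?(ltW dx0) ?subr_ge0 ?(ltW hRE).
by rewrite exprMn sqr_sqrtr// in h3; rewrite /eta expr_div_n; lra.
Qed.

Let near_sqr i j x : pixel D i j x ->
  ((pixel_center D i j).1 - x.1) ^+ 2 + ((pixel_center D i j).2 - x.2) ^+ 2 <= eta ^+ 2.
Proof.
move=> /(pixel_dist)[h1 h2].
have k (s t : R) : `|s - t| <= dx / 2 -> (t - s) ^+ 2 <= dx ^+ 2 / 4.
  rewrite distrC -(real_normK (num_real (t - s))) => h.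
  have : `|t - s| ^+ 2 <= (dx / 2) ^+ 2.
    by rewrite ler_pXn2r ?nnegrE// divr_ge0 ?(ltW dx0).
  by rewrite expr_div_n; lra.
have := k _ _ h1; have := k _ _ h2; have := dx_sqr; lra.
Qed.

Lemma pixel_center_lt i j x : Omega x -> pixel D i j x -> euclid2 (pixel_center D i j) < RE.
Proof.
move=> /OmegaE Ox /near_sqr; move: (pixel_center D i j) => c h.
have R0 : 0 < RE by apply: lt_trans hRE.
rewrite /euclid2 -(ger0_norm (ltW R0)) -sqrtr_sqr ltr_sqrt ?exprn_gt0//.
have e0 := eta0.
have -> : RE = 1 + 2 * eta by rewrite /eta; lra.
(* Young's inequality with parameter [eta], summed over the coordinates, bounds twice the inner
   product of [c - x] and [x] by [2 * eta]; thus [|c|^2 <= |x|^2 + 2 * eta + eta^2], which is less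
   than [RE^2 = (1 + 2 * eta)^2]. *)
have h1 : eta * (2 * ((c.1 - x.1) * x.1)) <= (c.1 - x.1) ^+ 2 + eta ^+ 2 * x.1 ^+ 2.
  by have := sqr_ge0 ((c.1 - x.1) - eta * x.1); rewrite sqrrB; lra.
have h2 : eta * (2 * ((c.2 - x.2) * x.2)) <= (c.2 - x.2) ^+ 2 + eta ^+ 2 * x.2 ^+ 2.
  by have := sqr_ge0 ((c.2 - x.2) - eta * x.2); rewrite sqrrB; lra.
have h3 : 2 * ((c.1 - x.1) * x.1) + 2 * ((c.2 - x.2) * x.2) <= 2 * eta.
  rewrite -(ler_pM2l e0) mulrDr.
  have : eta ^+ 2 * (x.1 ^+ 2 + x.2 ^+ 2) <= eta ^+ 2 * 1 by rewrite ler_wpM2l ?sqr_ge0// ltW.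
  by lra.
have -> : c.1 ^+ 2 + c.2 ^+ 2 = (x.1 ^+ 2 + x.2 ^+ 2) + (2 * ((c.1 - x.1) * x.1) + 2 * ((c.2 - x.2) * x.2))
  + ((c.1 - x.1) ^+ 2 + (c.2 - x.2) ^+ 2) by ring.
by nra.
Qed.

Let pixel_src i j x b : Omega x -> pixel D i j x -> eta <= srcdist RE (pixel_center D i j) b.
Proof.
move=> Ox /near_sqr; move: (pixel_center D i j) => c h.
have h1 := norm_dot_theta_perp b Ox.
have h2 : `|dot_theta_perp (c.1 - x.1, c.2 - x.2) b| <= eta.
  rewrite -(@ler_pXn2r _ 2) ?nnegrE ?(ltW eta0)// real_normK ?num_real//.
  apply: le_trans h; rewrite -[leRHS](dot_theta_sqr (c.1 - x.1, c.2 - x.2) b).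
  by rewrite lerDr sqr_ge0.
have E : dot_theta_perp c b = dot_theta_perp x b + dot_theta_perp (c.1 - x.1, c.2 - x.2) b.
  by rewrite /dot_theta_perp/=; ring.
rewrite /srcdist E; move: h1 h2; rewrite !ler_norml /eta => /andP[? ?] /andP[? ?]; lra.
Qed.

Let coord_le x : Omega x -> `|x.1| <= 1 /\ `|x.2| <= 1.
Proof.
move=> /OmegaE h; split.
  by rewrite -(@ler_pXn2r _ 2) ?nnegrE// real_normK ?num_real// expr1n; have := sqr_ge0 x.2; lra.
by rewrite -(@ler_pXn2r _ 2) ?nnegrE// real_normK ?num_real// expr1n; have := sqr_ge0 x.1; lra.
Qed.

Let prod_diff (s s' t t' : R) : `|s| <= 1 -> `|t'| <= 1 -> `|s - s'| <= dx / 2 -> `|t - t'| <= da ->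
  `|s * t - s' * t'| <= lam.
Proof.
move=> s1 t1 hs ht.
have -> : s * t - s' * t' = s * (t - t') + (s - s') * t' by ring.
apply: le_trans (ler_normD _ _) _; rewrite !normrM /lam addrC; apply: lerD.
  apply: le_trans (_ : dx / 2 * 1 <= _); first by apply: ler_pM.
  by have := dx0; lra.
by rewrite -[leRHS]mul1r; apply: ler_pM.
Qed.

Let cos1 (b : R) : `|cos b| <= 1. Proof. by rewrite ler_norml cos_geN1 cos_le1. Qed.
Let sin1 (b : R) : `|sin b| <= 1. Proof. by rewrite ler_norml sin_geN1 sin_le1. Qed.

Let dot_diff i j x a b : Omega x -> pixel D i j x -> `|a - b| <= da ->
  `|dot_theta x a - dot_theta (pixel_center D i j) b| <= 2 * lam.
Proof.
move=> Ox /(pixel_dist)[h1 h2] ab; have [x1 x2] := coord_le Ox.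
rewrite /dot_theta.
have -> (p q r s : R) : p + q - (r + s) = (p - r) + (q - s) by ring.
apply: le_trans (ler_normD _ _) _; rewrite mulr2n mulrDl !mul1r; apply: lerD.
  by apply: prod_diff => //; apply: le_trans (cos_lip _ _) ab.
by apply: prod_diff => //; apply: le_trans (sin_lip _ _) ab.
Qed.

Let perp_diff i j x a b : Omega x -> pixel D i j x -> `|a - b| <= da ->
  `|srcdist RE x a - srcdist RE (pixel_center D i j) b| <= 2 * lam.
Proof.
move=> Ox /(pixel_dist)[h1 h2] ab; have [x1 x2] := coord_le Ox.
rewrite /srcdist /dot_theta_perp.
have -> (p p' q q' r r' s s' t : R) : - p * p' + q * q' + t - (- r * r' + s * s' + t) =
   (q * q' - s * s') - (p * p' - r * r') by ring.
apply: le_trans (ler_normB _ _) _; rewrite mulr2n mulrDl !mul1r; apply: lerD.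
  by apply: prod_diff => //; apply: le_trans (cos_lip _ _) ab.
by apply: prod_diff => //; apply: le_trans (sin_lip _ _) ab.
Qed.

(** With [u' * RD / s' - u * RD / s = RD * (u * (s - s') + s * (u' - u)) / (s * s')], both
    differences are at most [2 * lam], [|u| <= 1], [s <= RE + 1], and both source distances are at
    least [eta]. *)
Definition offset_lip_cst : R := 2 * RD * (RE + 2) / ((RE - 1) / 2) ^+ 2.

Let C0 := offset_lip_cst.

Let C00 : 0 < C0.
Proof.
rewrite /C0 /offset_lip_cst divr_gt0 ?exprn_gt0// !mulr_gt0//.
by have := hRE; lra.
Qed.

Let offset_diff_le i j x a b : Omega x -> pixel D i j x -> `|a - b| <= da ->
  `|offset RE RD (pixel_center D i j) b - offset RE RD x a| <= C0 * lam.
Proof.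
move=> Ox px ab; have e0 := eta0; have l0 := lam0.
have s1 := pixel_src b Ox px; have s2 := srcdist_ge RE a Ox; have s3 := srcdist_le RE a Ox.
have d1 := dot_diff Ox px ab; have d2 := perp_diff Ox px ab.
have dx1 := norm_dot_theta a Ox.
rewrite /offset; move: s1 s2 s3 d1 d2 dx1.
set s := srcdist RE x a; set s' := srcdist RE _ b; set u := dot_theta x a; set u' := dot_theta _ b.
move=> s1 s2 s3 d1 d2 dx1.
have es : eta <= s by apply: le_trans s2; rewrite /eta; have := hRE; lra.
have sp : 0 < s by apply: lt_le_trans es.
have s'p : 0 < s' by apply: lt_le_trans s1.
have -> : u' * RD / s' - u * RD / s = RD * (u * (s - s') + s * (u' - u)) / (s * s').
  by field; rewrite !gt_eqF.
rewrite normrM normfV (gtr0_norm (mulr_gt0 sp s'p)) ler_pdivrMr ?mulr_gt0//.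
rewrite normrM (gtr0_norm hRD).
apply: le_trans (_ : RD * (2 * lam + (RE + 1) * (2 * lam)) <= _).
  rewrite ler_pM2l//; apply: le_trans (ler_normD _ _) _; rewrite !normrM; apply: lerD.
    by rewrite -[leRHS]mul1r; apply: ler_pM.
  by apply: ler_pM => //; [rewrite gtr0_norm|rewrite distrC].
apply: le_trans (_ : C0 * lam * (eta * eta) <= _).
  rewrite le_eqVlt /C0 /offset_lip_cst -/eta; apply/orP; left; apply/eqP; field.
  by rewrite gt_eqF.
by apply: ler_wpM2l; [rewrite mulr_ge0 ?ltW|apply: ler_pM => //; exact: ltW].
Qed.

Definition kernel_width : R := d + C0 * lam.

Let k := kernel_width.

Lemma kernel_width_gt0 : 0 < k.
Proof. by rewrite /k /kernel_width addr_gt0// mulr_gt0. Qed.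

(** [C0 / eta] comes from the variation of the triangle and [2 * W / eta^2] from that of the inverse
    source distance, with [d <= W]. The factor 8 is the price of majorizing the indicator of
    [[-2 k, 2 k]] by the triangle of width [4 k]. *)
Definition kernel_lip_cst : R := 8 * (C0 / eta + 2 * W / eta ^+ 2).

Lemma kernel_lip_cst_ge0 : 0 <= kernel_lip_cst.
Proof.
rewrite /kernel_lip_cst mulr_ge0// addr_ge0//.
  by rewrite divr_ge0 ?(ltW C00) ?(ltW eta0).
by rewrite divr_ge0 ?sqr_ge0// mulr_ge0// ltW.
Qed.

Let dotDz x b (n : int) : offset RE RD x (b + n%:~R * (2 * pi)) = offset RE RD x b /\
  srcdist RE x (b + n%:~R * (2 * pi)) = srcdist RE x b.
Proof. by rewrite /offset /srcdist /dot_theta /dot_theta_perp cosDz sinDz. Qed.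

(** The error is measured by a triangle rather than by a constant: integrated against [f] it is
    again an average of ray integrals, bounded in mean square. The triangle is centred at [xi] and
    not at the cell midpoint, so that it has unit mass in [xi] as well. *)
Lemma kernel_cell i j p q x (xi a : R) : Omega x -> pixel D i j x ->
  (1 <= q <= nQ D)%N -> Phi_ D q a -> Xi_ RE RD D p xi ->
  `|tri d (offset RE RD (pixel_center D i j) (alpha_ D q) - xi_ RE RD D p)
      / srcdist RE (pixel_center D i j) (alpha_ D q)
    - tri d (offset RE RD x a - xi_ RE RD D p) / srcdist RE x a| <=
  kernel_lip_cst * (lam * k / d ^+ 2) * tri (2 * (2 * k)) (offset RE RD x a - xi).
Proof.
move=> Ox px hq hPhi hXi.
have [n] := angle_cell_dist hD hq hPhi.
(* Offset and source distance are periodic, so [a] may be replaced by its translate near the node of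
   the cell. *)
have [<- <-] := dotDz x a n; move: (a + _) => b ab.
have hxi := offset_cell_dist hXi; rewrite -/d in hxi.
move: (alpha_ D q) ab => b' ab.
have h1 := offset_diff_le Ox px ab.
have s1 := pixel_src b' Ox px; have s2 := srcdist_ge RE b Ox.
have h2 := perp_diff Ox px ab.
move: h1 s1 s2 h2 hxi.
set s := srcdist RE x b; set s' := srcdist RE _ b'; set o := offset RE RD x b; set o' := offset RE RD _ b'.
set xp := xi_ RE RD D p => h1 s1 s2 h2 hxi.
have e0 := eta0; have l0 := lam0; have dd := d0; have k0 := kernel_width_gt0; have c0 := C00.
have es : eta <= s by apply: le_trans s2; rewrite /eta; have := hRE; lra.
have sp : 0 < s by apply: lt_le_trans es.
have s'p : 0 < s' by apply: lt_le_trans s1.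
have cl : 0 < C0 * lam by rewrite mulr_gt0.
have [far|near] := leP k `|o - xp|.
  have out1 : d <= `|o - xp| by move: far; rewrite /k /kernel_width; lra.
  have out2 : d <= `|o' - xp|.
    have := ler_distD o' o xp; rewrite (distrC o o') => hh.
    by move: far hh h1; rewrite /k /kernel_width; lra.
  rewrite (tri_out out1) (tri_out out2) !mul0r subrr normr0.
  rewrite mulr_ge0 ?tri_ge0// mulr_ge0 ?kernel_lip_cst_ge0//.
  by rewrite divr_ge0 ?sqr_ge0// mulr_ge0// ltW.
have big : 1 <= 8 * k * tri (2 * (2 * k)) (o - xi).
  have k2 : 0 < 2 * k by rewrite mulr_gt0.
  have : `|o - xi| <= 2 * k.
    have := ler_distD xp o xi; rewrite (distrC xp) => hh.
    have : d <= k by rewrite /k /kernel_width lerDl ltW.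
    by move: near hh hxi; lra.
  by move/(tri_half k2); lra.
apply: le_trans (_ : (C0 / eta + 2 * W / eta ^+ 2) * (lam / d ^+ 2) * 1 <= _); last first.
  have B0 : 0 <= (C0 / eta + 2 * W / eta ^+ 2) * (lam / d ^+ 2).
    rewrite mulr_ge0//; last by rewrite divr_ge0 ?sqr_ge0 ?(ltW l0).
    by have := kernel_lip_cst_ge0; rewrite /kernel_lip_cst; lra.
  apply: le_trans (ler_wpM2l B0 big) _.
  by rewrite le_eqVlt /kernel_lip_cst; apply/orP; left; apply/eqP; ring.
have -> : tri d (o' - xp) / s' - tri d (o - xp) / s =
  (tri d (o' - xp) - tri d (o - xp)) / s' + tri d (o - xp) * ((s - s') / (s * s')).
  by field; rewrite !gt_eqF.
apply: le_trans (ler_normD _ _) _; rewrite mulr1 [leRHS]mulrDl; apply: lerD.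
  rewrite normrM normfV (gtr0_norm s'p).
  apply: le_trans (_ : (C0 * lam / d ^+ 2) * eta^-1 <= _); last first.
    by rewrite le_eqVlt; apply/orP; left; apply/eqP; ring.
  apply: ler_pM => //; first by rewrite invr_ge0 ltW.
    apply: le_trans (tri_lip _ _ dd) _.
    rewrite ler_pM2r ?invr_gt0 ?exprn_gt0//.
    by have -> : o' - xp - (o - xp) = o' - o by ring.
  by rewrite lef_pV2.
rewrite normrM (ger0_norm (tri_ge0 _ _)) normrM normfV (gtr0_norm (mulr_gt0 sp s'p)).
apply: le_trans (_ : d^-1 * (2 * lam / (eta * eta)) <= _).
  apply: ler_pM; rewrite ?tri_ge0 ?tri_le//.
    by rewrite divr_ge0// mulr_ge0 ?(ltW sp) ?(ltW s'p).
  apply: ler_pM => //; first by rewrite invr_ge0 mulr_ge0 ?(ltW sp) ?(ltW s'p).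
  have ee : eta * eta <= s * s' by apply: ler_pM => //; exact: ltW.
  by rewrite lef_pV2 ?posrE ?(mulr_gt0 sp s'p) ?(mulr_gt0 e0 e0).
apply: le_trans (_ : 2 * d / eta ^+ 2 * (lam / d ^+ 2) <= _).
  by rewrite le_eqVlt; apply/orP; left; apply/eqP; field; rewrite !gt_eqF.
rewrite ler_wpM2r ?divr_ge0 ?sqr_ge0 ?(ltW l0)//.
by rewrite ler_pM2r ?invr_gt0 ?exprn_gt0// ler_pM2l.
Qed.

End discretization_kernel.

(** * Discretization error for nonnegative functions *)

Section discretization_error.
Context {R : realType}.
Variables (RE RD : R).
Hypotheses (hRE : 1 < RE) (hRD : 0 < RD).
Variable (D : discretization R).
Hypothesis (hD : admissible RE D).
Local Notation mu := (@lebesgue_measure R).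
Local Notation RR := (measurableTypeR R).
Implicit Types (f : RR * RR -> R) (x : RR * RR).

Let d := delta_xi RE RD D.
Let W := detector_width RE RD.
Let lam := delta_x D + delta_alpha D.
Let k := kernel_width RE RD D.

Let d0 : 0 < d. Proof. exact: (delta_xi_gt0 hRE hRD hD). Qed.
Let W0 : 0 < W. Proof. exact: (detector_width_gt0 hRE hRD). Qed.
Let k0 : 0 < k. Proof. exact: (kernel_width_gt0 hRE hRD hD). Qed.
Let lam0 : 0 <= lam.
Proof. by rewrite addr_ge0// ?(ltW (delta_x_gt0 hD)) ?(delta_alpha_ge0 hD). Qed.

Lemma ray_offset_integral f (phi : RR -> R) a : test_fun f ->
  measurable_fun setT phi -> (forall u, 0 <= phi u) ->
  (\int[mu]_u (phi u * ray_int RE RD f u a)%:E =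
   \int[leb2]_x (phi (offset RE RD x a) * (f x / srcdist RE x a))%:E)%E.
Proof.
move=> tf mp p0.
rewrite -(fan_integral hRE hRD a (test_meas tf) mp (test_ge0 tf) p0 (test_supp tf)).
by apply: eq_integral => u _; rewrite ray_intE.
Qed.

Definition tri_avg f (h xi a : R) : R :=
  fine (\int[mu]_u (tri h (u - xi) * ray_int RE RD f u a)%:E)%E.

Lemma tri_avgE f (h xi a : R) : 0 < h -> test_fun f ->
  (\int[mu]_u (tri h (u - xi) * ray_int RE RD f u a)%:E = (tri_avg f h xi a)%:E)%E.
Proof.
move=> h0 tf; rewrite /tri_avg fineK//.
have [M M0 hM] := ray_int_bounded hRE hRD tf.
have mt := @measurable_tri R h.
have mg := measurable_ray_int RE RD tf.
rewrite ge0_fin_numE; last first.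
  by apply: integral_ge0 => u _; rewrite lee_fin mulr_ge0 ?tri_ge0 ?ray_int_ge0.
apply: le_lt_trans (_ : \int[mu]_u (M%:E * (tri h (u - xi))%:E) < +oo)%E; last first.
  rewrite ge0_int_scale//; [|by mfun|by move=> u; rewrite lee_fin tri_ge0].
  by rewrite integral_tri// mule1 ltry.
apply: ge0_int_le.
- by mfun.
- by apply: emeasurable_funM; mfun.
- by move=> u; rewrite lee_fin mulr_ge0 ?tri_ge0 ?ray_int_ge0.
- by move=> u; rewrite -EFinM lee_fin mulrC ler_wpM2r ?tri_ge0.
Qed.

Lemma tri_avg_ge0 f (h xi a : R) : test_fun f -> 0 <= tri_avg f h xi a.
Proof.
move=> tf; rewrite /tri_avg fine_ge0// integral_ge0// => u _.
by rewrite lee_fin mulr_ge0 ?tri_ge0 ?ray_int_ge0.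
Qed.

Let cij p q (i j : nat) : R :=
  if euclid2 (pixel_center D i j) < RE then
    tri d (offset RE RD (pixel_center D i j) (alpha_ D q) - xi_ RE RD D p)
      / srcdist RE (pixel_center D i j) (alpha_ D q)
  else 0.

(** The restriction to centres with [|x| < RE] makes the source distance nonnegative. Nonnegative
    coefficients let the finite sums pass through the integrals of nonnegative functions. *)
Let cij_ge0 p q i j : 0 <= cij p q i j.
Proof.
rewrite /cij; case: ifPn => // h; rewrite divr_ge0 ?tri_ge0//.
move: h; move: (pixel_center D i j) => c; rewrite /euclid2 => h.
have h2 : `|dot_theta_perp c (alpha_ D q)| <= RE.
  apply: le_trans (ltW h); rewrite -sqrtr_sqr ler_wsqrtr//.
  by rewrite -(dot_theta_sqr c (alpha_ D q)) lerDr sqr_ge0.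
by rewrite /srcdist; move: h2; rewrite ler_norml => /andP[? _]; lra.
Qed.

Let pix i j x : R := \1_(pixel D i j) x.

Let mpix i j : measurable_fun setT (pix i j : RR * RR -> RR).
Proof. by apply: measurable_indic; exact: measurable_pixel. Qed.

Let pix_ge0 i j x : 0 <= pix i j x. Proof. by []. Qed.

(** On a product of cells the discrete transform is integration against this kernel, which is
    constant on pixels, up to the square root factor. *)
Let Kd p q x : R := \sum_(1 <= i < (nN D).+1) \sum_(1 <= j < (nM D).+1) cij p q i j * pix i j x.

Let Kd_cell p q i j x : Omega x -> (1 <= i <= nN D)%N -> (1 <= j <= nM D)%N ->
  pixel D i j x -> Kd p q x =
    tri d (offset RE RD (pixel_center D i j) (alpha_ D q) - xi_ RE RD D p)
      / srcdist RE (pixel_center D i j) (alpha_ D q).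
Proof.
move=> Ox hi hj px; rewrite /Kd.
have z i' j' : ~ (i' = i /\ j' = j) -> pix i' j' x = 0.
  move=> ne; rewrite /pix indicE memNset//.
  by move=> px'; apply: ne; exact: (pixel_uniq hD px' px).
rewrite (sum_only1 hi); last first.
  move=> i' _ /eqP ne; rewrite big1// => j' _; rewrite z ?mulr0//.
  by case.
rewrite (sum_only1 hj); last first.
  by move=> j' _ /eqP ne; rewrite z ?mulr0// => -[].
rewrite /pix indicE mem_set// mulr1 /cij.
by rewrite (pixel_center_lt hRE hD Ox px).
Qed.

Let Kd_ge0 p q x : 0 <= Kd p q x.
Proof. by apply: sumr_ge0 => i _; apply: sumr_ge0 => j _; rewrite mulr_ge0. Qed.

Let mKd p q : measurable_fun setT (Kd p q : RR * RR -> RR).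
Proof.
apply: measurable_sum => i; apply: measurable_sum => j.
by have m := mpix i j; mfun.
Qed.

Let pix_int f i j : test_fun f ->
  (\int[leb2]_x (pix i j x * f x)%:E = (\int[leb2]_(z in pixel D i j) (f \_ Omega) z)%:E)%E.
Proof.
move=> tf; have mf := test_meas tf; have m := mpix i j.
have [M M0 hM] := test_bounded tf.
have -> : f \_ Omega = f.
  apply/funext => x; rewrite patchE; case: ifPn => // /negP xO.
  by rewrite (test_out tf)// => h; apply: xO; rewrite inE.
have E : (\int[leb2]_x (pix i j x * f x)%:E = \int[leb2]_(z in pixel D i j) (f z)%:E)%E.
  rewrite [RHS]integral_mkcond; apply: eq_integral => x _.
  by rewrite patchE /pix indicE; case: ifPn => _; rewrite ?mul1r ?mul0r.
rewrite E /Rintegral fineK// -E ge0_fin_numE; last first.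
  by apply: integral_ge0 => x _; rewrite lee_fin; apply: mulr_ge0; [exact: pix_ge0|exact: test_ge0].
apply: le_lt_trans (_ : \int[leb2]_x (M%:E * (pix i j x)%:E) < +oo)%E.
  apply: ge0_int_le.
  - by mfun.
  - by apply: emeasurable_funM; mfun.
  - by move=> x; rewrite lee_fin; apply: mulr_ge0; [exact: pix_ge0|exact: test_ge0].
  - by move=> x; rewrite -EFinM lee_fin mulrC; apply: ler_wpM2r; [exact: pix_ge0|exact: hM].
rewrite ge0_int_scale//; [|by mfun|by move=> x; rewrite lee_fin].
rewrite integral_indic ?setIT//; last exact: measurable_pixel.
have E2 : leb2 (pixel D i j) = (mu `[((pixel_center D i j).1 - delta_x D / 2)%R,
    ((pixel_center D i j).1 + delta_x D / 2)%R[%classic *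
  mu `[((pixel_center D i j).2 - delta_x D / 2)%R,
    ((pixel_center D i j).2 + delta_x D / 2)%R[%classic)%E.
  by rewrite /leb2 /pixel product_measure1E; [|exact: measurable_itv|exact: measurable_itv].
change (M%:E * leb2 (pixel D i j) < +oo)%E; rewrite E2 !lebesgue_measure_itv/=.
by case: ifP => _; case: ifP => _; rewrite ?mule0 ?mul0e ?mule0 -?EFinB -?EFinM ?ltry.
Qed.

Let discr_kernel p q f : test_fun f ->
  (\int[leb2]_x (Kd p q x * f x)%:E = (\sum_(1 <= i < (nN D).+1) \sum_(1 <= j < (nM D).+1)
     cij p q i j * \int[leb2]_(z in pixel D i j) (f \_ Omega) z)%:E)%E.
Proof.
move=> tf; have mf := test_meas tf.
have nn i j x : (0 <= (cij p q i j * (pix i j x * f x))%:E)%E.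
  rewrite lee_fin; apply: mulr_ge0; first exact: cij_ge0.
  by apply: mulr_ge0; [exact: pix_ge0|exact: test_ge0].
have mm i j : measurable_fun setT (fun x => (cij p q i j * (pix i j x * f x))%:E).
  by have m := mpix i j; mfun.
transitivity (\int[leb2]_x \sum_(1 <= i < (nN D).+1) \sum_(1 <= j < (nM D).+1)
   (cij p q i j * (pix i j x * f x))%:E)%E.
  apply: eq_integral => x _; under [RHS]eq_bigr do rewrite sumEFin.
  rewrite sumEFin; congr (_%:E); rewrite /Kd mulr_suml; apply: eq_bigr => i _.
  by rewrite mulr_suml; apply: eq_bigr => j _; rewrite mulrA.
rewrite ge0_integral_sum//; last 2 first.
- by move=> i; apply: emeasurable_sum => j; exact: mm.
- by move=> i x _; apply: sume_ge0 => j _.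
rewrite -sumEFin; apply: eq_bigr => i _.
rewrite ge0_integral_sum//.
rewrite -sumEFin; apply: eq_bigr => j _.
under eq_integral do rewrite EFinM.
rewrite ge0_int_scale//; [|by have m := mpix i j; mfun
  |by move=> x; rewrite lee_fin; apply: mulr_ge0; [exact: pix_ge0|exact: test_ge0]].
by rewrite pix_int// EFinM.
Qed.

Let discr_eval p q f (xi a : R) : test_fun f ->
  (1 <= p <= nP D)%N -> (1 <= q <= nQ D)%N -> Xi_ RE RD D p xi -> Phi_ D q a ->
  fanbeam_discr_fun RE RD D f (xi, a) =
  Num.sqrt (xi_ RE RD D p ^+ 2 + RD ^+ 2) * fine (\int[leb2]_x (Kd p q x * f x)%:E)%E.
Proof.
move=> tf hp hq hXi hPhi.
have dn : d != 0 by rewrite gt_eqF.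
rewrite /fanbeam_discr_fun (sum_only1 hp); last first.
  move=> p' hp' /eqP ne; rewrite big1// => q' _.
  rewrite indicE memNset ?mul0r// => h; apply: ne.
  exact: (offset_cell_uniq hRE hRD hD h hXi).
rewrite (sum_only1 hq); last first.
  move=> q' hq' /eqP ne; rewrite [\1_(Phi_ _ _) _]indicE memNset ?mulr0 ?mul0r// => h.
  by apply: ne; exact: (angle_cell_uniq hD hq' hq h hPhi).
rewrite !indicE !mem_set//= !mul1r discr_kernel//=.
rewrite mulrCA; congr (_ * _); rewrite mulr_sumr; apply: eq_bigr => i _.
rewrite big_mkcond mulr_sumr; apply: eq_bigr => j _.
rewrite /cij; case: ifPn => _; last by rewrite mulr0 mul0r.
rewrite /tri -/d /offset -/(srcdist RE (pixel_center D i j) (alpha_ D q)); ring.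
Qed.

(** The kernel estimate bounds the error by a multiple of [f]; the factor [RE + 1] brings in the
    Jacobian, as [f <= (RE + 1) * (f / srcdist)], and turns the bound into an average of ray
    integrals. *)
Definition discr_cst : R := kernel_lip_cst RE RD * (RE + 1) * (lam * k / d ^+ 2).

Lemma discr_cst_ge0 : 0 <= discr_cst.
Proof.
rewrite /discr_cst mulr_ge0//.
  rewrite mulr_ge0 ?(kernel_lip_cst_ge0 hRE hRD)//.
  by have := hRE; lra.
by rewrite divr_ge0 ?sqr_ge0// mulr_ge0// ltW.
Qed.

(** The index of the offset cell is hidden by the quantifier: what matters afterwards is only that
    the midpoint is close to [xi] and within the detector. The index of the angular cell disappears
    altogether. *)
Lemma discr_pointwise f (xi a : R) : test_fun f -> - (W / 2) < xi < W / 2 ->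
  exists p, [/\ `|xi - xi_ RE RD D p| <= d / 2, `|xi_ RE RD D p| <= W / 2 &
    `|fanbeam_discr_fun RE RD D f (xi, a) -
      Num.sqrt (xi_ RE RD D p ^+ 2 + RD ^+ 2) * tri_avg f d (xi_ RE RD D p) a| <=
    Num.sqrt (xi_ RE RD D p ^+ 2 + RD ^+ 2) * (discr_cst * tri_avg f (2 * (2 * k)) xi a)].
Proof.
move=> tf hxi; have mf := test_meas tf.
have [p hp hXi] := offset_cell hRE hRD hD hxi.
have [q hq hPhi] := angle_cell hD a.
exists p; split.
- exact: (offset_cell_dist hXi).
- exact: (xi_le hRE hRD hD hp).
rewrite (discr_eval tf hp hq hXi hPhi).
set S := Num.sqrt _; set xp := xi_ RE RD D p.
rewrite -mulrBr normrM (ger0_norm (sqrtr_ge0 _)) ler_wpM2l ?sqrtr_ge0//.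
have mt h := @measurable_tri R h.
have ms0 := @measurable_srcdist R RE.
have mo0 := @measurable_offset R RE RD.
have mK := mKd p q.
have md := mt d; have m4 := mt (2 * (2 * k)).
have k4 : 0 < 2 * (2 * k) by rewrite !mulr_gt0.
set B := kernel_lip_cst RE RD * (lam * k / d ^+ 2).
have B0 : 0 <= B.
  rewrite mulr_ge0 ?(kernel_lip_cst_ge0 hRE hRD)//.
  by rewrite divr_ge0 ?sqr_ge0// mulr_ge0// ltW.
pose A x := tri d (offset RE RD x a - xp) * (f x / srcdist RE x a).
pose G x := tri (2 * (2 * k)) (offset RE RD x a - xi) * (f x / srcdist RE x a).
have fs0 x : 0 <= f x / srcdist RE x a.
  have [Ox|/(test_out tf) ->] := pselect (Omega x); last by rewrite mul0r.
  by rewrite divr_ge0 ?test_ge0// ltW// srcdist_gt0.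
have A0 x : 0 <= A x by rewrite mulr_ge0 ?tri_ge0.
have G0 x : 0 <= G x by rewrite mulr_ge0 ?tri_ge0.
have mA : measurable_fun setT (A : RR * RR -> RR) by rewrite /A; mfun.
have mG : measurable_fun setT (G : RR * RR -> RR) by rewrite /G; mfun.
have AE : (\int[leb2]_x (A x)%:E = (tri_avg f d xp a)%:E)%E.
  rewrite -tri_avgE// (ray_offset_integral a (phi := fun u => tri d (u - xp)) tf)//.
    by mfun.
  by move=> u; exact: tri_ge0.
have GE : (\int[leb2]_x (G x)%:E = (tri_avg f (2 * (2 * k)) xi a)%:E)%E.
  rewrite -tri_avgE// (ray_offset_integral a (phi := fun u => tri (2 * (2 * k)) (u - xi)) tf)//.
    by mfun.
  by move=> u; exact: tri_ge0.
have B'0 : 0 <= B * (RE + 1) by rewrite mulr_ge0//; have := hRE; lra.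
have cmp x : `|Kd p q x * f x - A x| <= B * (RE + 1) * G x.
  have [Ox|nO] := pselect (Omega x); last first.
    by rewrite /A /G (test_out tf nO) !mul0r !mulr0 subr0 normr0.
  have [i [j [hi hj px]]] := pixel_cover hD Ox.
  rewrite (Kd_cell p q Ox hi hj px) /A (mulrC (f x)) mulrA -mulrBl normrM (ger0_norm (test_ge0 tf x)).
  have := kernel_cell hRE hRD hD Ox px hq hPhi hXi; rewrite -/d -/k -/lam -/xp -/B => H.
  have s0 := srcdist_gt0 hRE a Ox; have s1 := srcdist_le RE a Ox.
  apply: le_trans (ler_wpM2r (test_ge0 tf x) H) _.
  set T := tri _ _.
  rewrite /G -/T [leRHS](_ : _ = B * T * ((RE + 1) * (f x / srcdist RE x a))); last by ring.
  apply: ler_wpM2l; first by rewrite mulr_ge0 ?tri_ge0.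
  by rewrite mulrCA ler_peMr ?test_ge0// ler_pdivlMr// mul1r.
have disE : discr_cst = B * (RE + 1) by rewrite /discr_cst /B; ring.
have KE : (\int[leb2]_x (Kd p q x * f x)%:E = (fine (\int[leb2]_x (Kd p q x * f x)%:E))%:E)%E.
  by rewrite fineK// discr_kernel.
rewrite disE ler_distlC.
have U : fine (\int[leb2]_x (Kd p q x * f x)%:E)%E <= tri_avg f d xp a + B * (RE + 1) * tri_avg f (2 * (2 * k)) xi a.
  rewrite -lee_fin EFinD EFinM -KE -AE -GE.
  rewrite -ge0_int_scale; [|exact: B'0|by mfun|by move=> x; rewrite lee_fin].
  rewrite -ge0_int_add; [|by mfun|by apply: emeasurable_funM; mfun|by move=> x; rewrite lee_fin
    |by move=> x; rewrite -EFinM lee_fin mulr_ge0].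
  apply: ge0_int_le.
  - by mfun.
  - by apply: emeasurable_funD; [mfun|apply: emeasurable_funM; mfun].
  - by move=> x; rewrite lee_fin; apply: mulr_ge0; [exact: Kd_ge0|exact: test_ge0].
  move=> x; rewrite -EFinM -EFinD lee_fin.
  by have := cmp x; rewrite ler_norml; lra.
have L : tri_avg f d xp a <= fine (\int[leb2]_x (Kd p q x * f x)%:E)%E + B * (RE + 1) * tri_avg f (2 * (2 * k)) xi a.
  rewrite -lee_fin EFinD EFinM -KE -AE -GE.
  rewrite -ge0_int_scale; [|exact: B'0|by mfun|by move=> x; rewrite lee_fin].
  rewrite -ge0_int_add; [|by mfun|by apply: emeasurable_funM; mfun
    |by move=> x; rewrite lee_fin; apply: mulr_ge0; [exact: Kd_ge0|exact: test_ge0]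
    |by move=> x; rewrite -EFinM lee_fin mulr_ge0].
  apply: ge0_int_le.
  - by mfun.
  - by apply: emeasurable_funD; [mfun|apply: emeasurable_funM; mfun].
  - by move=> x; rewrite lee_fin.
  move=> x; rewrite -EFinM -EFinD lee_fin.
  by have := cmp x; rewrite ler_norml; lra.
by apply/andP; split; lra.
Qed.

End discretization_error.

(** * Averages over an offset cell *)

Section integrated_error.
Context {R : realType}.
Variables (RE RD : R).
Hypotheses (hRE : 1 < RE) (hRD : 0 < RD).
Local Notation mu := (@lebesgue_measure R).
Local Notation RR := (measurableTypeR R).
Implicit Types (f : RR * RR -> R) (x : RR * RR).
Local Notation g := (ray_int RE RD).
Let W := detector_width RE RD.

(** Moves the centre from the cell midpoint to the variable point [v], which gives the translation
    invariant kernel of [fan_energy]. On the support, [|v - u|] is at most [d / 2 + d]; [tri_half]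
    at [3 * d / 2] then yields [6 = 4 * 3 / 2]. *)
Lemma tri_triple (d u v p : R) : 0 < d -> `|v - p| <= d / 2 ->
  tri d (u - p) <= 6 * tri (3 * d) (v - u).
Proof.
move=> d0 hv; have [h|h] := leP d `|u - p|; first by rewrite tri_out// mulr_ge0 ?tri_ge0.
apply: le_trans (tri_le _ d0) _.
have D0 : 0 < 3 * d / 2 by rewrite divr_gt0 ?mulr_gt0.
have hu : `|v - u| <= 3 * d / 2.
  by apply: le_trans (ler_distD p v u) _; move: h; rewrite (distrC p u); lra.
have := tri_half D0 hu; rewrite (_ : 2 * (3 * d / 2) = 3 * d); last by field.
by rewrite -[d^-1]mul1r ler_pdivrMr//; lra.
Qed.

(** The triangle has mass one, so the deviation from the average is at most the average of the
    deviations, and its square at most the average of the squares. Taking absolute values first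
    keeps all integrands nonnegative. *)
Lemma tri_avg_dist f (d xi p a : R) : 0 < d -> `|xi - p| <= d / 2 -> test_fun f ->
  (((g f xi a - tri_avg RE RD f d p a) ^+ 2)%:E <=
   6%:E * \int[mu]_u (tri (3 * d) (xi - u) * (g f xi a - g f u a) ^+ 2)%:E)%E.
Proof.
move=> d0 hp tf.
have mt h := @measurable_tri R h; have md := mt d; have m3 := mt (3 * d).
have mg := measurable_ray_int RE RD tf.
have [M M0 hM] := ray_int_bounded hRE hRD tf.
have g0 u : 0 <= g f u a := ray_int_ge0 _ _ _ _ tf.
have mga : measurable_fun setT (fun u : RR => g f u a : RR).
  by apply: (measurableT_comp mg (g := fun u : RR => (u, a))); mfun.
pose h u := `|g f xi a - g f u a|.
have mh : measurable_fun setT (h : RR -> RR) by rewrite /h; mfun.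
have h0 u : 0 <= h u by rewrite /h normr_ge0.
pose m' := fine (\int[mu]_u (tri d (u - p) * h u)%:E)%E.
have mu0 : (0 <= \int[mu]_u (tri d (u - p) * h u)%:E)%E.
  by apply: integral_ge0 => u _; rewrite lee_fin mulr_ge0 ?tri_ge0 ?h0.
have m'0 : 0 <= m' by rewrite fine_ge0.
have hle u : h u <= M.
  by rewrite /h ler_norml; have := hM xi a; have := hM u a; have := g0 u; have := g0 xi; lra.
have m'E : (\int[mu]_u (tri d (u - p) * h u)%:E = m'%:E)%E.
  rewrite fineK// ge0_fin_numE//.
  apply: le_lt_trans (_ : \int[mu]_u (M%:E * (tri d (u - p))%:E) < +oo)%E.
    apply: ge0_int_le.
    - by mfun.
    - by apply: emeasurable_funM; mfun.
    - by move=> u; rewrite lee_fin mulr_ge0 ?tri_ge0 ?h0.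
    - by move=> u; rewrite -EFinM lee_fin mulrC ler_wpM2r ?tri_ge0.
  rewrite ge0_int_scale//; [|by mfun|by move=> u; rewrite lee_fin tri_ge0].
  by rewrite integral_tri// mule1 ltry.
have gE : ((g f xi a)%:E = \int[mu]_u (tri d (u - p) * g f xi a)%:E)%E.
  under eq_integral do rewrite mulrC EFinM.
  rewrite ge0_int_scale//; [|by mfun|by move=> u; rewrite lee_fin tri_ge0].
  by rewrite integral_tri// mule1.
have t0 u : 0 <= tri d (u - p) by exact: tri_ge0.
have le1 : g f xi a <= tri_avg RE RD f d p a + m'.
  rewrite -lee_fin EFinD gE -m'E -tri_avgE//.
  rewrite -ge0_int_add; [|by mfun|by mfun|by move=> u; rewrite lee_fin mulr_ge0 ?g0
    |by move=> u; rewrite lee_fin mulr_ge0 ?h0].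
  apply: ge0_int_le; [by mfun|by apply: emeasurable_funD; mfun|by move=> u; rewrite lee_fin mulr_ge0 ?g0|].
  move=> u; rewrite -EFinD lee_fin -mulrDr ler_wpM2l//.
  by rewrite -lerBlDl ler_norm.
have le2 : tri_avg RE RD f d p a <= g f xi a + m'.
  rewrite -lee_fin EFinD gE -m'E -tri_avgE//.
  rewrite -ge0_int_add; [|by mfun|by mfun|by move=> u; rewrite lee_fin mulr_ge0 ?g0
    |by move=> u; rewrite lee_fin mulr_ge0 ?h0].
  apply: ge0_int_le; [by mfun|by apply: emeasurable_funD; mfun|by move=> u; rewrite lee_fin mulr_ge0 ?g0|].
  move=> u; rewrite -EFinD lee_fin -mulrDr ler_wpM2l//.
  by rewrite -lerBlDl /h distrC ler_norm.
apply: le_trans (_ : (m' ^+ 2)%:E <= _)%E.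
  rewrite lee_fin -[leLHS]real_normK ?num_real// ler_sqr ?nnegrE//.
  by rewrite ler_norml; lra.
have wc : (\int[mu]_u (tri d (u - p))%:E = 1%:E)%E by rewrite integral_tri.
have mtp : measurable_fun setT (fun u : RR => tri d (u - p) : RR) by mfun.
apply: le_trans (weighted_sqr mtp mh t0 h0 ltr01 m'0 wc m'E) _.
rewrite mul1e -ge0_int_scale//; [|by mfun|by move=> u; rewrite lee_fin mulr_ge0 ?tri_ge0 ?sqr_ge0].
apply: ge0_int_le.
- by mfun.
- by apply: emeasurable_funM; mfun.
- by move=> u; rewrite lee_fin mulr_ge0 ?sqr_ge0.
- move=> u; rewrite -EFinM lee_fin /h real_normK ?num_real// [leRHS]mulrA; apply: ler_wpM2r; rewrite ?sqr_ge0//.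
  exact: tri_triple.
Qed.

Lemma tri_avg_sqr f (h xi a : R) : 0 < h -> test_fun f ->
  (((tri_avg RE RD f h xi a) ^+ 2)%:E <= \int[mu]_u (tri h (u - xi) * g f u a ^+ 2)%:E)%E.
Proof.
move=> h0 tf; have mt := @measurable_tri R h.
have mg := measurable_ray_int RE RD tf.
have mga : measurable_fun setT (fun u : RR => g f u a : RR).
  by apply: (measurableT_comp mg (g := fun u : RR => (u, a))); mfun.
have mtp : measurable_fun setT (fun u : RR => tri h (u - xi) : RR) by mfun.
have t0 u : 0 <= tri h (u - xi) by exact: tri_ge0.
rewrite -[leRHS]mul1e.
apply: (weighted_sqr mtp mga t0) => //; last by rewrite tri_avgE.
- by move=> u; exact: ray_int_ge0.
- exact: tri_avg_ge0.
- by rewrite integral_tri.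
Qed.

End integrated_error.

(** * The error in mean square over the detector *)

Section squared_error.
Context {R : realType}.
Variables (RE RD : R).
Hypotheses (hRE : 1 < RE) (hRD : 0 < RD).
Variable (D : discretization R).
Hypothesis (hD : admissible RE D).
Local Notation mu := (@lebesgue_measure R).
Local Notation RR := (measurableTypeR R).
Implicit Types (f : RR * RR -> R) (x : RR * RR).
Local Notation g := (ray_int RE RD).
Local Notation W := (detector_width RE RD).
Local Notation d := (delta_xi RE RD D).
Local Notation k := (kernel_width RE RD D).
Local Notation S := (W + RD).
Local Notation c := (discr_cst RE RD D).

Definition fan_diff f (y : RR * RR) : R :=
  Num.sqrt (y.1 ^+ 2 + RD ^+ 2) * g f y.1 y.2 - fanbeam_discr_fun RE RD D f y.

(* The three terms come from moving [xi] to the cell midpoint in the square root,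
   from averaging the ray integral, and from freezing the kernel on cells. *)
Lemma fan_diff_pointwise f (xi a : R) : test_fun f -> - (W / 2) < xi < W / 2 ->
  ((fan_diff f (xi, a) ^+ 2)%:E <=
   (3 * d ^+ 2)%:E * (g f xi a ^+ 2)%:E +
   ((18 * S ^+ 2)%:E * \int[mu]_u (tri (3 * d) (xi - u) * (g f xi a - g f u a) ^+ 2)%:E +
    (3 * S ^+ 2 * c ^+ 2)%:E * \int[mu]_u (tri (2 * (2 * k)) (u - xi) * g f u a ^+ 2)%:E))%E.
Proof.
move=> tf hxi; have [p [hp xp hm]] := discr_pointwise hRE hRD hD a tf hxi.
have d0 := delta_xi_gt0 hRE hRD hD; have W0 := detector_width_gt0 hRE hRD.
have k4 : 0 < 2 * (2 * k) by rewrite !mulr_gt0 ?(kernel_width_gt0 hRE hRD hD).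
have c0 := discr_cst_ge0 hRE hRD hD.
have R0 := hRD.
have g0 : 0 <= g f xi a by exact: (ray_int_ge0 _ _ _ _ tf).
have hs := sqrt_hypot_lip xi (xi_ RE RD D p) RD.
have S1 : Num.sqrt (xi_ RE RD D p ^+ 2 + RD ^+ 2) <= S.
  apply: le_trans (_ : Num.sqrt ((`|xi_ RE RD D p| + RD) ^+ 2) <= _).
    rewrite ler_wsqrtr// sqrrD -normrX (ger0_norm (sqr_ge0 _)) lerD2r lerDl.
    by rewrite mulrn_wge0// mulr_ge0// ltW.
  by rewrite sqrtr_sqr ger0_norm ?addr_ge0 ?(ltW hRD)//; lra.
have S0 := sqrtr_ge0 (xi_ RE RD D p ^+ 2 + RD ^+ 2).
move: hs S1 S0 hm.
set s := Num.sqrt (xi ^+ 2 + _); set sp := Num.sqrt (xi_ _ _ _ p ^+ 2 + _) => hs S1 S0 hm.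
set F := fanbeam_discr_fun _ _ _ _ _ in hm.
set m := tri_avg _ _ _ _ _ _ in hm; set G4 := tri_avg _ _ _ _ _ _ in hm.
have G40 : 0 <= G4 by exact: tri_avg_ge0.
have e1 : `|fan_diff f (xi, a)| <= d * g f xi a + S * `|g f xi a - m| + S * (c * G4).
  rewrite /fan_diff/= -/s -/F.
  have -> : s * g f xi a - F = (s - sp) * g f xi a + sp * (g f xi a - m) - (F - sp * m) by ring.
  apply: le_trans (ler_normB _ _) _; apply: lerD.
    apply: le_trans (ler_normD _ _) _; rewrite !normrM (ger0_norm g0) (ger0_norm S0).
    apply: lerD; first by apply: ler_wpM2r => //; apply: le_trans hs _; lra.
    by apply: ler_wpM2r.
  apply: le_trans hm _; apply: ler_wpM2r => //.
  by rewrite mulr_ge0.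
have e2 : fan_diff f (xi, a) ^+ 2 <= 3 * d ^+ 2 * g f xi a ^+ 2 +
   (3 * S ^+ 2 * (g f xi a - m) ^+ 2 + 3 * S ^+ 2 * c ^+ 2 * G4 ^+ 2).
  rewrite -[leLHS]real_normK ?num_real// -[(g f xi a - m) ^+ 2]real_normK ?num_real//.
  apply: le_trans (_ : (d * g f xi a + S * `|g f xi a - m| + S * (c * G4)) ^+ 2 <= _).
    have Sn : 0 <= S by lra.
    rewrite ler_sqr ?nnegrE ?normr_ge0//; apply: addr_ge0; last by apply: mulr_ge0 => //; exact: mulr_ge0.
    by apply: addr_ge0; apply: mulr_ge0; rewrite ?(ltW d0).
  set A := d * _; set B := S * `|_|; set C := S * (c * _).
  have -> : 3 * d ^+ 2 * g f xi a ^+ 2 + (3 * S ^+ 2 * `|g f xi a - m| ^+ 2 +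
      3 * S ^+ 2 * c ^+ 2 * G4 ^+ 2) = 3 * (A ^+ 2 + B ^+ 2 + C ^+ 2) by rewrite /A /B /C; ring.
  have := sqr_ge0 (A - B); have := sqr_ge0 (B - C); have := sqr_ge0 (A - C).
  move: A B C => A B C h1 h2 h3; nra.
apply: le_trans (_ : (3 * d ^+ 2 * g f xi a ^+ 2 +
   (3 * S ^+ 2 * (g f xi a - m) ^+ 2 + 3 * S ^+ 2 * c ^+ 2 * G4 ^+ 2))%:E <= _)%E.
  by rewrite lee_fin.
have S2 : 0 <= 3 * S ^+ 2 by rewrite mulr_ge0 ?sqr_ge0.
rewrite EFinD (EFinM (3 * d ^+ 2)) leeD2l// EFinD; apply: leeD.
  rewrite (_ : 18 * S ^+ 2 = 3 * S ^+ 2 * 6); last by ring.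
  rewrite (EFinM (3 * S ^+ 2) 6) -muleA (EFinM (3 * S ^+ 2)); apply: lee_wpmul2l; first by rewrite lee_fin.
  exact: tri_avg_dist.
rewrite (EFinM (3 * S ^+ 2 * c ^+ 2)); apply: lee_wpmul2l; first by rewrite lee_fin mulr_ge0 ?sqr_ge0.
exact: tri_avg_sqr.
Qed.

Lemma measurable_fan_diff f : test_fun f ->
  measurable_fun setT (fan_diff f : RR * RR -> RR).
Proof.
move=> tf; have mg := measurable_ray_int RE RD tf.
have mF : measurable_fun setT (fanbeam_discr_fun RE RD D f : RR * RR -> RR).
  by have := fanbeam_discr_Lfun RE RD D f; rewrite inE => /andP[]; rewrite inE.
by rewrite /fan_diff; mfun.
Qed.

(** The summands correspond to the terms of [fan_diff_pointwise]: boundedness of the ray integrals,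
    smoothing at width [3 * d], and once more boundedness, since averaging does not increase the
    mean square. *)
Definition sqr_error_cst e : R :=
  3 * d ^+ 2 * ray_norm_cst RE RD +
  (18 * S ^+ 2 * (2 * fan_smoothing_cst RE RD e * (3 * d) `^ (2 * e)) +
   3 * S ^+ 2 * c ^+ 2 * ray_norm_cst RE RD).

Lemma fan_smoothing_cst_ge0 (e : R) : 0 <= fan_smoothing_cst RE RD e.
Proof. by rewrite mulr_ge0 ?sqr_ge0// mulr_ge0 ?fan_diff_cst_ge0. Qed.

Lemma sqr_error_cst_ge0 (e : R) : 0 <= sqr_error_cst e.
Proof.
have rn := ray_norm_cst_ge0 hRE hRD.
have d2 : 0 <= 3 * d ^+ 2 by rewrite mulr_ge0 ?sqr_ge0.
have S18 : 0 <= 18 * S ^+ 2 by rewrite mulr_ge0 ?sqr_ge0.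
have Sc : 0 <= 3 * S ^+ 2 * c ^+ 2 by rewrite mulr_ge0 ?sqr_ge0// mulr_ge0 ?sqr_ge0.
rewrite /sqr_error_cst; apply: addr_ge0; first exact: mulr_ge0.
apply: addr_ge0; last exact: mulr_ge0.
by apply: mulr_ge0 => //; rewrite mulr_ge0 ?powR_ge0// mulr_ge0 ?fan_smoothing_cst_ge0.
Qed.

Let int_ind_pi (G : R -> R -> \bar R) : (forall u a, 0 <= G u a)%E ->
  measurable_fun setT (fun z : RR * RR => G z.1 z.2) ->
  (\int[leb2]_y ((ind_pi y.2)%:E * G y.1 y.2) = \int[mu]_a ((ind_pi a)%:E * \int[mu]_u G u a))%E.
Proof.
move=> G0 mG; have mI := @measurable_ind_pi R.
rewrite leb2_tonelli2; last 2 first.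
- by apply: emeasurable_funM => //; mfun.
- by move=> y; rewrite mule_ge0 ?lee_fin.
apply: eq_integral => a _ /=; rewrite ge0_int_scale//.
by apply: (measurableT_comp mG (g := fun u : RR => (u, a))); mfun.
Qed.

Lemma fan_diff_sqr f (e : R) : 0 < e < 2^-1 -> test_fun f -> (sqr_int f < +oo)%E ->
  (\int[leb2]_y (\1_(Omega' RE RD) y * fan_diff f y ^+ 2)%:E
    <= (sqr_error_cst e)%:E * sqr_int f)%E.
Proof.
move=> he tf ffin.
have d0 := delta_xi_gt0 hRE hRD hD.
have k4 : 0 < 2 * (2 * k) by rewrite !mulr_gt0 ?(kernel_width_gt0 hRE hRD hD).
have mg := measurable_ray_int RE RD tf.
have mI := @measurable_ind_pi R.
have md := measurable_fan_diff tf.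
have mt h := @measurable_tri R h; have m3 := mt (3 * d); have m4 := mt (2 * (2 * k)).
have mO : measurable_fun setT (\1_(Omega' RE RD) : RR * RR -> R).
  by apply: measurable_indic; exact: measurable_Omega'.
pose G1 (u a : R) : \bar R := (g f u a ^+ 2)%:E.
pose G2 (u a : R) : \bar R := (\int[mu]_v (tri (3 * d) (u - v) * (g f u a - g f v a) ^+ 2)%:E)%E.
pose G3 (u a : R) : \bar R := (\int[mu]_v (tri (2 * (2 * k)) (v - u) * g f v a ^+ 2)%:E)%E.
have G10 u a : (0 <= G1 u a)%E by rewrite lee_fin sqr_ge0.
have G20 u a : (0 <= G2 u a)%E.
  by apply: integral_ge0 => v _; rewrite lee_fin mulr_ge0 ?sqr_ge0 ?tri_ge0.
have G30 u a : (0 <= G3 u a)%E.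
  by apply: integral_ge0 => v _; rewrite lee_fin mulr_ge0 ?sqr_ge0 ?tri_ge0.
have mG1 : measurable_fun setT (fun z : RR * RR => G1 z.1 z.2) by rewrite /G1; mfun.
have mG2 : measurable_fun setT (fun z : RR * RR => G2 z.1 z.2).
  apply: (measurable_fun_fubini_tonelli_F (m2 := mu) (fun z : RR * RR * RR =>
    (tri (3 * d) (z.1.1 - z.2) * (g f z.1.1 z.1.2 - g f z.2 z.1.2) ^+ 2)%:E)) => [|z]; first by mfun.
  by rewrite lee_fin mulr_ge0 ?sqr_ge0 ?tri_ge0.
have mG3 : measurable_fun setT (fun z : RR * RR => G3 z.1 z.2).
  apply: (measurable_fun_fubini_tonelli_F (m2 := mu) (fun z : RR * RR * RR =>
    (tri (2 * (2 * k)) (z.2 - z.1.1) * g f z.2 z.1.2 ^+ 2)%:E)) => [|z]; first by mfun.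
  by rewrite lee_fin mulr_ge0 ?sqr_ge0 ?tri_ge0.
have S2 : 0 <= 3 * S ^+ 2 by rewrite mulr_ge0 ?sqr_ge0.
have d2 : 0 <= 3 * d ^+ 2 by rewrite mulr_ge0 ?sqr_ge0.
have S18 : 0 <= 18 * S ^+ 2 by rewrite mulr_ge0 ?sqr_ge0.
have Sc : 0 <= 3 * S ^+ 2 * c ^+ 2 by rewrite mulr_ge0 ?sqr_ge0.
pose H (i : RR * RR -> \bar R) y := ((ind_pi y.2)%:E * i y)%E.
have I1 : (\int[leb2]_y ((ind_pi y.2)%:E * G1 y.1 y.2) <= (ray_norm_cst RE RD)%:E * sqr_int f)%E.
  by rewrite int_ind_pi//; exact: ray_norm.
have I2 : (\int[leb2]_y ((ind_pi y.2)%:E * G2 y.1 y.2) <=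
    (2 * fan_smoothing_cst RE RD e * (3 * d) `^ (2 * e))%:E * sqr_int f)%E.
  by rewrite int_ind_pi//; apply: fan_energy_le => //; rewrite mulr_gt0.
(* Integrating in the centre of the triangle first leaves its mass one, so the average costs no
   constant. *)
have I3 : (\int[leb2]_y ((ind_pi y.2)%:E * G3 y.1 y.2) <= (ray_norm_cst RE RD)%:E * sqr_int f)%E.
  rewrite int_ind_pi//; apply: le_trans (ray_norm hRE hRD tf).
  rewrite le_eqVlt; apply/orP; left; apply/eqP; apply: eq_integral => a _; congr (_ * _)%E.
  have mg1 : measurable_fun setT (fun u : RR => g f u a : RR).
    by apply: (measurableT_comp mg (g := fun u : RR => (u, a))); mfun.
  rewrite /G3 (fubini_tonelli (m1 := mu) (m2 := mu) (fun z : RR * RR =>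
    (tri (2 * (2 * k)) (z.2 - z.1) * g f z.2 a ^+ 2)%:E)); last 2 first.
  - by mfun.
  - by move=> z; rewrite lee_fin mulr_ge0 ?sqr_ge0 ?tri_ge0.
  apply: eq_integral => u _ /=.
  transitivity (\int[mu]_x ((g f u a ^+ 2)%:E * (tri (2 * (2 * k)) (x - u))%:E))%E.
    by apply: eq_integral => x _; rewrite -EFinM mulrC -triN opprB.
  rewrite ge0_int_scale ?sqr_ge0//; [|by mfun|by move=> x; rewrite lee_fin tri_ge0].
  by rewrite integral_tri// mule1.
have mH G' : measurable_fun setT (fun z : RR * RR => G' z.1 z.2 : \bar R) ->
    measurable_fun setT (fun y : RR * RR => ((ind_pi y.2)%:E * G' y.1 y.2))%E.
  by move=> m; apply: emeasurable_funM => //; mfun.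
have H0 (G' : R -> R -> \bar R) : (forall u a, 0 <= G' u a)%E ->
    (forall y : RR * RR, 0 <= (ind_pi y.2)%:E * G' y.1 y.2)%E.
  by move=> h y; rewrite mule_ge0 ?lee_fin.
apply: le_trans (_ : \int[leb2]_y ((3 * d ^+ 2)%:E * ((ind_pi y.2)%:E * G1 y.1 y.2) +
   ((18 * S ^+ 2)%:E * ((ind_pi y.2)%:E * G2 y.1 y.2) +
    (3 * S ^+ 2 * c ^+ 2)%:E * ((ind_pi y.2)%:E * G3 y.1 y.2))) <= _)%E.
  have mm (r : R) G' : measurable_fun setT (fun z : RR * RR => G' z.1 z.2 : \bar R) ->
    measurable_fun setT (fun y : RR * RR => (r%:E * ((ind_pi y.2)%:E * G' y.1 y.2)))%E.
    by move=> m; apply: emeasurable_funM; [exact: measurable_cst|exact: mH].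
  apply: ge0_int_le.
  - by mfun.
  - by apply: emeasurable_funD; [exact: mm|apply: emeasurable_funD; exact: mm].
  - by move=> y; rewrite lee_fin mulr_ge0 ?sqr_ge0.
  move=> [xi a]; rewrite [_ _ (xi, a)]indicE.
  have [[h1 h2]|nO] := pselect (Omega' RE RD (xi, a)); last first.
    rewrite memNset// mul0r; apply: adde_ge0; first by rewrite mule_ge0 ?H0.
    by apply: adde_ge0; rewrite mule_ge0 ?H0.
  rewrite mem_set; last by split.
  rewrite /= mul1r /ind_pi indicE mem_set// !mul1e.
  exact: fan_diff_pointwise.
have mS (r : R) (G' : R -> R -> \bar R) : measurable_fun setT (fun z : RR * RR => G' z.1 z.2 : \bar R) ->
    measurable_fun setT (fun y : RR * RR => (r%:E * ((ind_pi y.2)%:E * G' y.1 y.2)))%E.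
  by move=> m; apply: emeasurable_funM; [exact: measurable_cst|exact: mH].
have nS (r : R) (G' : R -> R -> \bar R) : 0 <= r -> (forall u a, 0 <= G' u a)%E ->
    forall y : RR * RR, (0 <= r%:E * ((ind_pi y.2)%:E * G' y.1 y.2))%E.
  by move=> r0 h y; rewrite mule_ge0 ?lee_fin// H0.
rewrite ge0_int_add; [|exact: mS|by apply: emeasurable_funD; exact: mS|exact: nS
  |by move=> y; apply: adde_ge0; exact: nS].
rewrite ge0_int_add; [|exact: mS|exact: mS|exact: nS|exact: nS].
rewrite !ge0_int_scale//; try by [exact: mH|exact: H0].
have s0 : (0 <= sqr_int f)%E by apply: integral_ge0 => x _; rewrite lee_fin sqr_ge0.
have rn := ray_norm_cst_ge0 hRE hRD.
have p1 : 0 <= 3 * d ^+ 2 * ray_norm_cst RE RD by exact: mulr_ge0.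
have p2 : 0 <= 18 * S ^+ 2 * (2 * fan_smoothing_cst RE RD e * (3 * d) `^ (2 * e)).
  by apply: mulr_ge0 => //; rewrite mulr_ge0 ?powR_ge0// mulr_ge0 ?fan_smoothing_cst_ge0.
have p3 : 0 <= 3 * S ^+ 2 * c ^+ 2 * ray_norm_cst RE RD by exact: mulr_ge0.
rewrite /sqr_error_cst !EFinD !ge0_muleDl ?lee_fin//; last exact: addr_ge0.
apply: leeD; first by rewrite (EFinM _ (ray_norm_cst _ _)) -muleA; apply: lee_wpmul2l.
apply: leeD; first by rewrite (EFinM (18 * _)) -muleA; apply: lee_wpmul2l.
by rewrite (EFinM _ (ray_norm_cst _ _)) -muleA; apply: lee_wpmul2l.
Qed.

End squared_error.

(** * Density of Lipschitz functions *)

Section density.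
Context {R : realType}.
Local Notation mu := (@lebesgue_measure R).
Local Notation RR := (measurableTypeR R).
Implicit Types (f g m : RR * RR -> R) (x y : RR * RR) (A C : set (RR * RR)).

Definition lip2 (L : R) f := forall x y, `|f x - f y| <= L * (`|x.1 - y.1| + `|x.2 - y.2|).

(** The radius [r < 1] puts the closure of the support inside [Omega]; for such functions
    [is_fanbeam] provides the integral formula. *)
Record lip_Omega f : Prop := LipOmega {
  lip_Omega_meas : measurable_fun setT (f : RR * RR -> RR);
  lip_Omega_lip : exists2 L, 0 <= L & lip2 L f;
  lip_Omega_supp : exists2 r : R, r < 1 & forall x, f x != 0 -> euclid2 x <= r }.

Lemma euclid2_lip : lip2 1 (@euclid2 R).
Proof.
move=> x y; rewrite mul1r /euclid2.
apply: le_trans (ler_distD (Num.sqrt (y.1 ^+ 2 + x.2 ^+ 2)) _ _) _.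
by apply: lerD; [exact: sqrt_hypot_lip|rewrite ![y.1 ^+ 2 + _]addrC; exact: sqrt_hypot_lip].
Qed.

Lemma lip_Omega_comb f g (c : R) : lip_Omega f -> lip_Omega g ->
  lip_Omega (fun x => f x + c * g x).
Proof.
move=> [mf [L L0 Lf] [r r1 fr]] [mg [K K0 Kg] [s s1 gs]]; split.
- by mfun.
- exists (L + `|c| * K); first by rewrite addr_ge0// mulr_ge0.
  move=> x y; have -> : f x + c * g x - (f y + c * g y) = (f x - f y) + c * (g x - g y) by ring.
  apply: le_trans (ler_normD _ _) _; rewrite normrM mulrDl -mulrA.
  by apply: lerD; [exact: Lf|apply: ler_wpM2l => //; exact: Kg].
- exists (Num.max r s); first by rewrite gt_max r1.
  move=> x; have [->|f0 _] := eqVneq (f x) 0; last by rewrite le_max fr.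
  have [->|g0 _] := eqVneq (g x) 0; last by rewrite le_max gs ?orbT.
  by rewrite mulr0 addr0 eqxx.
Qed.

(** A closure property instead of a density statement: it is stable under linear combinations and
    dominated limits, and so can be carried from tent functions through indicators and simple
    functions. *)
Definition L2_approx f := measurable_fun setT (f : RR * RR -> RR) /\
  forall e : R, 0 < e -> exists2 h, lip_Omega h & (\int[leb2]_x ((f x - h x) ^+ 2)%:E <= e%:E)%E.

Lemma L2_approx_lip f : lip_Omega f -> L2_approx f.
Proof.
move=> lf; split; first exact: lip_Omega_meas.
move=> e e0; exists f => //.
by rewrite integral0_eq ?lee_fin ?ltW// => x _; rewrite subrr expr0n.
Qed.

Let int_sqr_add f g (a : R) : measurable_fun setT (f : RR * RR -> RR) ->
  measurable_fun setT (g : RR * RR -> RR) ->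
  (\int[leb2]_x ((f x + a * g x) ^+ 2)%:E <=
    2%:E * \int[leb2]_x (f x ^+ 2)%:E + (2 * a ^+ 2)%:E * \int[leb2]_x (g x ^+ 2)%:E)%E.
Proof.
move=> mf mg.
rewrite -ge0_int_scale; [|by []|by mfun|by move=> x; rewrite lee_fin sqr_ge0].
rewrite -ge0_int_scale; [|by rewrite mulr_ge0 ?sqr_ge0|by mfun|by move=> x; rewrite lee_fin sqr_ge0].
rewrite -ge0_int_add; [|by apply: emeasurable_funM; mfun|by apply: emeasurable_funM; mfun
  |by move=> x; rewrite -EFinM lee_fin mulr_ge0 ?sqr_ge0
  |by move=> x; rewrite -EFinM lee_fin mulr_ge0 ?sqr_ge0// mulr_ge0 ?sqr_ge0].
apply: ge0_int_le.
- by mfun.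
- by apply: emeasurable_funD; apply: emeasurable_funM; mfun.
- by move=> x; rewrite lee_fin sqr_ge0.
- move=> x; rewrite -!EFinM -EFinD lee_fin.
  rewrite -[leRHS](_ : (f x + a * g x) ^+ 2 + (f x - a * g x) ^+ 2 = _); last by ring.
  by rewrite lerDl sqr_ge0.
Qed.

Lemma L2_approx_comb f g (c : R) : L2_approx f -> L2_approx g ->
  L2_approx (fun x => f x + c * g x).
Proof.
move=> [mf hf] [mg hg]; split; first by mfun.
move=> e e0.
have e4 : 0 < e / 4 by rewrite divr_gt0.
have c0 : 0 < 1 + c ^+ 2 by rewrite ltr_pwDl ?sqr_ge0.
have [F lF hF] := hf _ e4.
have [G lG hG] := hg (e / 4 / (1 + c ^+ 2)) (divr_gt0 e4 c0).
exists (fun x => F x + c * G x); first exact: lip_Omega_comb.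
have mF := lip_Omega_meas lF; have mG := lip_Omega_meas lG.
have m1 : measurable_fun setT (fun x : RR * RR => f x - F x : RR) by mfun.
have m2 : measurable_fun setT (fun x : RR * RR => g x - G x : RR) by mfun.
apply: le_trans (_ : 2%:E * \int[leb2]_x ((f x - F x) ^+ 2)%:E +
   (2 * c ^+ 2)%:E * \int[leb2]_x ((g x - G x) ^+ 2)%:E <= _)%E.
  apply: le_trans (int_sqr_add c m1 m2); rewrite le_eqVlt; apply/orP; left; apply/eqP.
  by apply: eq_integral => x _; congr (_ %:E); ring.
apply: le_trans (leeD (lee_wpmul2l _ hF) (lee_wpmul2l _ hG)) _.
- by rewrite lee_fin.
- by rewrite lee_fin mulr_ge0 ?sqr_ge0.
rewrite -!EFinM -EFinD lee_fin.
have : c ^+ 2 / (1 + c ^+ 2) <= 1 by rewrite ler_pdivrMr// mul1r lerDr.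
have -> : 2 * c ^+ 2 * (e / 4 / (1 + c ^+ 2)) = e / 2 * (c ^+ 2 / (1 + c ^+ 2)).
  by field; rewrite gt_eqF.
by move: (c ^+ 2 / _) => t t1; nra.
Qed.

(** Dominated convergence makes some [f_ n] close to [f] in [L^2], and [f_ n] is close to a
    Lipschitz function; the inequality for the square of a sum doubles each part, hence the quarters
    of [e]. *)
Lemma L2_approx_cvg (f_ : nat -> RR * RR -> R) f (h : RR * RR -> \bar R) :
  (forall n, L2_approx (f_ n)) -> measurable_fun setT (f : RR * RR -> RR) ->
  (forall x, f_ n x @[n --> \oo] --> f x) ->
  leb2.-integrable setT h -> (forall x, h x \is a fin_num) ->
  (forall n x, (((f x - f_ n x) ^+ 2)%:E <= h x)%E) ->
  L2_approx f.
Proof.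
move=> hf mf cf ih hfin fh; split => // e e0.
have mf_ n : measurable_fun setT (f_ n : RR * RR -> RR) := (hf n).1.
have cv : (\int[leb2]_x ((f x - f_ n x) ^+ 2)%:E @[n --> \oo] --> \int[leb2]_x (cst 0%E x))%E.
  apply: (@dominated_cvg _ _ _ leb2 setT measurableT (fun n x => ((f x - f_ n x) ^+ 2)%:E) (cst 0%E) h).
  - by move=> n; have mn := mf_ n; mfun.
  - move=> x _ /=; apply: cvg_EFin; first exact: nearW.
    have c1 : f x - f_ n x @[n --> \oo] --> f x - f x by apply: cvgB; [exact: cvg_cst|exact: cf].
    have c3 : (fun n => (f x - f_ n x) * (f x - f_ n x)) @ \oo --> (0 : R).
      rewrite subrr in c1; rewrite -(mul0r (0 : R)); exact: (cvgM c1 c1).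
    apply: cvg_trans c3; by apply: near_eq_cvg; apply: nearW => n /=; rewrite expr2.
  - by [].
  - exact: ih.
  - by move=> n x _; rewrite gee0_abs ?lee_fin ?sqr_ge0.
rewrite integral0 in cv.
have e4 : 0 < e / 4 by rewrite divr_gt0.
have [n hn] : exists n, (\int[leb2]_x ((f x - f_ n x) ^+ 2)%:E <= (e / 4)%:E)%E.
  move/fine_cvgP: cv => [fi cv].
  have [n _ H] : \forall n \near \oo, (\int[leb2]_x ((f x - f_ n x) ^+ 2)%:E <= (e / 4)%:E)%E.
    by apply: filterS2 fi (cvgr_lt (0 : R) cv _ e4) => n fn ln; rewrite -(fineK fn) lee_fin ltW.
  by exists n; apply: H => /=.
have [g lg hg] := (hf n).2 _ e4.
exists g => //; have mg := lip_Omega_meas lg; have mn := mf_ n.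
have m1 : measurable_fun setT (fun x : RR * RR => f x - f_ n x : RR) by mfun.
have m2 : measurable_fun setT (fun x : RR * RR => f_ n x - g x : RR) by mfun.
apply: le_trans (_ : 2%:E * \int[leb2]_x ((f x - f_ n x) ^+ 2)%:E +
   (2 * 1 ^+ 2)%:E * \int[leb2]_x ((f_ n x - g x) ^+ 2)%:E <= _)%E.
  apply: le_trans (int_sqr_add 1 m1 m2); rewrite le_eqVlt; apply/orP; left; apply/eqP.
  by apply: eq_integral => x _; congr (_ %:E); ring.
apply: le_trans (leeD (lee_wpmul2l _ hn) (lee_wpmul2l _ hg)) _.
- by rewrite lee_fin.
- by rewrite lee_fin mulr_ge0 ?sqr_ge0.
by rewrite -!EFinM -EFinD lee_fin; lra.
Qed.

End density.

Section density_sets.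
Context {R : realType}.
Local Notation mu := (@lebesgue_measure R).
Local Notation RR := (measurableTypeR R).
Implicit Types (f g m : RR * RR -> R) (x y : RR * RR) (A C : set (RR * RR)).

Lemma leb2_Omega : (leb2 (@Omega R) < +oo)%E.
Proof.
have mI := @measurable_itv R.
apply: (@le_lt_trans _ _ (leb2 ((`[-1, 1]%classic : set RR) `*` (`[-1, 1]%classic : set RR)))).
  apply: (le_measure leb2); rewrite ?inE; [exact: measurable_Omega|exact: measurableX|].
  move=> x /OmegaE h /=; rewrite !in_itv/=; have s1 := sqr_ge0 x.1; have s2 := sqr_ge0 x.2.
  by split; rewrite -ler_norml -(ler_sqr (normr_ge0 _) ler01) real_normK ?num_real// expr1n; lra.
have -> : leb2 ((`[-1, 1]%classic : set RR) `*` (`[-1, 1]%classic : set RR)) =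
    (mu `[(-1)%R, 1%R]%classic * mu `[(-1)%R, 1%R]%classic)%E.
  by rewrite /leb2 product_measure1E; [|exact: mI|exact: mI].
rewrite !lebesgue_measure_itv/= lte_fin; case: ifP => _; last by rewrite mule0.
by rewrite -EFinB -EFinM ltry.
Qed.

Lemma integrable_Omega : leb2.-integrable setT (fun x : RR * RR => (\1_Omega x : R)%:E).
Proof.
apply/integrableP; split; first by apply/measurable_EFinP; apply: measurable_indic; exact: measurable_Omega.
rewrite (eq_integral (fun x : RR * RR => (\1_Omega x : R)%:E)); last first.
  by move=> x _; rewrite gee0_abs ?lee_fin.
by rewrite integral_indic ?setIT//; [exact: leb2_Omega|exact: measurable_Omega].
Qed.

Lemma clip_lip (s t : R) : `|Num.min 1 (Num.max 0 s) - Num.min 1 (Num.max 0 t)| <= `|s - t|.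
Proof.
wlog st : s t / s <= t => [h|].
  by have [/h//|/ltW /h] := leP s t; rewrite distrC (distrC t).
rewrite distrC (distrC s) (ger0_norm (_ : 0 <= t - s)) ?subr_ge0// ler_norml.
rewrite /Num.min /Num.max; case: (ltP 0 s) => s0; case: (ltP 0 t) => t0;
  case: ltP => ?; case: ltP => ?; apply/andP; split; lra.
Qed.

(** The indicator of the positivity set of a Lipschitz function is the limit of the ramps that clip
    [n * m - 1] to [[0, 1]]. As [m] lies below the distance to the unit circle, each ramp is
    supported in a smaller disc. *)
Lemma L2_approx_tent m : measurable_fun setT (m : RR * RR -> RR) -> lip2 1 m ->
  (forall x, m x <= 1 - euclid2 x) -> L2_approx (\1_[set x | 0 < m x] : RR * RR -> R).
Proof.
move=> mm Lm m1.
pose phi (n : nat) x : R := Num.min 1 (Num.max 0 (n%:R * m x - 1)).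
have phi0 n x : m x <= 0 -> phi n x = 0.
  move=> h; rewrite /phi max_l ?min_r// subr_le0.
  by apply: le_trans (mulr_ge0_le0 _ h) _.
have phi01 n x : 0 <= phi n x <= 1.
  by rewrite /phi le_min ler01 le_max lexx ge_min lexx.
have mpos : measurable [set x : RR * RR | 0 < m x].
  have mO := measurable_fun_ltr (@measurable_cst _ _ _ _ setT (0 : R)) mm.
  by have := mO measurableT [set true] I; rewrite setTI.
have posO x : 0 < m x -> Omega x by move=> h; rewrite /Omega/=; have := m1 x; lra.
apply: (@L2_approx_cvg _ phi _ (fun x => (\1_Omega x : R)%:E)).
- move=> n; apply: L2_approx_lip; split.
  + rewrite /phi; apply: measurable_minr; first exact: measurable_cst.
    by apply: measurable_maxr; [exact: measurable_cst|mfun].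
  + exists n%:R => // x y; apply: le_trans (clip_lip _ _) _.
    have -> : n%:R * m x - 1 - (n%:R * m y - 1) = n%:R * (m x - m y) by ring.
    rewrite normrM ger0_norm// ler_wpM2l//.
    by have := Lm x y; rewrite mul1r.
  (* The ramp vanishes unless [n * m x >= 1]; the successor in place of [n] covers [n = 0], where
     the ramp is zero. *)
  + exists (1 - n.+1%:R^-1); first by rewrite ltrBlDr ltrDl invr_gt0 ltr0n.
    move=> x h; have : 1 <= n%:R * m x.
      rewrite leNgt; apply: contraNN h => h; apply/eqP.
      by rewrite /phi max_l ?min_r// subr_le0 ltW.
    move=> h1; have m0 : 0 < m x.
      by rewrite ltNge; apply/negP => /(mulr_ge0_le0 (ler0n R n)); lra.
    apply: le_trans (_ : 1 - m x <= _); first by have := m1 x; lra.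
    rewrite lerD2l lerN2.
    by rewrite -[n.+1%:R^-1]mul1r ler_pdivrMr ?ltr0n// -natr1 mulrDr mulr1 mulrC; lra.
- exact: measurable_indic.
- move=> x; have [h|h] := ltP 0 (m x); last first.
    rewrite indicE memNset/=; last by apply/negP; rewrite -leNgt.
    by under eq_cvg do rewrite phi0//; exact: cvg_cst.
  rewrite indicE mem_set//=.
  apply: cvg_near_cst; near=> n.
  have hn : 2 / m x <= n%:R by near: n; exact: nbhs_infty_ger.
  rewrite /phi max_r; first by apply/eqP; rewrite eq_minl// lerBrDr; rewrite ler_pdivrMr// in hn.
  by rewrite subr_ge0; rewrite ler_pdivrMr// in hn; lra.
- exact: integrable_Omega.
- by [].
- move=> n x; rewrite lee_fin !indicE.
  have [h|h] := ltP 0 (m x).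
    rewrite mem_set// mem_set; last exact: posO.
    by have := phi01 n x => /andP[a b]; rewrite expr_le1//=; lra.
  rewrite memNset; last by apply/negP; rewrite -leNgt.
  by rewrite phi0// subr0 expr0n.
Unshelve. all: by end_near. Qed.

Lemma indic_setD0 (C S1 S2 : set (RR * RR)) : S1 `&` S2 = set0 ->
  (\1_(C `&` (S1 `|` S2)) : RR * RR -> R) = (fun x => \1_(C `&` S1) x + 1 * \1_(C `&` S2) x).
Proof.
move=> d; apply/funext => x; rewrite !indicE !in_setI in_setU mul1r.
have : ~~ ((x \in S1) && (x \in S2)) by rewrite -in_setI d in_set0.
by case: (x \in C); case: (x \in S1); case: (x \in S2) => //=; rewrite ?addr0 ?add0r.
Qed.

(* Dynkin argument along a measurable map, applied to both coordinates and then
   to the identity. *)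
Lemma L2_approx_dynkin d (T : measurableType d) (G : set (set T)) (p : RR * RR -> T) C :
  measurable_fun setT p -> @measurable _ T = <<s G >> -> setI_closed G ->
  measurable C -> C `<=` Omega -> L2_approx (\1_C : RR * RR -> R) ->
  (forall S, G S -> L2_approx (\1_(C `&` p @^-1` S) : RR * RR -> R)) ->
  forall S, measurable S -> L2_approx (\1_(C `&` p @^-1` S) : RR * RR -> R).
Proof.
move=> mp GE GI mC CO aC aG S; rewrite GE; move: S.
have mpre S : measurable S -> measurable (p @^-1` S).
  by move=> mS; have := mp measurableT S mS; rewrite setTI.
apply: (dynkin_induction GE GI (P := fun S => L2_approx (\1_(C `&` p @^-1` S) : RR * RR -> R))) => //.
- by rewrite preimage_setT setIT.
- move=> S mS aS.
  have -> : (\1_(C `&` p @^-1` (~` S)) : RR * RR -> R) = (fun x => \1_C x + -1 * \1_(C `&` p @^-1` S) x).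
    apply/funext => x; rewrite !indicE !in_setI preimage_setC in_setC.
    by case: (x \in C); case: (x \in _) => //=; ring.
  exact: L2_approx_comb.
- move=> F mF tF aF.
  pose U n := \big[setU/set0]_(i < n) F i.
  have aU n : L2_approx (\1_(C `&` p @^-1` (U n)) : RR * RR -> R).
    elim: n => [|n IH].
      rewrite /U big_ord0 preimage_set0 setI0 indic0.
      have := L2_approx_comb (-1) aC aC.
      by congr L2_approx; apply/funext => x /=; ring.
    rewrite /U big_ord_recr/= preimage_setU indic_setD0; first exact: L2_approx_comb.
    rewrite -preimage_setI; have -> : U n `&` F n = set0; last exact: preimage_set0.
    apply/seteqP; split => // y []; rewrite /U -bigcup_mkord => -[i /= ni Fi] Fn.
    by have := tF i n I I (ex_intro _ y (conj Fi Fn)) => E; rewrite E ltnn in ni.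
  apply: (@L2_approx_cvg _ (fun n => \1_(C `&` p @^-1` (U n))) _ (fun x => (\1_Omega x : R)%:E)).
  + exact: aU.
  + apply: measurable_indic; apply: measurableI => //; apply: mpre.
    exact: bigcupT_measurable.
  + move=> x; apply: cvg_near_cst.
    have [[n _ Fn]|nF] := pselect ((\bigcup_k F k) (p x)).
      exists n.+1 => // k /= nk; rewrite !indicE !in_setI; congr (_%:R); congr nat_of_bool; congr andb.
      rewrite !mem_set//=; first by exists n.
      by rewrite /U -bigcup_mkord; exists n.
    exists 0%N => // k _ /=; rewrite !indicE !in_setI; congr (_%:R); congr nat_of_bool; congr andb.
    rewrite !memNset//= /U -bigcup_mkord => -[i _ Fi]; apply: nF; by exists i.
  + exact: integrable_Omega.
  + by [].
  + move=> n x; rewrite lee_fin !indicE !in_setI.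
    case Cx : (x \in C) => /=; last by rewrite subrr expr0n.
    rewrite (mem_set (CO x (set_mem Cx))).
    case: (_ \in _); case: (_ \in _); rewrite ?subrr ?subr0 ?sub0r ?sqrrN ?expr1n ?expr0n//.
Qed.

(** A half-space condition keeps the tent form, because the minimum of [m] and [p - a] inherits the
    Lipschitz bound and stays below [1 - |x|]. *)
Lemma L2_approx_rays (m : RR * RR -> R) (p : RR * RR -> RR) :
  measurable_fun setT (m : RR * RR -> RR) -> lip2 1 m -> (forall x, m x <= 1 - euclid2 x) ->
  measurable_fun setT p -> lip2 1 p ->
  forall (a : R), L2_approx (\1_([set x | 0 < m x] `&` p @^-1` `]a, +oo[) : RR * RR -> R).
Proof.
move=> mm Lm m1 mp Lp a.
have -> : [set x | 0 < m x] `&` p @^-1` `]a, +oo[ = [set x | 0 < Num.min (m x) (p x - a)].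
  apply/seteqP; split => x /=; rewrite in_itv/= andbT lt_min subr_gt0; first by move=> [-> ->].
  by move=> /andP[].
apply: L2_approx_tent.
- by apply: measurable_minr => //; mfun.
- move=> x y; have := Lm x y; have := Lp x y; rewrite !mul1r !ler_norml => /andP[h1 h2] /andP[h3 h4].
  by rewrite /Num.min; case: ltP => ?; case: ltP => ?; apply/andP; split; lra.
- by move=> x; rewrite ge_min m1.
Qed.

End density_sets.

Section density_functions.
Context {R : realType}.
Local Notation mu := (@lebesgue_measure R).
Local Notation RR := (measurableTypeR R).
Implicit Types (f g m : RR * RR -> R) (x y : RR * RR) (A C : set (RR * RR)).

Let mE : measurable_fun setT (fun x : RR * RR => 1 - euclid2 x : RR).
Proof. by rewrite /euclid2; mfun. Qed.

Let lE : lip2 1 (fun x : RR * RR => 1 - euclid2 x).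
Proof.
move=> x y; have -> : 1 - euclid2 x - (1 - euclid2 y) = - (euclid2 x - euclid2 y) by ring.
by rewrite normrN; exact: euclid2_lip.
Qed.

Let OE : [set x : RR * RR | 0 < 1 - euclid2 x] = Omega.
Proof. by apply/seteqP; split => x; rewrite /Omega/= subr_gt0. Qed.

Let raysE : @measurable _ RR = <<s @RGenOInfty.G R >>.
Proof. exact: RGenOInfty.measurableE. Qed.

Let raysI : setI_closed (@RGenOInfty.G R).
Proof.
move=> _ _ [a ->] [b ->]; exists (Num.max a b); apply/seteqP.
split => x /=; rewrite !in_itv/= !andbT gt_max; first by move=> [-> ->].
by move=> /andP[].
Qed.

Let aO : L2_approx (\1_Omega : RR * RR -> R).
Proof. by rewrite -OE; apply: L2_approx_tent. Qed.

(** The first coordinate is generalized from rays to [A] over two base sets, [Omega] and [Omega] cut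
    by a half-plane in the second coordinate. These are the base and the generator case when the
    second coordinate is generalized to [B]. *)
Lemma L2_approx_rect (A B : set RR) : measurable A -> measurable B ->
  L2_approx (\1_(Omega `&` (A `*` B)) : RR * RR -> R).
Proof.
move=> mA mB.
have mO := @measurable_Omega R.
have m1 : measurable_fun setT (fst : RR * RR -> RR) by exact: measurable_fst.
have m2 : measurable_fun setT (snd : RR * RR -> RR) by exact: measurable_snd.
have l1 : lip2 1 (fst : RR * RR -> R) by move=> x y; rewrite mul1r lerDl.
have l2 : lip2 1 (snd : RR * RR -> R) by move=> x y; rewrite mul1r lerDr.
have stripe b : measurable ((Omega : set (RR * RR)) `&` snd @^-1` (`]b, +oo[%classic : set RR)).
  apply: measurableI => //.
  by have := m2 measurableT (`]b, +oo[%classic) (measurable_itv _); rewrite setTI.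
have s1 : L2_approx (\1_(Omega `&` fst @^-1` A) : RR * RR -> R).
  apply: (L2_approx_dynkin m1 raysE raysI) => // _ [a ->]; rewrite -OE.
  exact: L2_approx_rays.
have s2 b : L2_approx (\1_((Omega `&` snd @^-1` (`]b, +oo[%classic : set RR)) `&` fst @^-1` A) : RR * RR -> R).
  have E : Omega `&` snd @^-1` (`]b, +oo[%classic : set RR) =
      [set x : RR * RR | 0 < Num.min (1 - euclid2 x) (x.2 - b)].
    rewrite -OE; apply/seteqP; split => x /=; rewrite in_itv/= andbT lt_min !subr_gt0.
      by move=> [-> ->].
    by move=> /andP[].
  apply: (L2_approx_dynkin m1 raysE raysI) => //.
  - by rewrite -OE; apply: L2_approx_rays.
  - move=> _ [a ->]; rewrite E; apply: L2_approx_rays => //.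
    + by apply: measurable_minr => //; mfun.
    + move=> x y; have := lE x y; have := l2 x y; rewrite !mul1r !ler_norml => /andP[h1 h2] /andP[h3 h4].
      by rewrite /Num.min; case: ltP => ?; case: ltP => ?; apply/andP; split; lra.
    + by move=> x; rewrite ge_min lexx.
have -> : Omega `&` A `*` B = (Omega `&` fst @^-1` A) `&` snd @^-1` B.
  by apply/seteqP; split => [x [h [h1 h2]]|x [[h h1] h2]].
have s3 : measurable ((Omega : set (RR * RR)) `&` fst @^-1` A).
  apply: measurableI => //.
  by have := m1 measurableT A mA; rewrite setTI.
apply: (L2_approx_dynkin m2 raysE raysI) => //.
by move=> _ [b ->]; rewrite setIAC.
Qed.

Lemma L2_approx_indic C : measurable C -> C `<=` Omega -> L2_approx (\1_C : RR * RR -> R).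
Proof.
move=> mC CO.
have -> : C = Omega `&` id @^-1` C by apply/seteqP; split => x //=; [split => //; exact: CO|case].
apply: (@L2_approx_dynkin _ _ _ [set A `*` B | A in measurable & B in measurable] id) => //.
- exact: measurable_prod_measurableType.
- move=> _ _ [A1 mA1 [A2 mA2 <-]] [B1 mB1 [B2 mB2 <-]].
  exists (A1 `&` B1); first exact: measurableI.
  by exists (A2 `&` B2); [exact: measurableI|rewrite setXI].
- exact: measurable_Omega.
- by move=> _ [A mA [B mB <-]]; exact: L2_approx_rect.
Qed.

Let aprx0 : L2_approx (fun=> 0 : R).
Proof.
have := L2_approx_comb (-1) aO aO.
by congr L2_approx; apply/funext => x /=; ring.
Qed.

Import HBNNSimple.

Lemma L2_approx_ge0 f : measurable_fun setT (f : RR * RR -> RR) -> (forall x, 0 <= f x) ->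
  (forall x, f x != 0 -> Omega x) -> (\int[leb2]_x (f x ^+ 2)%:E < +oo)%E -> L2_approx f.
Proof.
move=> mf f0 fO fi.
have mf' : measurable_fun setT (EFin \o f : RR * RR -> \bar R) by exact/measurable_EFinP.
pose s := nnsfun_approx measurableT mf'.
have cs x : s n x @[n --> \oo] --> f x.
  have := @cvg_nnsfun_approx _ _ _ _ measurableT _ mf' (fun x _ => f0 x) x I.
  by move=> /fine_cvgP[_].
have sf n x : s n x <= f x.
  have nd : nondecreasing_seq (fun n => s n x).
    by move=> i j ij; have /lefP := nd_nnsfun_approx measurableT mf' ij; exact.
  have := nondecreasing_cvgn_le nd (cvgP _ (cs x)) n.
  by rewrite (cvg_lim _ (cs x)).
have s0 n x : 0 <= s n x by exact: fun_ge0.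
apply: (@L2_approx_cvg _ (fun n => s n : RR * RR -> R) _ (fun x => (f x ^+ 2)%:E)) => //.
- move=> n.
  have -> : (s n : RR * RR -> R) = fun x => \sum_(y <- finmap.enum_fset (fset_set (range (s n)))) (y * \1_(s n @^-1` [set y]) x).
    apply/funext => x; rewrite [LHS]fimfunE fsbig_finite//; exact: fimfunP.
  elim: (finmap.enum_fset _) => [|y r IH].
    by have := aprx0; congr L2_approx; apply/funext => x; rewrite big_nil.
  (* The level set of the value 0 need not lie in [Omega], but it contributes nothing; all others
     do, since the simple functions are below [f]. *)
  have [y0|y0] := eqVneq y 0.
    by have := IH; congr L2_approx; apply/funext => x; rewrite big_cons y0 mul0r add0r//.
  have a1 : L2_approx (\1_(s n @^-1` [set y]) : RR * RR -> R).
    apply: L2_approx_indic; first exact: measurable_sfunP.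
    move=> x /= sy; apply: fO; rewrite gt_eqF//; apply: lt_le_trans (sf n x).
    by rewrite sy lt_neqAle eq_sym y0 -sy s0.
  have := L2_approx_comb y IH a1; congr L2_approx.
  by apply/funext => x; rewrite big_cons addrC.
- apply/integrableP; split; first by mfun.
  by under eq_integral do rewrite gee0_abs ?lee_fin ?sqr_ge0//.
- move=> n x; rewrite lee_fin ler_sqr ?nnegrE ?subr_ge0//.
  by rewrite lerBlDr lerDl.
Qed.

Lemma L2_dense f : measurable_fun setT (f : RR * RR -> RR) ->
  (forall x, f x != 0 -> Omega x) -> (\int[leb2]_x (f x ^+ 2)%:E < +oo)%E -> L2_approx f.
Proof.
move=> mf fO fi.
have part (g : RR * RR -> R) : measurable_fun setT (g : RR * RR -> RR) ->
    (forall x, 0 <= g x <= `|f x|) -> L2_approx g.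
  move=> mg hg; apply: L2_approx_ge0 => //.
  - by move=> x; have /andP[] := hg x.
  - move=> x; have /andP[g0 gf] := hg x => gn; apply: fO; rewrite -normr_gt0.
    by apply: lt_le_trans gf; rewrite lt_neqAle eq_sym gn.
  - apply: le_lt_trans fi; apply: ge0_int_le; [by mfun|by mfun|by move=> x; rewrite lee_fin sqr_ge0|].
    move=> x; have /andP[g0 gf] := hg x; rewrite lee_fin -[f x ^+ 2]real_normK ?num_real//.
    by rewrite ler_sqr ?nnegrE.
have -> : f = fun x => Num.max 0 (f x) + -1 * Num.max 0 (- f x).
  apply/funext => x; rewrite /Num.max; case: ltP => ?; case: ltP => ?; lra.
apply: L2_approx_comb; apply: part.
- by apply: measurable_maxr => //; exact: measurable_cst.
- by move=> x; rewrite le_max lexx ge_max normr_ge0 ler_norm.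
- by apply: measurable_maxr; [exact: measurable_cst|mfun].
- by move=> x; rewrite le_max lexx ge_max normr_ge0 -normrN ler_norm.
Qed.

End density_functions.

(** * Restricted measures, L^2 norms and operator distances *)

Lemma ge0_integral_mrestr d (T : measurableType d) (R : realType)
    (m : {measure set T -> \bar R}) (D : set T) (mD : measurable D) (f : T -> \bar R) :
  measurable_fun setT f -> (forall x, 0 <= f x)%E ->
  (\int[mrestr m mD]_x f x = \int[m]_(x in D) f x)%E.
Proof.
move=> mf f0.
have mDC : measurable (~` D) by exact: measurableC.
rewrite (ge0_negligible_integral (mu := mrestr m mD) (N := ~` D))//; last first.
  by change (m (~` D `&` D) = 0%E); rewrite setICl measure0.
rewrite setTD setCK; apply: eq_measure_integral => A mA AD.
by change (m (A `&` D) = m A); rewrite setIidl.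
Qed.

Lemma Lfun2_sqr d (T : measurableType d) (R : realType) (m : {measure set T -> \bar R}) (u : T -> R) :
  measurable_fun setT u -> (\int[m]_x (u x ^+ 2)%:E < +oo)%E -> u \in Lfun m 2%:E.
Proof.
move=> mu' fi; rewrite inE; apply/andP; split; rewrite inE//=.
rewrite /finite_norm unlock poweR_lty//.
rewrite (eq_integral (fun x => (u x ^+ 2)%:E))// => x _ /=.
by rewrite powR_mulrn// real_normK ?num_real.
Qed.

Section L2_norm.
Context d (T : measurableType d) (R : realType) (mu : {measure set T -> \bar R}).
Implicit Types f g h : L2 mu.

Lemma L2_meas f : measurable_fun setT (f : T -> R).
Proof. by []. Qed.

Definition L2n f : R := fine (L2norm f).

Lemma L2normE f : L2norm f = (L2n f)%:E.
Proof. by rewrite /L2n /L2norm; exact/esym/finite_norm_fine. Qed.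

Lemma L2n_ge0 f : 0 <= L2n f.
Proof. by rewrite fine_ge0 ?Lnorm_ge0. Qed.

Lemma L2n_sqr f : ((L2n f ^+ 2)%:E = \int[mu]_x (f x ^+ 2)%:E)%E.
Proof.
have n2 : (2 : R) != 0 by rewrite pnatr_eq0.
have := @poweR_Lnorm _ _ _ mu (EFin \o f) 2 n2.
rewrite -/(L2norm f) L2normE poweR_EFin powR_mulrn ?L2n_ge0// => ->.
apply: eq_integral => x _; rewrite /= powR_mulrn//.
by rewrite real_normK ?num_real.
Qed.

Lemma L2nD f g : L2n (f + g) <= L2n f + L2n g.
Proof. exact: ler_LnormD. Qed.

Lemma L2nN f : L2n (- f) = L2n f.
Proof. exact: LnormrN. Qed.

Lemma L2n0 : L2n 0 = 0.
Proof.
apply/eqP; rewrite -sqrf_eq0; apply/eqP/EFin_inj; rewrite L2n_sqr.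
by rewrite integral0_eq// => x _; rewrite expr0n.
Qed.

Lemma L2n_ae f g : f = g %[ae mu] -> L2n f = L2n g.
Proof.
move=> fg; apply/eqP; rewrite -(eqrXn2 (n := 2))// ?L2n_ge0//; apply/eqP/EFin_inj.
rewrite !L2n_sqr; apply: ge0_ae_eq_integral => //.
- by apply/measurable_EFinP; exact: measurable_funX.
- by apply/measurable_EFinP; exact: measurable_funX.
- by move=> x _; rewrite lee_fin sqr_ge0.
- by move=> x _; rewrite lee_fin sqr_ge0.
- by apply: filterS fg => x /= fg /fg ->.
Qed.

Lemma L2_mul_integrable f g : mu.-integrable setT (EFin \o (fun x => f x * g x)).
Proof. by apply/Lfun1_integrable/Lfun2_mul_Lfun1; exact: LfunP. Qed.

Lemma L2inner_le f g : L2inner f g <= L2n f * L2n g.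
Proof.
apply: le_trans (ler_norm _) _.
apply: le_trans (le_normr_Rintegral measurableT (L2_mul_integrable f g)) _.
have H := @hoelder _ _ _ mu f g 2 2.
have mf : measurable_fun setT (f : T -> R) by [].
have mg : measurable_fun setT (g : T -> R) by [].
have h2 : (2^-1 + 2^-1 = 1 :> R) by lra.
have {}H := H mf mg (ltr0Sn _ _) (ltr0Sn _ _) h2.
rewrite -lee_fin EFinM -!L2normE; apply: le_trans H; rewrite Lnorm1 /Rintegral fineK//.
apply: integrable_fin_num => //.
exact: (integrable_norm (L2_mul_integrable f g)).
Qed.

Lemma L2innerBr f g h : L2inner f (g - h) = L2inner f g - L2inner f h.
Proof.
rewrite /L2inner -RintegralB//; try exact: L2_mul_integrable.
by apply: eq_Rintegral => x _ /=; rewrite -mulrBr.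
Qed.

Lemma L2innerBl f g h : L2inner (f - g) h = L2inner f h - L2inner g h.
Proof.
rewrite /L2inner -RintegralB//; try exact: L2_mul_integrable.
by apply: eq_Rintegral => x _ /=; rewrite -mulrBl.
Qed.

Lemma L2inner_sqr f : L2inner f f = L2n f ^+ 2.
Proof.
by rewrite /L2inner /Rintegral -[RHS]/(fine (_%:E)) L2n_sqr.
Qed.

End L2_norm.

Section L2_operator_bounds.
Context d1 d2 (T1 : measurableType d1) (T2 : measurableType d2) (R : realType).
Variables (mu : {measure set T1 -> \bar R}) (nu : {measure set T2 -> \bar R}).

Lemma opdist_le (A B : L2 mu -> L2 nu) (E : R) : 0 <= E ->
  (forall f, L2n (A f - B f) <= E * L2n f) -> (opdist A B <= E%:E)%E.
Proof.
move=> E0 H; apply: ge_ereal_sup => _ [f /= f1 <-].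
rewrite L2normE lee_fin in f1; rewrite L2normE lee_fin.
by apply: le_trans (H f) _; rewrite ler_piMr.
Qed.

Lemma opdist_ge0 (A B : L2 mu -> L2 nu) : (0 <= opdist A B)%E.
Proof.
apply: (@le_trans _ _ (L2norm (A 0 - B 0))); first by rewrite L2normE lee_fin L2n_ge0.
by apply: ereal_sup_ubound; exists 0 => //=; rewrite L2normE L2n0 lee_fin.
Qed.

Lemma adjoint_diff_le (A B : L2 mu -> L2 nu) (A' B' : L2 nu -> L2 mu) (E : R) :
  0 <= E -> is_adjoint A A' -> is_adjoint B B' ->
  (forall f, L2n (A f - B f) <= E * L2n f) ->
  forall g, L2n (A' g - B' g) <= E * L2n g.
Proof.
move=> E0 hA hB H g; set h := A' g - B' g.
have h0 := L2n_ge0 h; have g0 := L2n_ge0 g.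
have sq : L2n h ^+ 2 <= E * L2n h * L2n g.
  rewrite -L2inner_sqr {2}/h L2innerBr -hA -hB -L2innerBl.
  by apply: le_trans (L2inner_le _ _) _; apply: ler_wpM2r.
(* The estimate for [h] is quadratic, so a factor [L2n h] is cancelled when it is positive. *)
have [hz|hp] := leP (L2n h) 0; last first.
  by rewrite -(ler_pM2l hp) -expr2; apply: le_trans sq _; rewrite mulrCA mulrA.
by apply: le_trans hz _; exact: mulr_ge0.
Qed.

(* [A] is only known on a dense set, so the estimate is transported by density. *)
Lemma L2n_diff_dense (A B : L2 mu -> L2 nu) (CA CB E : R) :
  0 <= CA -> 0 <= CB -> 0 <= E -> L2linear A ->
  (forall f, L2n (A f) <= CA * L2n f) ->
  (forall f g, L2n (B f - B g) <= CB * L2n (f - g)) ->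
  (forall f (d : R), 0 < d -> exists2 g, L2n (f - g) <= d & L2n (A g - B g) <= E * L2n g) ->
  forall f, L2n (A f - B f) <= E * L2n f.
Proof.
move=> CA0 CB0 E0 lA bA bB dns f.
have step d : 0 < d -> L2n (A f - B f) <= E * L2n f + (CA + E + CB) * d.
  move=> d0; have [g fg Eg] := dns f d d0.
  have g1 : L2n g <= L2n f + d.
    have -> : g = f - (f - g) by rewrite opprB addrC subrK.
    by apply: le_trans (L2nD _ _) _; rewrite L2nN lerD2l.
  (* Linearity is an identity almost everywhere, not of representatives, so the splitting of [A f]
     leaves a remainder of norm zero. *)
  have F0 : L2n (A f - (A (f - g) + A g)) = 0.
    rewrite -(L2n0 nu); apply: L2n_ae.
    have := lA 1 (f - g) g; rewrite scale1r subrK; apply: filterS => y /= /(_ I).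
    rewrite scale1r => h2 _.
    by change ((A f) y - (A (f - g) y + A g y) = 0); rewrite h2 subrr.
  have -> : A f - B f = (A f - (A (f - g) + A g)) + (A (f - g) + ((A g - B g) + (B g - B f))).
    by rewrite (addrA (A g - _)) subrK (addrA (A (f - g))) addrA subrK.
  apply: le_trans (L2nD _ _) _; rewrite F0 add0r; apply: le_trans (L2nD _ _) _.
  have fg' : L2n (g - f) <= d by rewrite -L2nN opprB.
  have h1 := le_trans (bA (f - g)) (ler_wpM2l CA0 fg).
  have h2 := le_trans (bB g f) (ler_wpM2l CB0 fg').
  have h3 := le_trans Eg (ler_wpM2l E0 g1).
  apply: le_trans (lerD h1 (le_trans (L2nD _ _) (lerD h3 h2))) _.
  by move: (L2n f) => t; rewrite mulrDr !mulrDl; lra.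
have c0 : 0 < CA + E + CB + 1 by rewrite ltr_wpDl// !addr_ge0.
apply/ler_addgt0Pr => eps eps0.
apply: le_trans (step (eps / (CA + E + CB + 1)) (divr_gt0 eps0 c0)) _.
by rewrite lerD2l mulrA ler_pdivrMr// mulrC ler_pM2l// lerDl.
Qed.

End L2_operator_bounds.

(** * Operator norm estimate *)

Section signed_functions.
Context {R : realType}.
Variables (RE RD : R).
Hypotheses (hRE : 1 < RE) (hRD : 0 < RD).
Variable (D : discretization R).
Hypothesis (hD : admissible RE D).
Local Notation mu := (@lebesgue_measure R).
Local Notation RR := (measurableTypeR R).
Implicit Types (f g h u : RR * RR -> R) (x y : RR * RR).

Record sq_fun f : Prop := SqFun {
  sq_meas : measurable_fun setT (f : RR * RR -> RR);
  sq_supp : forall x, f x != 0 -> Omega x;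
  sq_fin : (sqr_int f < +oo)%E }.

Let mOm := @measurable_Omega R.
Let mI1 : measurable_fun setT (\1_Omega : RR * RR -> R).
Proof. exact: measurable_indic. Qed.

Lemma sqr_int_ge0 f : (0 <= sqr_int f)%E.
Proof. by apply: integral_ge0 => x _; rewrite lee_fin sqr_ge0. Qed.

Lemma sq_restrict f : sq_fun f -> f \_ Omega = f.
Proof.
move=> sf; apply/funext => x; rewrite patchE; case: ifPn => // /negP xO.
by apply/esym/eqP; apply: contra_notT xO => /(sq_supp sf) Ox; rewrite inE.
Qed.

Lemma sq_integrable f : sq_fun f -> leb2.-integrable setT (EFin \o f : RR * RR -> \bar R).
Proof.
move=> sf; have mf := sq_meas sf.
apply/integrableP; split; first exact/measurable_EFinP.
apply: (@le_lt_trans _ _ (\int[leb2]_x ((\1_Omega x)%:E + (f x ^+ 2)%:E))%E).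
  apply: ge0_int_le.
  - by apply/measurableT_comp => //; exact/measurable_EFinP.
  - by apply: emeasurable_funD; [exact/measurable_EFinP|mfun].
  - by move=> x; exact: abse_ge0.
  - move=> x /=; rewrite -EFinD lee_fin indicE.
    have [f0|/(sq_supp sf) Ox] := eqVneq (f x) 0; first by rewrite f0 normr0 addr_ge0 ?sqr_ge0.
    rewrite mem_set//= -[f x ^+ 2]real_normK ?num_real//.
    by have := sqr_ge0 (`|f x| - 1); have := normr_ge0 (f x); nra.
rewrite ge0_int_add; [|exact/measurable_EFinP|by mfun|by move=> x; rewrite lee_fin|by move=> x; rewrite lee_fin sqr_ge0].
apply: lte_add_pinfty; last exact: sq_fin.
by rewrite integral_indic ?setIT//; exact: leb2_Omega.
Qed.

(** The Cauchy-Schwarz inequality with the indicator of the square [[-1, 1] x [-1, 1]] as weight. It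
    contains [Omega] and, unlike the disc, its area 4 is read off from the product measure. *)
Lemma sq_int_norm f : sq_fun f ->
  exists m : R, [/\ 0 <= m, (\int[leb2]_x `|f x|%:E = m%:E)%E &
    ((m ^+ 2)%:E <= 4%:E * sqr_int f)%E].
Proof.
move=> sf; have mf := sq_meas sf.
have /integrableP[_ fi] := sq_integrable sf.
have i0 : (0 <= \int[leb2]_x `|f x|%:E)%E by apply: integral_ge0 => x _; rewrite lee_fin.
have mE : (\int[leb2]_x `|f x|%:E = (fine (\int[leb2]_x `|f x|%:E))%:E)%E by rewrite fineK// ge0_fin_numE.
have m0 : 0 <= fine (\int[leb2]_x `|f x|%:E)%E by rewrite fine_ge0.
exists (fine (\int[leb2]_x `|f x|%:E)%E); split => //.
pose Q : set (RR * RR) := (`[-1, 1]%classic : set RR) `*` (`[-1, 1]%classic : set RR).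
have mQ : measurable Q by apply: measurableX; exact: measurable_itv.
have Q4 : (\int[leb2]_x (\1_Q x : R)%:E = 4%:E)%E.
  rewrite integral_indic ?setIT//.
  change (leb2 Q = 4%:E).
  have -> : leb2 Q =
      (mu `[(-1)%R, 1%R]%classic * mu `[(-1)%R, 1%R]%classic)%E.
    by rewrite /leb2 /Q product_measure1E; [|exact: measurable_itv|exact: measurable_itv].
  rewrite !lebesgue_measure_itv/= lte_fin; case: ifPn => [_|]; last by rewrite -leNgt => /(le_trans ler01); rewrite oppr_ge0 ler10.
  by rewrite -EFinB -EFinM; congr (_%:E); ring.
have Qf x : \1_Q x * `|f x| = `|f x|.
  have [->|/(sq_supp sf)/OmegaE h] := eqVneq (f x) 0; first by rewrite normr0 mulr0.
  rewrite indicE mem_set ?mul1r// /Q/= !in_itv/=.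
  have s1 := sqr_ge0 x.1; have s2 := sqr_ge0 x.2.
  by split; rewrite -ler_norml -(ler_sqr (normr_ge0 _) ler01) real_normK ?num_real// expr1n; lra.
have mn : measurable_fun setT (fun x : RR * RR => `|f x| : RR) by exact: measurableT_comp.
have mQ1 : measurable_fun setT (\1_Q : RR * RR -> RR) by exact: measurable_indic.
have H := weighted_sqr (mu := leb2) mQ1 mn (fun x => ler0n _ _) (fun x => normr_ge0 _) (ltr0n R 4) m0 Q4.
apply: le_trans (H _) _; first by rewrite -mE; apply: eq_integral => x _; rewrite Qf.
rewrite le_eqVlt; apply/orP; left; apply/eqP; congr (_ * _)%E; apply: eq_integral => x _.
by rewrite expr2 mulrA Qf -expr2 real_normK ?num_real.
Qed.

Lemma fanbeam_discrB f g y :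
  leb2.-integrable setT (EFin \o (f \_ Omega) : RR * RR -> \bar R) ->
  leb2.-integrable setT (EFin \o (g \_ Omega) : RR * RR -> \bar R) ->
  fanbeam_discr_fun RE RD D (fun x => f x - g x) y =
  fanbeam_discr_fun RE RD D f y - fanbeam_discr_fun RE RD D g y.
Proof.
move=> fi gi.
have B i j : \int[leb2]_(z in pixel D i j) ((fun x => f x - g x) \_ Omega) z =
   \int[leb2]_(z in pixel D i j) (f \_ Omega) z - \int[leb2]_(z in pixel D i j) (g \_ Omega) z.
  have mp := measurable_pixel D i j.
  rewrite -RintegralB//; last 2 first.
  - exact: integrableS fi.
  - exact: integrableS gi.
  apply: eq_Rintegral => x _; rewrite !patchE; case: ifP => // _.
  by rewrite subr0.
rewrite /fanbeam_discr_fun -mulrBr; congr (_ * _); rewrite -sumrB; apply: eq_bigr => p _.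
rewrite -sumrB; apply: eq_bigr => q _; rewrite -mulrBr; congr (_ * _); rewrite -sumrB; apply: eq_bigr => i _.
by rewrite -sumrB; apply: eq_bigr => j _; rewrite B -mulrBr -mulrBl.
Qed.

(** A crude bound whose constant depends on the discretization. It serves only as continuity in the
    density argument and does not appear in the final estimate. *)
Lemma fanbeam_discr_bounded : exists2 K : R, 0 <= K & forall u y, sq_fun u ->
  ((fanbeam_discr_fun RE RD D u y ^+ 2)%:E <= K%:E * sqr_int u)%E.
Proof.
pose c p q i j : R :=
  let x := pixel_center D i j in let s := dot_theta_perp x (alpha_ D q) + RE in
  `|w_ (delta_xi RE RD D) (dot_theta x (alpha_ D q) * RD / s - xi_ RE RD D p) / s|.
pose K1 : R := (delta_xi RE RD D ^+ 2)^-1 * \sum_(1 <= p < (nP D).+1) \sum_(1 <= q < (nQ D).+1)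
    Num.sqrt (xi_ RE RD D p ^+ 2 + RD ^+ 2) * \sum_(1 <= i < (nN D).+1)
      \sum_(1 <= j < (nM D).+1 | euclid2 (pixel_center D i j) < RE) c p q i j.
have d20 : 0 <= (delta_xi RE RD D ^+ 2)^-1 by rewrite invr_ge0 sqr_ge0.
exists (K1 ^+ 2 * 4); first by rewrite mulr_ge0 ?sqr_ge0.
move=> u y su; have [m [m0 mE hm]] := sq_int_norm su.
have iu := sq_integrable su; have mu' := sq_meas su.
have P i j : `|\int[leb2]_(z in pixel D i j) (u \_ Omega) z| <= m.
  have mp := measurable_pixel D i j.
  rewrite sq_restrict//.
  have iup : leb2.-integrable (pixel D i j) (EFin \o u : RR * RR -> \bar R) by exact: integrableS iu.
  apply: le_trans (le_normr_Rintegral mp iup) _.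
  rewrite -lee_fin -mE /Rintegral fineK; last by apply: integrable_fin_num => //; exact: integrable_norm iup.
  apply: ge0_subset_integral => //; first by apply/measurable_EFinP; exact: measurableT_comp.
have H : `|fanbeam_discr_fun RE RD D u y| <= K1 * m.
  rewrite /fanbeam_discr_fun /K1 normrM (ger0_norm d20) -[leRHS]mulrA ler_wpM2l//.
  rewrite mulr_suml; apply: le_trans (ler_norm_sum _ _ _) _; apply: ler_sum => p _.
  rewrite mulr_suml; apply: le_trans (ler_norm_sum _ _ _) _; apply: ler_sum => q _.
  rewrite !normrM -[leRHS]mulrA (ger0_norm (sqrtr_ge0 _)).
  have i1 (A : set R) z : 0 <= `|\1_A z : R| <= 1.
    by rewrite normr_ge0 indicE ger0_norm ?ler0n// lern1 leq_b1.
  apply: le_trans (_ : 1 * Num.sqrt (xi_ RE RD D p ^+ 2 + RD ^+ 2) * _ <= _).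
    apply: ler_wpM2r => //; apply: ler_wpM2r => //.
    have /andP[a1 a2] := i1 (Xi_ RE RD D p) y.1; have /andP[b1 b2] := i1 (Phi_ D q) y.2.
    by rewrite mulr_ile1.
  rewrite mul1r ler_wpM2l ?sqrtr_ge0//.
  rewrite mulr_suml; apply: le_trans (ler_norm_sum _ _ _) _; apply: ler_sum => i _.
  rewrite mulr_suml; apply: le_trans (ler_norm_sum _ _ _) _; apply: ler_sum => j _.
  rewrite /c /=; set w := w_ _ _; set s := (_ + RE); set I := \int[_]_(_ in _) _.
  have -> : w * (I / s) = w / s * I by rewrite mulrA mulrAC.
  by rewrite normrM; apply: ler_wpM2l; rewrite ?normr_ge0// /I P.
apply: le_trans (_ : ((K1 * m) ^+ 2)%:E <= _)%E.
  rewrite lee_fin -[leLHS]real_normK ?num_real// ler_sqr ?nnegrE//.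
  exact: le_trans (normr_ge0 _) H.
by rewrite exprMn (EFinM (K1 ^+ 2)) (EFinM (K1 ^+ 2) 4) -muleA; apply: lee_wpmul2l; rewrite ?lee_fin ?sqr_ge0.
Qed.

End signed_functions.

Section signed_lipschitz.
Context {R : realType}.
Variables (RE RD : R).
Hypotheses (hRE : 1 < RE) (hRD : 0 < RD).
Variable (D : discretization R).
Hypothesis (hD : admissible RE D).
Local Notation mu := (@lebesgue_measure R).
Local Notation RR := (measurableTypeR R).
Implicit Types (f g h u : RR * RR -> R) (x y : RR * RR).

Definition pos_part h x : R := Num.max (h x) 0.

Lemma lip_Omega_supp_Omega h x : lip_Omega h -> h x != 0 -> Omega x.
Proof. by move=> [_ _ [r r1 H]] /H; rewrite /Omega/= => /le_lt_trans; exact. Qed.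

Lemma lip_Omega_opp h : lip_Omega h -> lip_Omega (fun x => - h x).
Proof.
move=> [mh [L L0 hL] [r r1 hr]]; split; first by mfun.
  exists L => // x y; have -> : - h x - - h y = - (h x - h y) by ring.
  by rewrite normrN; exact: hL.
by exists r => // x; rewrite oppr_eq0; exact: hr.
Qed.

Lemma test_pos_part h : lip_Omega h -> test_fun (pos_part h).
Proof.
move=> lh; have [mh [L L0 hL] _] := lh; split.
- by move=> x; rewrite /pos_part le_max lexx orbT.
- by apply: measurable_maxr => //; exact: measurable_cst.
- exists L => // x y; apply: le_trans (hL x y); rewrite /pos_part /Num.max.
  have := ler_norm (h x - h y); have := ler_norm (h y - h x); rewrite (distrC (h y)) ler_norml.
  by case: ltP => ?; case: ltP => ? ? ?; apply/andP; split; lra.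
- move=> x; rewrite /pos_part /Num.max; case: ltP => h0; rewrite ?eqxx//.
  exact: lip_Omega_supp_Omega.
Qed.

Lemma test_sq_fun f : test_fun f -> sq_fun f.
Proof.
move=> tf; have mf := test_meas tf; have [M M0 hM] := test_bounded tf; split => //; first exact: test_supp.
have mI : measurable_fun setT (\1_Omega : RR * RR -> R).
  by apply: measurable_indic; exact: measurable_Omega.
apply: (@le_lt_trans _ _ (\int[leb2]_x ((M ^+ 2)%:E * (\1_Omega x)%:E))%E).
  apply: ge0_int_le.
  - by mfun.
  - by apply: emeasurable_funM => //; exact/measurable_EFinP.
  - by move=> x; rewrite lee_fin sqr_ge0.
  - move=> x; rewrite -EFinM lee_fin indicE.
    have [f0|/(test_supp tf) Ox] := eqVneq (f x) 0.
      by rewrite f0 expr0n/= mulr_ge0 ?sqr_ge0.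
    rewrite mem_set// mulr1; have f0 := test_ge0 tf x; have fM := hM x.
    by rewrite ler_sqr ?nnegrE.
rewrite ge0_int_scale ?sqr_ge0//; last exact/measurable_EFinP.
rewrite integral_indic ?setIT//; last exact: measurable_Omega.
by rewrite lte_mul_pinfty ?lee_fin ?sqr_ge0//; exact: leb2_Omega.
Qed.

Lemma pos_partB h x : h x = pos_part h x - pos_part (fun x => (- h x)%R) x.
Proof. by rewrite /pos_part /Num.max; case: ltP => ?; case: ltP => ?; lra. Qed.

Lemma pos_part_sqr h x : h x ^+ 2 = pos_part h x ^+ 2 + pos_part (fun x => (- h x)%R) x ^+ 2.
Proof. by rewrite /pos_part /Num.max; case: ltP => ?; case: ltP => ?; nra. Qed.

Lemma lip_sq_fun h : lip_Omega h -> sq_fun h.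
Proof.
move=> lh; have [mh _ _] := lh; split => //; first by move=> x; exact: lip_Omega_supp_Omega.
have sp := test_sq_fun (test_pos_part lh).
have sn := test_sq_fun (test_pos_part (lip_Omega_opp lh)).
have mp := sq_meas sp; have mn := sq_meas sn.
rewrite /sqr_int; under eq_integral do rewrite pos_part_sqr EFinD.
rewrite ge0_int_add; [|by mfun|by mfun|by move=> x; rewrite lee_fin sqr_ge0|by move=> x; rewrite lee_fin sqr_ge0].
by apply: lte_add_pinfty; [exact: sq_fin sp|exact: sq_fin sn].
Qed.

Lemma fanbeam_fun_lip h (y : RR * RR) : lip_Omega h ->
  fanbeam_fun RE RD h y = Num.sqrt (y.1 ^+ 2 + RD ^+ 2) *
    (ray_int RE RD (pos_part h) y.1 y.2 - ray_int RE RD (pos_part (fun x => (- h x)%R)) y.1 y.2).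
Proof.
move=> lh; rewrite /fanbeam_fun; congr (_ * _).
rewrite (sq_restrict (lip_sq_fun lh)) /Rintegral integralE.
have -> : (\int[mu]_t ((fun t => (h (fan_ray RE RD y.1 y.2 t))%:E)^\+ t) = (ray_int RE RD (pos_part h) y.1 y.2)%:E)%E.
  rewrite -(ray_intE hRE hRD _ _ (test_pos_part lh)); apply: eq_integral => t _.
  by rewrite funeposE /pos_part EFin_max.
have -> : (\int[mu]_t ((fun t => (h (fan_ray RE RD y.1 y.2 t))%:E)^\- t) = (ray_int RE RD (pos_part (fun x => (- h x)%R)) y.1 y.2)%:E)%E.
  rewrite -(ray_intE hRE hRD _ _ (test_pos_part (lip_Omega_opp lh))); apply: eq_integral => t _.
  by rewrite funenegE /pos_part EFin_max EFinN.
by rewrite -EFinB.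
Qed.

Lemma measurable_fanbeam_fun h : lip_Omega h -> measurable_fun setT (fanbeam_fun RE RD h : RR * RR -> RR).
Proof.
move=> lh.
have mp := measurable_ray_int RE RD (test_pos_part lh).
have mn := measurable_ray_int RE RD (test_pos_part (lip_Omega_opp lh)).
have -> : fanbeam_fun RE RD h = fun y => Num.sqrt (y.1 ^+ 2 + RD ^+ 2) *
    (ray_int RE RD (pos_part h) y.1 y.2 - ray_int RE RD (pos_part (fun x => (- h x)%R)) y.1 y.2).
  by apply/funext => y; exact: fanbeam_fun_lip.
by mfun.
Qed.

(** Positive and negative parts have disjoint supports, so their squared norms add up exactly; the
    factor 2 comes from the square of the difference of the two errors. *)
Lemma fanbeam_error h (e : R) : 0 < e < 2^-1 -> lip_Omega h ->
  (\int[leb2]_(y in Omega' RE RD) ((fanbeam_fun RE RD h y - fanbeam_discr_fun RE RD D h y) ^+ 2)%:E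
    <= (2 * sqr_error_cst RE RD D e)%:E * sqr_int h)%E.
Proof.
move=> he lh.
have tp := test_pos_part lh; have tn := test_pos_part (lip_Omega_opp lh).
have sp := test_sq_fun tp; have sn := test_sq_fun tn.
have mp := measurable_fan_diff RE RD D tp; have mn := measurable_fan_diff RE RD D tn.
have mO : measurable_fun setT (\1_(Omega' RE RD) : RR * RR -> R).
  by apply: measurable_indic; exact: measurable_Omega'.
have Ep := fan_diff_sqr hRE hRD hD he tp (sq_fin sp).
have En := fan_diff_sqr hRE hRD hD he tn (sq_fin sn).
have mhp := sq_meas sp; have mhn := sq_meas sn.
have dE (y : RR * RR) : fanbeam_fun RE RD h y - fanbeam_discr_fun RE RD D h y =
   fan_diff RE RD D (pos_part h) y - fan_diff RE RD D (pos_part (fun x => (- h x)%R)) y.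
  rewrite fanbeam_fun_lip// /fan_diff.
  have -> : fanbeam_discr_fun RE RD D h y = fanbeam_discr_fun RE RD D (pos_part h) y -
      fanbeam_discr_fun RE RD D (pos_part (fun x => (- h x)%R)) y.
    rewrite -fanbeam_discrB; last 2 first.
    - by rewrite sq_restrict//; exact: sq_integrable.
    - by rewrite sq_restrict//; exact: sq_integrable.
    by congr fanbeam_discr_fun; apply/funext => x; exact: pos_partB.
  by ring.
have c0 := sqr_error_cst_ge0 hRE hRD D e.
have SE : sqr_int h = (sqr_int (pos_part h) + sqr_int (pos_part (fun x => (- h x)%R)))%E.
  rewrite /sqr_int -ge0_int_add; [|by mfun|by mfun|by move=> x; rewrite lee_fin sqr_ge0|by move=> x; rewrite lee_fin sqr_ge0].
  by apply: eq_integral => x _; rewrite -EFinD -pos_part_sqr.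
have mF : measurable_fun setT (fanbeam_discr_fun RE RD D h : RR * RR -> RR).
  by have := fanbeam_discr_Lfun RE RD D h; rewrite inE => /andP[]; rewrite inE.
rewrite integral_mkcond.
apply: le_trans (_ : 2%:E * \int[leb2]_y (\1_(Omega' RE RD) y * fan_diff RE RD D (pos_part h) y ^+ 2)%:E +
   2%:E * \int[leb2]_y (\1_(Omega' RE RD) y * fan_diff RE RD D (pos_part (fun x => (- h x)%R)) y ^+ 2)%:E <= _)%E.
  have nn u (y : RR * RR) : (0 <= (\1_(Omega' RE RD) y * fan_diff RE RD D u y ^+ 2)%:E)%E.
    by rewrite lee_fin mulr_ge0 ?sqr_ge0.
  have nn2 u (y : RR * RR) : (0 <= 2%:E * (\1_(Omega' RE RD) y * fan_diff RE RD D u y ^+ 2)%:E)%E.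
    by rewrite mule_ge0 ?nn// lee_fin.
  have m2 u : measurable_fun setT (fan_diff RE RD D u : RR * RR -> RR) ->
     measurable_fun setT (fun y : RR * RR => 2%:E * (\1_(Omega' RE RD) y * fan_diff RE RD D u y ^+ 2)%:E)%E.
    by move=> m; apply: emeasurable_funM; mfun.
  have E2 u : measurable_fun setT (fan_diff RE RD D u : RR * RR -> RR) ->
     (\int[leb2]_y (2%:E * (\1_(Omega' RE RD) y * fan_diff RE RD D u y ^+ 2)%:E) =
     2%:E * \int[leb2]_y (\1_(Omega' RE RD) y * fan_diff RE RD D u y ^+ 2)%:E)%E.
    move=> m.
    have m1 : measurable_fun setT (fun y : RR * RR => (\1_(Omega' RE RD) y * fan_diff RE RD D u y ^+ 2)%:E) by mfun.
    exact: (ge0_int_scale leb2 (ler0n R 2) m1 (nn u)).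
  rewrite [leRHS](_ : _ = \int[leb2]_y (2%:E * (\1_(Omega' RE RD) y * fan_diff RE RD D (pos_part h) y ^+ 2)%:E) +
    \int[leb2]_y (2%:E * (\1_(Omega' RE RD) y * fan_diff RE RD D (pos_part (fun x => (- h x)%R)) y ^+ 2)%:E))%E; last first.
    by congr (_ + _)%E; [rewrite (E2 _ mp)|rewrite (E2 _ mn)].
  rewrite -ge0_int_add; [|exact: m2|exact: m2|exact: nn2|exact: nn2].
  apply: ge0_int_le.
  - have mdd : measurable_fun (Omega' RE RD)
      (fun y : RR * RR => ((fanbeam_fun RE RD h y - fanbeam_discr_fun RE RD D h y) ^+ 2)%:E).
      by apply: measurable_funTS; have m1 := measurable_fanbeam_fun lh; mfun.
    by apply/(measurable_restrictT _ (measurable_Omega' RE RD)).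
  - by apply: emeasurable_funD; exact: m2.
  - by move=> y; rewrite patchE; case: ifP => // _; rewrite lee_fin sqr_ge0.
  - move=> y; rewrite patchE; case: ifPn => h1; last by rewrite adde_ge0.
    rewrite -!EFinM -EFinD lee_fin dE indicE h1 !mul1r.
    set a := fan_diff _ _ _ _ _; set b := fan_diff _ _ _ _ _.
    by have := sqr_ge0 (a + b); nra.
have two : (0 <= (2 : R)%:E)%E by rewrite lee_fin.
apply: le_trans (leeD (lee_wpmul2l two Ep) (lee_wpmul2l two En)) _.
have key (r : R) (a b s : \bar R) : (0 <= a)%E -> (0 <= b)%E -> s = (a + b)%E ->
    (2%:E * (r%:E * a) + 2%:E * (r%:E * b) <= (2 * r)%:E * s)%E.
  by move=> a0 b0 ->; rewrite ge0_muleDr// EFinM !muleA.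
by apply: key; rewrite ?SE//; exact: sqr_int_ge0.
Qed.

End signed_lipschitz.

(** * From Lipschitz functions to all of L^2 *)

Section operator_error.
Context {R : realType}.
Variables (RE RD : R).
Hypotheses (hRE : 1 < RE) (hRD : 0 < RD).
Local Notation mu := (@lebesgue_measure R).
Local Notation RR := (measurableTypeR R).
Implicit Types (f g : L2Omega R) (h : RR * RR -> R) (x y : RR * RR).

Lemma lip2_continuous (L : R) h : 0 <= L -> lip2 L h -> continuous (h : R * R -> R).
Proof.
move=> L0 hL x; apply/cvgrPdist_lt => e e0.
have d0 : 0 < e / (2 * L + 1) by rewrite divr_gt0// ltr_wpDl ?mulr_ge0.
near=> y.
have [y1 y2] : ball x (e / (2 * L + 1)) y by near: y; exact: (nbhsx_ballx x _ d0).
move: y1 y2; rewrite -!ball_normE /= => y1 y2.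
apply: le_lt_trans (hL x y) _.
have l1 : 0 < 2 * L + 1 by rewrite ltr_wpDl ?mulr_ge0.
move: y1 y2; rewrite !ltr_pdivlMr// => y1 y2.
have n1 := normr_ge0 (x.1 - y.1); have n2 := normr_ge0 (x.2 - y.2).
by move: (`|x.1 - y.1|) (`|x.2 - y.2|) y1 y2 n1 n2 => a b; nra.
Unshelve. all: by end_near. Qed.

Lemma lip_Omega_Cc h : lip_Omega h -> Cc_Omega h.
Proof.
move=> [mh [L L0 hL] [r r1 hr]]; split; first exact: lip2_continuous hL.
move=> x cx; rewrite /Omega/=; apply: le_lt_trans r1.
have cE : continuous (@euclid2 R) by apply: (lip2_continuous ler01); exact: euclid2_lip.
have cl : closed [set x : R * R | euclid2 x <= r].
  by have := closed_comp (fun x _ => cE x) (@closed_le R r); exact.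
have := closure_subset (A := [set x : R * R | h x != 0]) (B := [set x : R * R | euclid2 x <= r]) hr.
by move=> /(_ x cx); rewrite -(closure_id _).1.
Qed.

Lemma sqr_int_restrict f : (sqr_int (f \_ Omega) = (L2n f ^+ 2)%:E)%E.
Proof.
have mf : measurable_fun setT (f : RR * RR -> RR) by exact: L2_meas.
rewrite L2n_sqr ge0_integral_mrestr; last 2 first.
- by mfun.
- by move=> x; rewrite lee_fin sqr_ge0.
rewrite integral_mkcond /sqr_int; apply: eq_integral => x _.
by rewrite !patchE; case: ifP => // _; rewrite expr0n.
Qed.

(** A representative is arbitrary outside [Omega], where its measure does not see it. Extension by
    zero makes it square integrable for the planar measure. *)
Lemma L2Omega_sq_fun f : sq_fun (f \_ Omega).
Proof.
have mf : measurable_fun setT (f : RR * RR -> RR) by exact: L2_meas.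
split.
- by apply/(measurable_restrictT _ measurable_Omega)/measurable_funTS.
- by move=> x; rewrite patchE; case: ifPn => [xO _|]; [rewrite inE in xO|rewrite eqxx].
- by rewrite sqr_int_restrict ltry.
Qed.

Lemma L2Omega'_sqr (u : L2Omega' RE RD) :
  ((L2n u ^+ 2)%:E = \int[leb2]_(y in Omega' RE RD) (u y ^+ 2)%:E)%E.
Proof.
have mf : measurable_fun setT (u : RR * RR -> RR) by exact: L2_meas.
rewrite L2n_sqr ge0_integral_mrestr; [by []|by mfun|].
by move=> x; rewrite lee_fin sqr_ge0.
Qed.

Lemma lip_Omega_L2 h : lip_Omega h -> exists f, f = h :> (RR * RR -> R).
Proof.
move=> lh; have [mh _ _] := lh.
have H : h \in Lfun (@mu_Omega R) 2%:E.
  apply: Lfun2_sqr => //; rewrite ge0_integral_mrestr; [|by mfun|by move=> x; rewrite lee_fin sqr_ge0].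
  apply: le_lt_trans (sq_fin (lip_sq_fun lh)).
  apply: ge0_subset_integral => //; first exact: measurable_Omega.
    by mfun.
  by move=> x _; rewrite lee_fin sqr_ge0.
by exists (Lfun_Sub (lee1n 2) H).
Qed.

Lemma leb2_Omega'_fin : (leb2 (Omega' RE RD) < +oo)%E.
Proof.
have -> : leb2 (Omega' RE RD) = (mu (`](- (detector_width RE RD / 2))%R, (detector_width RE RD / 2)%R[%classic)
   * mu (`[(- pi)%R, pi[%classic))%E.
  by rewrite /leb2 /Omega' product_measure1E; [|exact: measurable_itv|exact: measurable_itv].
rewrite !lebesgue_measure_itv/=.
by case: ifP => _; case: ifP => _; rewrite ?mul0e ?mule0 // -!EFinB -EFinM ltry.
Qed.

Variable (D : discretization R).
Hypothesis (hD : admissible RE D).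

(** A pointwise bound of the discrete transform, integrated over the finite measure of [Omega']. *)
Lemma L2n_discr_lip : exists2 K : R, 0 <= K & forall f g,
  L2n (fanbeam_discr RE RD D f - fanbeam_discr RE RD D g) <= K * L2n (f - g).
Proof.
have [K K0 hK] := fanbeam_discr_bounded RE RD D.
have l0 : 0 <= fine (leb2 (Omega' RE RD)) by rewrite fine_ge0.
exists (Num.sqrt (K * fine (leb2 (Omega' RE RD)))) => [|f g]; first exact: sqrtr_ge0.
rewrite -(ger0_norm (L2n_ge0 (f - g))) -sqrtr_sqr -sqrtrM ?mulr_ge0//.
rewrite -[leLHS](ger0_norm (L2n_ge0 _)) -[leLHS]sqrtr_sqr ler_wsqrtr//.
rewrite -lee_fin L2Omega'_sqr.
have sq := L2Omega_sq_fun (f - g); have sf := L2Omega_sq_fun f; have sg := L2Omega_sq_fun g.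
have E : (f - g) \_ Omega = fun x => (f \_ Omega) x - (g \_ Omega) x.
  by apply: boolp.funext => x; rewrite !patchE; case: ifP => // _; rewrite subr0.
have dE y : (fanbeam_discr RE RD D f - fanbeam_discr RE RD D g) y =
    fanbeam_discr_fun RE RD D ((f - g) \_ Omega) y.
  rewrite E fanbeam_discrB ?(sq_restrict sf) ?(sq_restrict sg); try exact: sq_integrable.
  by rewrite /fanbeam_discr_fun ?(sq_restrict sf) ?(sq_restrict sg).
apply: le_trans (_ : \int[leb2]_(y in Omega' RE RD) (cst (K * L2n (f - g) ^+ 2)%:E y) <= _)%E.
  apply: ge0_le_integral => //.
  - exact: measurable_Omega'.
  - by move=> y _; rewrite lee_fin sqr_ge0.
  - apply: measurable_funTS.
    have m : measurable_fun setT ((fanbeam_discr RE RD D f - fanbeam_discr RE RD D g : L2Omega' RE RD) : RR * RR -> RR) by exact: L2_meas.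
    by mfun.
  - by move=> y _; rewrite dE (EFinM K) -sqr_int_restrict; apply: hK.
rewrite integral_cst; last exact: measurable_Omega'.
have V : leb2 (Omega' RE RD) = (fine (leb2 (Omega' RE RD)))%:E.
  by rewrite fineK// ge0_fin_numE ?leb2_Omega'_fin.
change ((K * L2n (f - g) ^+ 2)%:E * leb2 (Omega' RE RD) <=
  (K * fine (leb2 (Omega' RE RD)) * L2n (f - g) ^+ 2)%:E)%E.
by rewrite {1}V -EFinM lee_fin mulrAC.
Qed.

Lemma operator_error_lip (F : L2Omega R -> L2Omega' RE RD) (e : R) (g : L2Omega R) :
  is_fanbeam F -> 0 < e < 2^-1 -> lip_Omega g ->
  L2n (F g - fanbeam_discr RE RD D g) <= Num.sqrt (2 * sqr_error_cst RE RD D e) * L2n g.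
Proof.
move=> [_ _ FE] he lg; set E := Num.sqrt _.
have s0 := sqr_error_cst_ge0 hRE hRD D e.
have E0 : 0 <= E by exact: sqrtr_ge0.
rewrite -(ler_sqr (L2n_ge0 _) (mulr_ge0 E0 (L2n_ge0 _))) exprMn /E sqr_sqrtr ?mulr_ge0//.
have S : ((L2n g ^+ 2)%:E = sqr_int g)%E by rewrite -sqr_int_restrict (sq_restrict (lip_sq_fun lg)).
rewrite -lee_fin [leRHS]EFinM S.
apply: le_trans (fanbeam_error hRE hRD hD he lg).
have mFh := measurable_fanbeam_fun hRE hRD lg.
have mDh : measurable_fun setT (fanbeam_discr_fun RE RD D g : RR * RR -> RR).
  by have := fanbeam_discr_Lfun RE RD D g; rewrite inE => /andP[]; rewrite inE.
rewrite -(ge0_integral_mrestr leb2 (measurable_Omega' RE RD)); last 2 first.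
- by mfun.
- by move=> y; rewrite lee_fin sqr_ge0.
rewrite L2n_sqr le_eqVlt; apply/orP; left; apply/eqP; apply: ge0_ae_eq_integral => //.
- have m := L2_meas (F g - fanbeam_discr RE RD D g).
  by apply/measurable_EFinP/measurable_funX.
- by mfun.
- by move=> y _; rewrite lee_fin sqr_ge0.
- by move=> y _; rewrite lee_fin sqr_ge0.
apply: filterS (FE g (lip_Omega_Cc lg)) => y /= FEy _; congr (_ ^+ 2)%:E.
by rewrite -FEy.
Qed.

Lemma operator_error (F : L2Omega R -> L2Omega' RE RD) (e : R) : is_fanbeam F -> 0 < e < 2^-1 ->
  forall f, L2n (F f - fanbeam_discr RE RD D f) <= Num.sqrt (2 * sqr_error_cst RE RD D e) * L2n f.
Proof.
move=> hF he; have [Flin [C Fbd] _] := hF.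
have [K K0 hK] := L2n_discr_lip.
apply: (L2n_diff_dense (normr_ge0 C) K0 (sqrtr_ge0 _) Flin) => // [f|f d d0].
  have := Fbd f; rewrite !L2normE -EFinM lee_fin => /le_trans; apply.
  by apply: ler_wpM2r; [exact: L2n_ge0|exact: ler_norm].
have sf := L2Omega_sq_fun f.
have [_ /(_ (d ^+ 2) (exprn_gt0 2 d0)) [h lh hh]] := L2_dense (sq_meas sf) (sq_supp sf) (sq_fin sf).
have [g gh] := lip_Omega_L2 lh; exists g; last by apply: operator_error_lip => //; rewrite gh.
rewrite -(ler_sqr (L2n_ge0 _) (ltW d0)) -lee_fin -sqr_int_restrict; apply: le_trans hh.
rewrite le_eqVlt; apply/orP; left; apply/eqP; apply: eq_integral => x _; congr (_ ^+ 2)%:E.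
have := sq_restrict (lip_sq_fun lh) => {1}<-; rewrite -gh.
by rewrite !patchE; case: ifP => // _; rewrite subr0.
Qed.

End operator_error.

(** * Rates of convergence *)

Section rates.
Context {R : realType}.
Variables (RE RD : R).
Hypotheses (hRE : 1 < RE) (hRD : 0 < RD).
Local Notation W := (detector_width RE RD).
Local Notation C0 := (offset_lip_cst RE RD).

Lemma offset_lip_cst_ge0 : 0 <= C0.
Proof.
rewrite /offset_lip_cst divr_ge0 ?sqr_ge0// mulr_ge0//; first by rewrite mulr_ge0 ?(ltW hRD).
by have := hRE; lra.
Qed.

Definition mesh_ratio (D : discretization R) : R :=
  delta_x D / delta_xi RE RD D + delta_alpha D / delta_xi RE RD D.

(** What remains of [sqr_error_cst] after the mesh quantities are separated: with [r] the mesh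
    ratio, [lam * k / d^2 = r * (1 + C0 * r)], and the power of [3 * d] splits. The leading 2 is
    that of [fanbeam_error]. *)
Definition error_cst (e : R) : R :=
  2 * (3 * ray_norm_cst RE RD + 36 * (W + RD) ^+ 2 * fan_smoothing_cst RE RD e * 3 `^ (2 * e) +
    3 * (W + RD) ^+ 2 * (kernel_lip_cst RE RD * (RE + 1)) ^+ 2 * ray_norm_cst RE RD).

Definition error_bound (e : R) (D : discretization R) : R :=
  let d := delta_xi RE RD D in let r := mesh_ratio D in
  Num.sqrt (error_cst e * (d ^+ 2 + d `^ (2 * e) + (r * (1 + C0 * r)) ^+ 2)).

Lemma error_cst_ge0 e : 0 <= error_cst e.
Proof.
have rn := ray_norm_cst_ge0 hRE hRD.
rewrite /error_cst mulr_ge0//; apply: addr_ge0.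
  apply: addr_ge0; first exact: mulr_ge0.
  apply: mulr_ge0; last exact: powR_ge0.
  by apply: mulr_ge0; [rewrite mulr_ge0 ?sqr_ge0|exact: fan_smoothing_cst_ge0].
by apply: mulr_ge0 => //; rewrite mulr_ge0 ?sqr_ge0// mulr_ge0 ?sqr_ge0.
Qed.

Lemma sqr_error_cst_le (D : discretization R) e : admissible RE D ->
  Num.sqrt (2 * sqr_error_cst RE RD D e) <= error_bound e D.
Proof.
move=> hD; rewrite /error_bound /=; apply: ler_wsqrtr.
have rn := ray_norm_cst_ge0 hRE hRD; have fs := fan_smoothing_cst_ge0 hRE hRD e.
have d0 := delta_xi_gt0 hRE hRD hD.
have dE : discr_cst RE RD D = kernel_lip_cst RE RD * (RE + 1) * (mesh_ratio D * (1 + C0 * mesh_ratio D)).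
  rewrite /discr_cst /kernel_width /mesh_ratio; field; rewrite gt_eqF//.
rewrite /sqr_error_cst dE powRM ?ler0n// ?(ltW d0)//.
rewrite /error_cst.
set a := ray_norm_cst _ _; set b := fan_smoothing_cst _ _ _; set k := kernel_lip_cst _ _ * _.
set r := mesh_ratio D * _; set t := 3 `^ _; set s := _ `^ _; set S := W + RD; set d := delta_xi _ _ _.
have t0 : 0 <= t by exact: powR_ge0.
have s0 : 0 <= s by exact: powR_ge0.
set A := 3 * a; set B := 36 * S ^+ 2 * b * t; set C := 3 * S ^+ 2 * k ^+ 2 * a.
have A0 : 0 <= A by rewrite mulr_ge0.
have B0 : 0 <= B by apply: mulr_ge0 => //; apply: mulr_ge0 => //; rewrite mulr_ge0 ?sqr_ge0.
have K0 : 0 <= C by apply: mulr_ge0 => //; rewrite mulr_ge0 ?sqr_ge0// mulr_ge0 ?sqr_ge0.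
have -> : 2 * (3 * d ^+ 2 * a + (18 * S ^+ 2 * (2 * b * (t * s)) + 3 * S ^+ 2 * (k * r) ^+ 2 * a)) =
  2 * (A * d ^+ 2 + B * s + C * r ^+ 2) by rewrite /A /B /C; ring.
rewrite -mulrA ler_wpM2l//.
have d2 := sqr_ge0 d; have r2 := sqr_ge0 r.
move: (d ^+ 2) (r ^+ 2) d2 r2 A0 B0 K0 => x y x0 y0; move: A B C => A B C A0 B0 K0.
have := mulr_ge0 A0 s0; have := mulr_ge0 A0 y0; have := mulr_ge0 B0 x0; have := mulr_ge0 B0 y0.
have := mulr_ge0 K0 x0; have := mulr_ge0 K0 s0; lra.
Qed.

Lemma opdist_fanbeam_le F (D : discretization R) e : is_fanbeam F -> admissible RE D -> 0 < e < 2^-1 ->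
  (opdist F (fanbeam_discr RE RD D) <= (error_bound e D)%:E)%E.
Proof.
move=> hF hD he; apply: opdist_le; first exact: sqrtr_ge0.
move=> f; apply: le_trans (operator_error hRE hRD hD hF he f) _.
by rewrite ler_wpM2r ?L2n_ge0// sqr_error_cst_le.
Qed.

Lemma opdist_adjoint_le F Fadj (D : discretization R) Dadj e :
  is_fanbeam F -> is_adjoint F Fadj -> admissible RE D -> is_adjoint (fanbeam_discr RE RD D) Dadj ->
  0 < e < 2^-1 -> (opdist Fadj Dadj <= (error_bound e D)%:E)%E.
Proof.
move=> hF hFa hD hDa he; apply: opdist_le; first exact: sqrtr_ge0.
apply: (adjoint_diff_le (sqrtr_ge0 _) hFa hDa) => f.
apply: le_trans (operator_error hRE hRD hD hF he f) _.
by rewrite ler_wpM2r ?L2n_ge0// sqr_error_cst_le.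
Qed.

(** Convergence needs just one exponent between 0 and [1/2]; for [1/4] the power [d^(2 e)] is the
    square root of [d], whose continuity is at hand. *)
Lemma error_bound_cvg (I : Type) (U : set_system I) (hU : ProperFilter U)
    (D : I -> discretization R) :
  (forall i, admissible RE (D i)) ->
  delta_xi RE RD (D i) @[i --> U] --> (0 : R) ->
  delta_x (D i) / delta_xi RE RD (D i) @[i --> U] --> (0 : R) ->
  delta_alpha (D i) / delta_xi RE RD (D i) @[i --> U] --> (0 : R) ->
  error_bound 4^-1 (D i) @[i --> U] --> (0 : R).
Proof.
move=> hD hxi hx ha.
have sE i : delta_xi RE RD (D i) `^ (2 * 4^-1) = Num.sqrt (delta_xi RE RD (D i)).
  have d0 := delta_xi_gt0 hRE hRD (hD i).
  by rewrite (_ : 2 * 4^-1 = 2^-1); [rewrite powR12_sqrt// ltW|lra].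
have hr : mesh_ratio (D i) @[i --> U] --> (0 : R).
  by rewrite -(addr0 (0 : R)); exact: cvgD.
have hs : Num.sqrt (delta_xi RE RD (D i)) @[i --> U] --> (0 : R).
  rewrite -[X in _ --> X](sqrtr0 R); apply: continuous_cvg hxi.
  exact: sqrt_continuous.
have sq0 (f : I -> R) : f @ U --> (0 : R) -> f i ^+ 2 @[i --> U] --> (0 : R).
  move=> hf; have -> : (fun i => f i ^+ 2) = (fun i => f i * f i).
    by apply: boolp.funext => i; rewrite expr2.
  by rewrite -(mul0r (0 : R)); exact: cvgM.
have hd2 := sq0 _ hxi.
have hq : mesh_ratio (D i) * (1 + C0 * mesh_ratio (D i)) @[i --> U] --> (0 : R).
  rewrite -(mul0r (1 + C0 * 0)); apply: cvgM => //.
  by apply: cvgD; [exact: cvg_cst|apply: cvgMr].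
have hq2 := sq0 _ hq.
have hB : error_cst 4^-1 * (delta_xi RE RD (D i) ^+ 2 + delta_xi RE RD (D i) `^ (2 * 4^-1) +
    (mesh_ratio (D i) * (1 + C0 * mesh_ratio (D i))) ^+ 2) @[i --> U] --> (0 : R).
  rewrite -(mulr0 (error_cst 4^-1)); apply: cvgMr.
  rewrite -(addr0 (0 : R)); apply: cvgD => //.
  rewrite -(addr0 (0 : R)); apply: cvgD => //.
  by under eq_cvg do rewrite sE.
rewrite -[X in _ --> X](sqrtr0 R); apply: continuous_cvg hB.
exact: sqrt_continuous.
Qed.

(** Since [d] never exceeds the detector width [W], higher powers reduce to [d^e]:
    [d <= W^(1 - e) * d^e], and the mesh ratio inside [1 + C0 * r] is at most [k * W^e]. Hence the
    constant does not depend on the discretization. *)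
Lemma error_bound_rate (D : discretization R) (e k : R) : admissible RE D -> 0 < e < 2^-1 -> 0 <= k ->
  mesh_ratio D <= k * delta_xi RE RD D `^ e ->
  error_bound e D <= Num.sqrt (error_cst e * ((W `^ (1 - e)) ^+ 2 + 1 +
    (k * (1 + C0 * (k * W `^ e))) ^+ 2)) * delta_xi RE RD D `^ e.
Proof.
move=> hD /andP[e0 e2] k0 hr.
have d0 := delta_xi_gt0 hRE hRD hD.
have dW : delta_xi RE RD D <= W by exact: (delta_xi_le hRE hRD hD).
have c0 := offset_lip_cst_ge0.
have r0 : 0 <= mesh_ratio D.
  by rewrite addr_ge0// divr_ge0 ?(ltW d0) ?(ltW (delta_x_gt0 hD)) ?(delta_alpha_ge0 hD).
rewrite /error_bound /=; move: hr; set r := mesh_ratio D; set d := delta_xi _ _ _ => hr.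
set s := d `^ e in hr *; have s0 : 0 <= s by exact: powR_ge0.
rewrite -[X in _ <= _ * X](ger0_norm s0) -sqrtr_sqr -sqrtrM; last first.
  by rewrite mulr_ge0 ?error_cst_ge0// addr_ge0 ?sqr_ge0// addr_ge0 ?sqr_ge0.
apply: ler_wsqrtr; rewrite -[leRHS]mulrA; apply: ler_wpM2l; first exact: error_cst_ge0.
rewrite [leRHS]mulrDl [X in _ <= X + _]mulrDl mul1r.
have sW : s <= W `^ e by apply: ge0_ler_powR; rewrite ?nnegrE ?(ltW e0) ?(ltW d0)// (le_trans (ltW d0) dW).
apply: lerD; [apply: lerD|].
- rewrite -exprMn ler_sqr ?nnegrE ?(ltW d0) ?mulr_ge0 ?powR_ge0//.
  apply: le_trans (_ : d `^ (1 - e) * s <= _).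
    rewrite -powRD; last by apply/implyP => _; rewrite gt_eqF.
    by rewrite subrK powRr1// ltW.
  rewrite ler_wpM2r//; apply: ge0_ler_powR; rewrite ?nnegrE ?(ltW d0)//; first lra.
  by rewrite (le_trans (ltW d0) dW).
- by rewrite /s -powR_mulrn ?powR_ge0// -powRrM mulrC.
- rewrite -exprMn ler_sqr ?nnegrE; last 2 first.
  + by rewrite mulr_ge0// addr_ge0// mulr_ge0.
  + apply: mulr_ge0 => //; apply: mulr_ge0 => //.
    by rewrite addr_ge0// mulr_ge0// mulr_ge0 ?powR_ge0.
  rewrite [leRHS]mulrAC; apply: ler_pM; [exact: r0|by rewrite addr_ge0// mulr_ge0|exact: hr|].
  rewrite lerD2l ler_wpM2l//; apply: le_trans hr _.
  by rewrite ler_wpM2l.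
Qed.

End rates.

Theorem theorem3p11 (R : realType) (RE RD : R) (hRE : 1 < RE) (hRD : RE + 1 < RD)
  (F : L2Omega R -> L2Omega' RE RD) (hF : is_fanbeam F)
  (Fadj : L2Omega' RE RD -> L2Omega R) (hFadj : is_adjoint F Fadj)
  (I : Type) (U : set_system I) (hU : ProperFilter U)
  (D : I -> discretization R) (hD : forall i : I, admissible RE (D i))
  (Dadj : I -> L2Omega' RE RD -> L2Omega R)
  (hDadj : forall i : I, is_adjoint (fanbeam_discr RE RD (D i)) (Dadj i))
  (hxi : delta_xi RE RD (D i) @[i --> U] --> (0 : R))
  (hx : delta_x (D i) / delta_xi RE RD (D i) @[i --> U] --> (0 : R))
  (halpha : delta_alpha (D i) / delta_xi RE RD (D i) @[i --> U] --> (0 : R)) :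
  [/\ opdist F (fanbeam_discr RE RD (D i)) @[i --> U] --> 0%E,
      opdist Fadj (Dadj i) @[i --> U] --> 0%E &
      forall eps : R, 0 < eps < 2^-1 ->
      forall A : set I, U A ->
      (exists K : R, forall i : I, A i ->
         delta_alpha (D i) <= K * delta_xi RE RD (D i) `^ (1 + eps)) ->
      (exists K : R, forall i : I, A i ->
         delta_x (D i) <= K * delta_xi RE RD (D i) `^ (1 + eps)) ->
      exists C : R, forall i : I, A i ->
        delta_xi RE RD (D i) <= 4 / 3 * (Num.sqrt 2 - 1) ->
        delta_x (D i) < Num.sqrt 2 * (RE - 1) ->
        (opdist F (fanbeam_discr RE RD (D i)) <=
           (C * delta_xi RE RD (D i) `^ eps)%:E)%E /\
        (opdist Fadj (Dadj i) <=
           (C * delta_xi RE RD (D i) `^ eps)%:E)%E].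
Proof.
have RD0 : 0 < RD by lra.
have bd e i (he : 0 < e < 2^-1) := opdist_fanbeam_le hRE RD0 hF (hD i) he.
have bda e i (he : 0 < e < 2^-1) := opdist_adjoint_le hRE RD0 hF hFadj (hD i) (hDadj i) he.
have e4 : 0 < (4^-1 : R) < 2^-1 by apply/andP; split; lra.
have b0 : (error_bound RE RD 4^-1 (D i))%:E @[i --> U] --> 0%E.
  by apply: cvg_EFin; [exact: nearW|exact: (error_bound_cvg hRE RD0 hU hD)].
split.
- apply: squeeze_cvge (cvg_cst 0%E) b0.
  by apply: nearW => i; rewrite opdist_ge0 (bd _ _ e4).
- apply: squeeze_cvge (cvg_cst 0%E) b0.
  by apply: nearW => i; rewrite opdist_ge0 (bda _ _ e4).
move=> eps heps A _ [Ka ha] [Kx hx'].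
(* The constants in the hypotheses carry no sign, so absolute values are taken to obtain the
   nonnegative factor that [error_bound_rate] asks for. *)
have k0 : 0 <= `|Kx| + `|Ka| by rewrite addr_ge0.
(* The constant is left open and is found by unification with [error_bound_rate]; it involves [RE],
   [RD], [eps], [Kx] and [Ka], but not the index [i]. *)
eexists => i Ai _ _.
have d0 := delta_xi_gt0 hRE RD0 (hD i).
have div (z K : R) : z <= K * delta_xi RE RD (D i) `^ (1 + eps) ->
    z / delta_xi RE RD (D i) <= `|K| * delta_xi RE RD (D i) `^ eps.
  rewrite powRD; last by apply/implyP => _; rewrite gt_eqF.
  rewrite powRr1 ?(ltW d0)// => h.
  rewrite ler_pdivrMr// -mulrA [_ `^ _ * _]mulrC; apply: le_trans h _.
  by rewrite ler_wpM2r ?ler_norm// mulr_ge0 ?powR_ge0// ltW.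
have hr : mesh_ratio RE RD (D i) <= (`|Kx| + `|Ka|) * delta_xi RE RD (D i) `^ eps.
  by rewrite /mesh_ratio mulrDl; apply: lerD; apply: div; [exact: hx'|exact: ha].
have := error_bound_rate hRE RD0 (hD i) heps k0 hr; rewrite -lee_fin => H.
by split; apply: le_trans H; [exact: bd|exact: bda].
Qed.
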